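(* Let $\mathbb{G}$ be a stratified group, let $\Omega\subset\mathbb{G}$ be open, let $u:\Omega\to\mathbb{R}$ be h-convex and let $x\in\Omega$. Then $u$ is h-differentiable at $x$ if and only if $\partial_Hu(x)=\{p\}$ for some $p\in H_1$, and in this case $\nabla_Hu(x)=p$.
   Context: Stratified group: $\mathbb{G}=H_1\oplus\cdots\oplus H_\iota$ is a finite dimensional graded vector space with a polynomial group operation given by the Baker-Campbell-Hausdorff formula (so $\mathbb{G}$ is identified with its stratified Lie algebra via exponential coordinates; the unit element is $0$, and the first layer $H_1$ generates the Lie algebra). Dilations: $\delta_r(x)=\sum_jr^jx_{(j)}$ if $x=\sum_jx_{(j)}$, $x_{(j)}\in H_j$. A scalar product $\langle\cdot,\cdot\rangle$ is fixed on $\mathbb{G}$ making the $H_j$ mutually orthogonal; $\pi_1:\mathbb{G}\to H_1$ is the orthogonal projection. A homogeneous distance $d$ is fixed: a continuous metric with $d(ux,uy)=d(x,y)$ and $d(\delta_rx,\delta_ry)=r\,d(x,y)$ for $r>0$; $\|w\|=d(0,w)$. For $h\in H_1$ put $[0,h]=\{th:0\le t\le1\}$ and $x\cdot[0,h]=\{x\delta_th:0\le t\le1\}$. A function $u:\Omega\to\mathbb{R}$ is h-convex if for all $x,y\in\Omega$ with $x^{-1}y\in H_1$ and $x\cdot[0,x^{-1}y]\subset\Omega$ one has $u(x\delta_\lambda(x^{-1}y))\le\lambda u(y)+(1-\lambda)u(x)$ for all $\lambda\in[0,1]$. All h-convex functions are assumed measurable; they are then locally Lipschitz with respect to $d$ (Rickly).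 The h-subdifferential $\partial_Hu(x)$ is the set of $p\in H_1$ such that $u(xh)\ge u(x)+\langle p,h\rangle$ whenever $h\in H_1$ and $[0,h]\subset x^{-1}\Omega$. A linear map $L$ on $\mathbb{G}$ is h-linear if $L(x)=L(\pi_1(x))$ for all $x$. $u$ is h-differentiable at $x$ if there is an h-linear $L:\mathbb{G}\to\mathbb{R}$ with $u(xz)=u(x)+L(z)+o(\|z\|)$; then $\nabla_Hu(x)\in H_1$ is the vector representing $L$ with respect to $\langle\cdot,\cdot\rangle$. *)

(* Defs.v *)
From mathcomp Require Import all_boot all_order all_algebra.
From mathcomp Require Import all_classical all_reals all_analysis.

Set Implicit Arguments.
Unset Strict Implicit.
Unset Printing Implicit Defensive.

Import Order.TTheory GRing.Theory Num.Theory.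
Import numFieldNormedType.Exports.

Local Open Scope classical_set_scope.
Local Open Scope ring_scope.

(* [:: v1; ...; vm] |-> [v1, [v2, ... [v_(m-1), vm]...]] *)
Fixpoint nested_bracket (V : nmodType) (br : V -> V -> V) (s : seq V) : V :=
  match s with
  | [::] => 0
  | [:: v] => v
  | v :: s' => br v (nested_bracket br s')
  end.

(* Baker-Campbell-Hausdorff product in Dynkin's form
     sum_k (-1)^(k-1) / k * sum_(r_i + s_i > 0)
       [x^r_1 y^s_1 ... x^r_k y^s_k]
         / ((sum_i (r_i + s_i)) * prod_i (r_i! s_i!)),
   with k, r_i, s_i at most N. In a Lie algebra that is nilpotent of step at
   most N the omitted terms are brackets of more than N vectors, hence 0. *)
Definition bch (R : fieldType) (V : lmodType R) (br : V -> V -> V) (N : nat)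
    (x y : V) : V :=
  \sum_(1 <= k < N.+1)
    \sum_(f : {ffun 'I_k -> 'I_N.+1 * 'I_N.+1}
            | [forall i, (0 < (f i).1 + (f i).2)%N])
      ((-1) ^+ k.-1 /
        (k * (\sum_i ((f i).1 + (f i).2)) *
         \prod_i (((f i).1)`! * ((f i).2)`!))%:R) *:
      nested_bracket br
        (flatten [seq nseq (f i).1 x ++ nseq (f i).2 y | i <- enum 'I_k]).

(* A stratified group in exponential coordinates, on the vector space R^n.
   The layers H_1, ..., H_step are arbitrary subspaces, not necessarily spanned
   by coordinate vectors; [layer j] is 0 for the other values of j. *)
Record stratified_group (R : realType) (n : nat) := StratifiedGroup {
  lie : {bilinear 'rV[R]_n -> 'rV[R]_n -> 'rV[R]_n};
  liexx : forall x, lie x x = 0;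
  lie_jacobi : forall x y z,
    lie x (lie y z) + lie y (lie z x) + lie z (lie x y) = 0;
  step : nat;
  layer : nat -> {vspace 'rV[R]_n};
  layer_out : forall j, ~~ (0 < j <= step)%N -> layer j = 0%VS;
  layer_sum : fullv = (\sum_(j < step) layer j.+1)%VS;
  layer_direct : directv (\sum_(j < step) layer j.+1)%VS;
  lie_layer : forall i j x y,
    x \in layer i -> y \in layer j -> lie x y \in layer (i + j)%N;
  layer1_generates : forall U : {vspace 'rV[R]_n},
    (layer 1 <= U)%VS ->
    (forall x y, x \in U -> y \in U -> lie x y \in U) -> U = fullv;
  gmul : 'rV[R]_n -> 'rV[R]_n -> 'rV[R]_n;
  ginv : 'rV[R]_n -> 'rV[R]_n;
  gmulA : associative gmul;
  gmul0g : left_id 0 gmul;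
  gmulg0 : right_id 0 gmul;
  gmulVg : left_inverse 0 ginv gmul;
  gmulgV : right_inverse 0 ginv gmul;
  gmul_bch : forall x y, gmul x y = bch lie step x y
}.

Section StratifiedGroupTheory.
Context (R : realType) (n : nat) (G : stratified_group R n).
Local Notation V := 'rV[R]_n.
Local Notation H1 := (layer G 1).

Definition dilation (r : R) (x : V) : V :=
  \sum_(j < step G) r ^+ j.+1 *: sumv_pi_for (layer_sum G) j x.

Definition layers_orthogonal (ip : {dot V for idfun}) : Prop :=
  forall i j x y, i != j -> x \in layer G i -> y \in layer G j -> ip x y = 0.

Record homogeneous_distance (d : V -> V -> R) : Prop := HomogeneousDistance {
  hdist_continuous : continuous (fun z : V * V => d z.1 z.2);
  hdist_eq0 : forall x y, d x y = 0 <-> x = y;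
  hdist_sym : forall x y, d x y = d y x;
  hdist_triangle : forall x y z, d x z <= d x y + d y z;
  hdist_left_invariant : forall w x y, d (gmul G w x) (gmul G w y) = d x y;
  hdist_dilation : forall r x y,
    0 < r -> d (dilation r x) (dilation r y) = r * d x y
}.

(* [0, h] *)
Definition hsegment (h : V) : set V := [set t *: h | t in `[0, 1]].

(* x . [0, h] *)
Definition translated_hsegment (x h : V) : set V :=
  [set gmul G x (dilation t h) | t in `[0, 1]].

(* u is a total function, of which only the restriction to Om matters. *)
Definition hconvex (Om : set V) (u : V -> R) : Prop :=
  forall x y, Om x -> Om y ->
    let h := gmul G (ginv G x) y in
    h \in H1 -> translated_hsegment x h `<=` Om ->
    forall l, 0 <= l <= 1 ->
      u (gmul G x (dilation l h)) <= l * u y + (1 - l) * u x.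

Definition hsubdifferential (ip : {dot V for idfun}) (Om : set V) (u : V -> R)
    (x : V) : set V :=
  [set p | p \in H1 /\
    forall h, h \in H1 -> hsegment h `<=` gmul G (ginv G x) @` Om ->
      u x + ip p h <= u (gmul G x h)].

(* The orthogonal projection onto H_1: projection along its orthogonal. *)
Definition pi1 (ip : {dot V for idfun}) : 'End(V) :=
  daddv_pi H1 (orthov ip H1).

Definition hlinear (ip : {dot V for idfun}) (L : {scalar V}) : Prop :=
  forall z, L z = L (pi1 ip z).

Definition is_hdifferential (ip : {dot V for idfun}) (d : V -> V -> R)
    (u : V -> R) (x : V) (L : {scalar V}) : Prop :=
  hlinear ip L /\
  (fun z => u (gmul G x z) - u x - L z) =o_ (nbhs (0 : V)) (fun z => d 0 z).

Definition hdifferentiable (ip : {dot V for idfun}) (d : V -> V -> R)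
    (u : V -> R) (x : V) : Prop :=
  exists L : {scalar V}, is_hdifferential ip d u x L.

Definition hgradient (ip : {dot V for idfun}) (d : V -> V -> R)
    (u : V -> R) (x : V) : V :=
  xget 0 [set p | p \in H1 /\
    exists2 L : {scalar V}, is_hdifferential ip d u x L &
      forall z, L z = ip p z].

End StratifiedGroupTheory.

Section LebesgueMeasurability.
Context (R : realType) (n : nat).
Local Notation V := 'rV[R]_n.

Definition box (a b : V) : set V := [set z | forall i, a 0 i <= z 0 i <= b 0 i].

(* Covers are indexed by an arbitrary set D of naturals, so that set0 is
   negligible also when n = 0, where every box has volume 1. *)
Definition lebesgue_negligible (N : set V) : Prop :=
  forall e : R, 0 < e -> exists (D : set nat) (a b : nat -> V),
    [/\ forall k i, a k 0 i <= b k 0 i,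
        N `<=` \bigcup_(k in D) box (a k) (b k) &
        (\esum_(k in D) (\prod_i (b k 0 i - a k 0 i))%:E <= e%:E)%E].

(* The completion of the Borel sigma-algebra of R^n. *)
Definition lebesgue_measurable_set (A : set V) : Prop :=
  exists X N : set V,
    [/\ <<s (@open V) >> X, lebesgue_negligible N & A = X `|` N].

Definition lebesgue_measurable_fun (Om : set V) (u : V -> R) : Prop :=
  forall Y : set R, measurable Y -> lebesgue_measurable_set (Om `&` u @^-1` Y).

End LebesgueMeasurability.

(* Main.v *)
Require Import Defs.
From HB Require Import structures.
From mathcomp Require Import all_boot all_order all_algebra.
From mathcomp Require Import all_classical all_reals all_analysis.
From mathcomp Require Import measurable_realfun.
From mathcomp Require Import lra ring zify.

Set Implicit Arguments.
Unset Strict Implicit.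
Unset Printing Implicit Defensive.

Import Order.TTheory GRing.Theory Num.Theory.
Import numFieldNormedType.Exports.

Local Open Scope classical_set_scope.
Local Open Scope ring_scope.

(** If [u] has the h-differential [L] at [x], then [L] is the only possible
    subgradient, and it is one because the secant slopes of a convex function on a
    line increase ([differential_subdifferential]). The substance is the converse.

    The difference quotients [q_r(z) = (u(x d_r z) - u(x)) / r], where [d_r] is the
    dilation, are equi-Lipschitz for small [r], since [u] is locally Lipschitz with
    respect to [d] ([local_lipschitz]). Their upper limit [U] at [r = 0]
    ([blowup]) is h-convex on the whole group, homogeneous and Lipschitz. Comparing
    slopes on a horizontal line with the slope at infinity gives
    [U(z h) <= U(z) + U(h)] for horizontal [h] ([sublinear_add]), with equality if
    [U(-h) = -U(h)]. Blowing up [U] again at a horizontal [h0] produces a function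
    of the same kind that is below [U] on the first layer, agrees with [U] at [h0],
    is odd there and stays odd where [U] was ([sublinear_blowup]). After blowing up
    at each member of a finite set of horizontal vectors that generates the group,
    the result is a homomorphism to the reals, hence a linear function of the first
    component ([sublinear_linear]). So for every [h0] there is a subgradient of [u]
    at [x] whose value at [h0] is [U(h0)]. If the subdifferential is a point [p],
    then [U = p] on the first layer, and then [U] itself is odd there and equals [p]
    composed with the projection ([blowup_unique]). Lower limits follow from upper
    limits by [q_r(z h) >= 2 q_r(z) - q_r(z h^-1)] along a word for [z] ([quot_cvg]),
    and compactness of the unit sphere makes the convergence uniform.

    Local Lipschitz continuity is obtained from a local upper bound as for convex
    functions on a vector space, words in horizontal letters replacing segments
    ([generation]). For the upper bound, [u(x)] is at most the maximum of [u] over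
    the [2^k] points [x (e_1 t_1 h_1) ... (e_k t_k h_k)] with signs [e_i]
    ([tree_bound]). The sets [u > j] have small measure locally, and the [2^k] maps
    taking [t] to these points do not collapse a suitable [n]-dimensional family of
    parameters ([signed_words]), so that some [t] makes all these points avoid
    [u > j] ([local_upper_bound]). This requires words that are submersions
    ([velocities_span]): the tangent directions that a word of maximal rank
    produces form a space invariant under conjugation, hence under brackets with
    the first layer, hence everything. *)

(** * Polynomial functions and their difference quotients *)

Section PolynomialFunctions.
Context (R : realType).

Inductive polyfun (I T : Type) (c : I -> T -> R) : (T -> R) -> Prop :=
| polyfun_cst a : polyfun c (fun=> a)
| polyfun_var i : polyfun c (c i)
| polyfun_add f g :
    polyfun c f -> polyfun c g -> polyfun c (fun x => f x + g x)
| polyfun_mul f g :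
    polyfun c f -> polyfun c g -> polyfun c (fun x => f x * g x).

Lemma polyfun_ext (I T : Type) (c : I -> T -> R) f g :
  (forall x, f x = g x) -> polyfun c f -> polyfun c g.
Proof. by move=> /funext ->. Qed.

Lemma polyfun_comp (I J S T : Type) (c : I -> T -> R) (c' : J -> S -> R)
    (F : S -> T) f :
  (forall i, polyfun c' (c i \o F)) -> polyfun c f -> polyfun c' (f \o F).
Proof.
move=> cF; elim=> [a|i|{}f g _ IHf _ IHg|{}f g _ IHf _ IHg].
- exact: polyfun_cst.
- exact: cF.
- exact: (polyfun_add IHf IHg).
- exact: (polyfun_mul IHf IHg).
Qed.

Lemma polyfun_sum (I T J : Type) (c : I -> T -> R) (r : seq J) (P : pred J)
    (F : J -> T -> R) :
  (forall j, P j -> polyfun c (F j)) ->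
  polyfun c (fun x => \sum_(j <- r | P j) F j x).
Proof.
move=> cF; elim: r => [|j r IH].
  by apply: polyfun_ext (polyfun_cst c 0) => x; rewrite big_nil.
have [Pj|Pj] := boolP (P j).
  by apply: polyfun_ext (polyfun_add (cF _ Pj) IH) => x; rewrite big_cons Pj.
by apply: polyfun_ext IH => x; rewrite big_cons (negbTE Pj).
Qed.

Lemma polyfun_prod (I T J : Type) (c : I -> T -> R) (r : seq J) (P : pred J)
    (F : J -> T -> R) :
  (forall j, P j -> polyfun c (F j)) ->
  polyfun c (fun x => \prod_(j <- r | P j) F j x).
Proof.
move=> cF; elim: r => [|j r IH].
  by apply: polyfun_ext (polyfun_cst c 1) => x; rewrite big_nil.
have [Pj|Pj] := boolP (P j).
  by apply: polyfun_ext (polyfun_mul (cF _ Pj) IH) => x; rewrite big_cons Pj.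
by apply: polyfun_ext IH => x; rewrite big_cons (negbTE Pj).
Qed.

Lemma polyfun_det (I T : Type) (c : I -> T -> R) n (A : T -> 'M[R]_n) :
  (forall i j, polyfun c (fun x => A x i j)) -> polyfun c (fun x => \det (A x)).
Proof.
move=> cA; apply: polyfun_sum => s _; apply: polyfun_mul.
  exact: polyfun_cst.
exact: polyfun_prod.
Qed.

Lemma polyfun_mulmx (I T : Type) (c : I -> T -> R) m n p
    (A : T -> 'M[R]_(m, n)) (B : T -> 'M[R]_(n, p)) :
  (forall i j, polyfun c (fun x => A x i j)) ->
  (forall i j, polyfun c (fun x => B x i j)) ->
  forall i j, polyfun c (fun x => (A x *m B x) i j).
Proof.
move=> cA cB i j; apply: (@polyfun_ext _ _ _ (fun x => \sum_k A x i k * B x k j)).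
  by move=> x; rewrite mxE.
by apply: polyfun_sum => k _; apply: polyfun_mul.
Qed.

Lemma polyfun_continuous (I : Type) (T : topologicalType) (c : I -> T -> R) f :
  (forall i, continuous (c i)) -> polyfun c f -> continuous f.
Proof.
move=> cc; elim=> [a|i|{}f g _ IHf _ IHg|{}f g _ IHf _ IHg].
- by move=> x; exact: cvg_cst.
- exact: cc.
- by move=> x; apply: cvgD; [exact: IHf|exact: IHg].
- by move=> x; apply: cvgM; [exact: IHf|exact: IHg].
Qed.

Lemma polyfun_horner (f : R -> R) :
  polyfun (fun _ : unit => id) f -> exists p : {poly R}, forall s, f s = p.[s].
Proof.
elim=> [a|i|{}f g _ [p fp] _ [q gq]|{}f g _ [p fp] _ [q gq]].
- by exists a%:P => s; rewrite hornerC.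
- by exists 'X => s; rewrite hornerX.
- by exists (p + q) => s; rewrite hornerD fp gq.
- by exists (p * q) => s; rewrite hornerM fp gq.
Qed.

Definition affine_coords (I : Type) (V : lmodType R) (c : I -> V -> R) : Prop :=
  forall i a v s, c i (a + s *: v) = c i a + s * (c i (a + v) - c i a).

Lemma polyfun_line (I : Type) (V : lmodType R) (c : I -> V -> R) f a v :
  affine_coords c -> polyfun c f ->
  exists p : {poly R}, forall s, f (a + s *: v) = p.[s].
Proof.
move=> cc pf; apply: polyfun_horner.
apply: (@polyfun_comp _ _ _ _ _ _ (fun s : R => a + s *: v) f _ pf) => i.
apply: (@polyfun_ext _ _ _ (fun s => c i a + s * (c i (a + v) - c i a))).
  by move=> s; rewrite /= cc.
apply: polyfun_add; first exact: polyfun_cst.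
by apply: polyfun_mul; [exact: (polyfun_var _ tt)|exact: polyfun_cst].
Qed.

Lemma poly_nonroot_near (p : {poly R}) (e : R) :
  p != 0 -> 0 < e -> exists s, [/\ 0 < s, s < e & p.[s] != 0].
Proof.
move=> p0 e0; apply: contrapT => /forallNP H.
have roots (m : nat) : root p (e / m.+2%:R).
  have := H (e / m.+2%:R); apply: contra_notT => np; split => //.
    by rewrite divr_gt0.
  by rewrite ltr_pdivrMr ?ltr0n// ltr_pMr// ltr1n.
pose r := [seq e / m.+2%:R | m <- iota 0 (size p)].
have : (size r < size p)%N.
  apply: max_poly_roots => //; first by apply/allP => _ /mapP[m _ ->].
  rewrite map_inj_uniq ?iota_uniq// => a b /(mulfI (lt0r_neq0 e0))/invr_inj.
  by move/eqP; rewrite eqr_nat => /eqP [].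
by rewrite size_map size_iota ltnn.
Qed.

(** Nonzero polynomial functions have a common nonzero on a line through any
    prescribed point, arbitrarily close to it: if [a] works for the functions
    treated so far and [b] for the next one, then on the line through [a] and
    [b] each of them restricts to a nonzero polynomial in one variable. *)
Lemma polyfun_common_nonzero (I : Type) (V : lmodType R) (c : I -> V -> R)
    (J : finType) (f : J -> V -> R) (x0 : V) :
  affine_coords c -> (forall j, polyfun c (f j)) ->
  (forall j, exists a, f j a != 0) ->
  exists v, forall e : R, 0 < e ->
    exists s, [/\ 0 < s, s < e & forall j, f j (x0 + s *: v) != 0].
Proof.
move=> cc pf f0.
have prod_line (r : seq J) a v : exists p : {poly R},
    forall s, \prod_(j <- r) f j (a + s *: v) = p.[s].
  have := @polyfun_line _ _ c (fun x => \prod_(j <- r) f j x) a v cc.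
  by apply; apply: polyfun_prod.
have [a fa] : exists a, \prod_(j <- index_enum J) f j a != 0.
  elim: (index_enum J) => [|j r [a fa]].
    by exists 0; rewrite big_nil oner_neq0.
  have [b fb] := f0 j.
  have [p pE] := prod_line r a (b - a).
  have [q qE] := polyfun_line a (b - a) cc (pf j).
  have p0 : p != 0.
    by apply: contraNneq fa => p0; rewrite -[a]addr0 -(scale0r (b - a)) pE p0 horner0.
  have q0 : q != 0.
    apply: contraNneq fb => q0.
    by rewrite -[b](subrKC a) -(scale1r (b - a)) qE q0 horner0.
  have [s [_ _ ps]] := poly_nonroot_near (mulf_neq0 p0 q0) ltr01.
  exists (a + s *: (b - a)); rewrite big_cons pE qE.
  by move: ps; rewrite hornerM mulrC.
exists (a - x0) => e e0.
have [p pE] := prod_line (index_enum J) x0 (a - x0).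
have p0 : p != 0.
  apply: contraNneq fa => p0.
  by rewrite -[a](subrKC x0) -(scale1r (a - x0)) pE p0 horner0.
have [s [s0 se ps]] := poly_nonroot_near p0 e0; exists s; split=> // j.
by move: ps; rewrite -pE (bigD1 j)//= mulf_eq0 negb_or => /andP[].
Qed.

Definition mxcoord m n (ij : 'I_m * 'I_n) (A : 'M[R]_(m, n)) : R :=
  A ij.1 ij.2.

Definition paircoord (I J S T : Type) (c : I -> S -> R) (c' : J -> T -> R)
    (k : I + J) (z : S * T) : R :=
  match k with inl i => c i z.1 | inr j => c' j z.2 end.

Lemma mxcoord_affine m n : affine_coords (@mxcoord m n).
Proof. by move=> [i j] a v s; rewrite /mxcoord !mxE; ring. Qed.

Lemma paircoord_affine (I J : Type) (V W : lmodType R)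
    (c : I -> V -> R) (c' : J -> W -> R) :
  affine_coords c -> affine_coords c' -> affine_coords (paircoord c c').
Proof. by move=> hc hc' [i|j] a v s /=; rewrite (hc, hc'). Qed.

Lemma mxcoord_continuous m n ij : continuous (@mxcoord m n ij).
Proof. by move=> x; exact: coord_continuous. Qed.

Lemma paircoord_continuous (I J : Type) (S T : topologicalType)
    (c : I -> S -> R) (c' : J -> T -> R) :
  (forall i, continuous (c i)) -> (forall j, continuous (c' j)) ->
  forall k, continuous (paircoord c c' k).
Proof.
move=> cc cc' [i|j] z /=.
  by apply: (@continuous_comp _ _ _ fst (c i)); [exact: cvg_fst|exact: cc].
by apply: (@continuous_comp _ _ _ snd (c' j)); [exact: cvg_snd|exact: cc'].
Qed.

Definition polymap (I T : Type) (c : I -> T -> R) m n (F : T -> 'M[R]_(m, n)) :=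
  forall i j, polyfun c (fun x => F x i j).

Lemma mx_continuous (T : topologicalType) m n (F : T -> 'M[R]_(m, n)) x :
  (forall i j, {for x, continuous (fun y => F y i j)}) -> {for x, continuous F}.
Proof.
move=> cF; apply/cvgrPdist_lt => e e0.
have H : \forall y \near x, forall i j, `|F x i j - F y i j| < e.
  apply: filter_forall => i; apply: filter_forall => j.
  by move: (cF i j) => /cvgrPdist_lt/(_ _ e0).
apply: filterS H => y H; rewrite [ltLHS]/Num.norm/= mx_normrE.
by apply/bigmax_ltP; split=> //= -[i j] _ /=; rewrite !mxE.
Qed.

Lemma polymap_continuous (I : Type) (T : topologicalType) (c : I -> T -> R) m n
    (F : T -> 'M[R]_(m, n)) :
  (forall i, continuous (c i)) -> polymap c F -> continuous F.
Proof.
move=> cc pF x; apply: mx_continuous => i j.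
exact: (polyfun_continuous cc (pF i j)).
Qed.

Lemma polymap_mxcoord m n : polymap (@mxcoord m n) id.
Proof. by move=> i j; exact: (polyfun_var _ (i, j)). Qed.

Definition slope_coord m := paircoord (@mxcoord 1 m) (@mxcoord 1 m).

Lemma polyfun_slope m (f : 'rV[R]_m -> R) : polyfun (@mxcoord 1 m) f ->
  exists D : 'I_m -> 'rV[R]_m * 'rV[R]_m -> R,
    (forall i, polyfun (@slope_coord m) (D i)) /\
    forall x y, f y - f x = \sum_i (y - x) 0 i * D i (x, y).
Proof.
elim=> [a|[i0 i]|{}f g _ [D [pD fD]] _ [E [pE gE]]
       |{}f g pf [D [pD fD]] pg [E [pE gE]]].
- exists (fun _ _ => 0); split => [i|x y]; first exact: polyfun_cst.
  by rewrite subrr big1// => i _; rewrite mulr0.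
- exists (fun j _ => (j == i)%:R); split => [j|x y]; first exact: polyfun_cst.
  rewrite (bigD1 i)//= eqxx mulr1 big1 ?addr0; last first.
    by move=> j /negbTE ->; rewrite mulr0.
  by rewrite /mxcoord !mxE ord1.
- exists (fun i z => D i z + E i z); split => [i|x y].
    exact: polyfun_add.
  rewrite (eq_bigr _ (fun i _ => mulrDr _ _ _)) big_split/= -fD -gE.
  by rewrite opprD addrACA.
- exists (fun i z => D i z * g z.2 + f z.1 * E i z); split => [i|x y].
    apply: polyfun_add; apply: polyfun_mul => //.
      by apply: polyfun_comp pg => j; exact: (polyfun_var _ (inr j)).
    by apply: polyfun_comp pf => j; exact: (polyfun_var _ (inl j)).
  rewrite (eq_bigr (fun i => ((y - x) 0 i * D i (x, y)) * g y +
      f x * ((y - x) 0 i * E i (x, y)))); last by move=> i _ /=; ring.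
  by rewrite big_split/= -mulr_suml -mulr_sumr -fD -gE; ring.
Qed.

(** Differential calculus of polynomial maps by exact difference quotients:
    the quotient [D] is polynomial, hence continuous, so [D (x, x)] is the
    derivative at [x], and bounds on [D] near the diagonal are at once Lipschitz
    bounds and strict differentiability. *)
Lemma polymap_slope m n (F : 'rV[R]_m -> 'rV[R]_n) : polymap (@mxcoord 1 m) F ->
  exists2 D : 'rV[R]_m * 'rV[R]_m -> 'M[R]_(m, n),
    polymap (@slope_coord m) D &
    forall x y, F y - F x = (y - x) *m D (x, y).
Proof.
move=> pF.
have /choice[D DP] : forall j : 'I_n, exists D : 'I_m -> 'rV[R]_m * 'rV[R]_m -> R,
    (forall i, polyfun (@slope_coord m) (D i)) /\
    forall x y, F y 0 j - F x 0 j = \sum_i (y - x) 0 i * D i (x, y).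
  by move=> j; apply: polyfun_slope; exact: pF.
exists (fun z => \matrix_(i, j) D j i z) => [i j|x y].
  by apply: (@polyfun_ext _ _ _ (D j i)) => [z|]; [rewrite mxE|apply: (DP j).1].
apply/rowP => j; rewrite !mxE (DP j).2.
by apply: eq_bigr => i _; rewrite !mxE.
Qed.

Lemma slope_coord_continuous m k : continuous (@slope_coord m k).
Proof. by apply: paircoord_continuous => i; exact: mxcoord_continuous. Qed.

End PolynomialFunctions.

(** * The Baker-Campbell-Hausdorff formula to second order *)

Section BakerCampbellHausdorff.
Context (R : realType) (n : nat).
Local Notation V := 'rV[R]_n.
Context (br : {bilinear V -> V -> V}).
Hypothesis brxx : forall x, br x x = 0.

Lemma br_anti x y : br y x = - br x y.
Proof.
have := brxx (x + y).
rewrite linearDl/= !linearDr/= !brxx add0r addr0 => /eqP.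
by rewrite addr_eq0 => /eqP ->; rewrite opprK.
Qed.

Definition bword (x y : V) (w : seq bool) : V :=
  nested_bracket br [seq if b then x else y | b <- w].

Lemma bword_cons b c w x y :
  bword x y (b :: c :: w) = br (if b then x else y) (bword x y (c :: w)).
Proof. by []. Qed.

Lemma bwordZ s x y w : bword (s *: x) (s *: y) w = s ^+ size w *: bword x y w.
Proof.
elim: w => [|b [|c w] IH]; first by rewrite scaler0.
  by rewrite /bword/= expr1; case: b.
rewrite !bword_cons IH linearZr_LR/= !exprSr -!scalerA.
by case: b; rewrite linearZl_LR/=.
Qed.

(** Remainders of the product at second order: they are of order at least three
    when both factors are scaled by the same small number. *)
Definition cubic (F : V -> V -> V) : Prop :=
  exists2 L : seq (R * seq bool), all (fun cw => 2 < size cw.2)%N L &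
    forall x y, F x y = \sum_(cw <- L) cw.1 *: bword x y cw.2.

Lemma cubic0 : cubic (fun _ _ => 0).
Proof. by exists [::] => // x y; rewrite big_nil. Qed.

Lemma cubicD F H : cubic F -> cubic H -> cubic (fun x y => F x y + H x y).
Proof.
move=> [L L3 FE] [L' L'3 HE]; exists (L ++ L'); first by rewrite all_cat L3.
by move=> x y; rewrite big_cat/= FE HE.
Qed.

Lemma cubic_ext F H : (forall x y, F x y = H x y) -> cubic F -> cubic H.
Proof. by move=> FH [L L3 FE]; exists L => // x y; rewrite -FH. Qed.

Lemma cubic_sum (J : Type) (r : seq J) (P : pred J) (F : J -> V -> V -> V) :
  (forall j, P j -> cubic (F j)) ->
  cubic (fun x y => \sum_(j <- r | P j) F j x y).
Proof.
move=> cF; elim: r => [|j r IH].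
  by apply: cubic_ext cubic0 => x y; rewrite big_nil.
have [Pj|Pj] := boolP (P j).
  by apply: cubic_ext (cubicD (cF _ Pj) IH) => x y; rewrite big_cons Pj.
by apply: cubic_ext IH => x y; rewrite big_cons (negbTE Pj).
Qed.

Lemma cubic_word c w : (2 < size w)%N -> cubic (fun x y => c *: bword x y w).
Proof.
by move=> w3; exists [:: (c, w)] => [/=|x y]; [rewrite w3|rewrite big_seq1].
Qed.

Section Dynkin.
Context (N k : nat).
Implicit Types f : {ffun 'I_k -> 'I_N.+1 * 'I_N.+1}.

Definition ddeg f := (\sum_i ((f i).1 + (f i).2))%N.

Definition dcoef f : R :=
  (-1) ^+ k.-1 / (k * ddeg f * \prod_i (((f i).1)`! * ((f i).2)`!))%:R.

Definition dword f : seq bool :=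
  flatten [seq nseq (f i).1 true ++ nseq (f i).2 false | i <- enum 'I_k].

Lemma size_dword f : size (dword f) = ddeg f.
Proof.
rewrite size_flatten /shape -map_comp sumnE big_map /ddeg big_enum/=.
by apply: eq_bigr => i _; rewrite size_cat !size_nseq.
Qed.

Lemma dynkin_term f x y :
  nested_bracket br
    (flatten [seq nseq (f i).1 x ++ nseq (f i).2 y | i <- enum 'I_k])
  = bword x y (dword f).
Proof.
rewrite /bword /dword map_flatten -map_comp; congr (nested_bracket _ (flatten _)).
by apply: eq_map => i /=; rewrite map_cat !map_nseq.
Qed.

Definition nontrivial f := [forall i, (0 < (f i).1 + (f i).2)%N].

Lemma leq_ddeg f : nontrivial f -> (k <= ddeg f)%N.
Proof.
move=> /forallP f0; rewrite -[leqLHS]card_ord -sum1_card.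
exact: leq_sum.
Qed.

Definition dsum x y := \sum_(f | nontrivial f) dcoef f *: bword x y (dword f).

End Dynkin.

Lemma cubic_dsum N k : (2 < k)%N -> cubic (@dsum N k).
Proof.
move=> k3; apply: cubic_sum => f f0; apply: cubic_word.
by rewrite size_dword (leq_trans k3)// leq_ddeg.
Qed.

(** In the terms with two blocks and two factors each block is a single letter;
    exchanging the blocks changes the sign of the bracket and nothing else, so
    that these terms cancel. *)
Lemma cubic_dsum2 N : cubic (@dsum N 2).
Proof.
pose deg2 (f : {ffun 'I_2 -> 'I_N.+1 * 'I_N.+1}) := ddeg f == 2.
pose S x y := \sum_(f | nontrivial f && deg2 f) dcoef f *: bword x y (dword f).
have S0 x y : S x y = 0.
  pose sw (f : {ffun 'I_2 -> 'I_N.+1 * 'I_N.+1}) :=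
    [ffun i => f (rev_ord i)].
  have swK : involutive sw by move=> f; apply/ffunP => i; rewrite !ffunE rev_ordK.
  have r0 : rev_ord (ord0 : 'I_2) = lift ord0 ord0 by apply/val_inj.
  have r1 : rev_ord (lift ord0 ord0 : 'I_2) = ord0 by apply/val_inj.
  have degsw f : ddeg (sw f) = ddeg f.
    by rewrite /ddeg !big_ord_recl !big_ord0 !ffunE r0 r1 !addn0 addnC.
  have ntsw f : nontrivial (sw f) = nontrivial f.
    apply/forallP/forallP => [H i|H i]; last by rewrite ffunE.
    by have := H (rev_ord i); rewrite ffunE rev_ordK.
  have coefsw f : dcoef (sw f) = dcoef f.
    rewrite /dcoef degsw; congr (_ / (_ * _)%:R).
    by rewrite !big_ord_recl !big_ord0 !ffunE r0 r1 !muln1 mulnC.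
  have wordsw f : nontrivial f -> deg2 f ->
      bword x y (dword (sw f)) = - bword x y (dword f).
    move=> /forallP f0; rewrite /deg2 /ddeg !big_ord_recl big_ord0 addn0.
    have /= := f0 ord0; have /= := f0 (lift ord0 ord0).
    rewrite /dword !enum_ordSl/= /dword !ffunE r0 r1.
    have -> : enum 'I_0 = [::] by apply: size0nil; rewrite size_enum_ord.
    rewrite /= !cats0.
    move: (nat_of_ord (f ord0).1) (nat_of_ord (f ord0).2).
    move: (nat_of_ord (f (lift ord0 ord0)).1) (nat_of_ord (f (lift ord0 ord0)).2).
    move=> [|[|c]] [|[|d]] [|[|a]] [|[|b]] //=; try lia;
      by move=> _ _ _; rewrite /bword/= ?brxx ?oppr0// br_anti ?opprK.
  have : S x y = - S x y.
    rewrite {1}/S (reindex_inj (inv_inj swK))/= -sumrN.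
    apply: eq_big => [f|f /andP[]]; first by rewrite ntsw /deg2 degsw.
    rewrite ntsw /deg2 degsw coefsw => f0 f2.
    by rewrite wordsw// scalerN.
  move/eqP; rewrite -addr_eq0 -mulr2n -scaler_nat scaler_eq0 pnatr_eq0/=.
  by move/eqP.
apply: (@cubic_ext (fun x y => \sum_(f | nontrivial f && ~~ deg2 f)
    dcoef f *: bword x y (dword f))) => [x y|].
  rewrite /dsum [RHS](bigID deg2)/= [X in _ = X + _](_ : _ = 0) ?add0r//.
  exact: S0.
apply: cubic_sum => f /andP[f0 f2]; apply: cubic_word.
by rewrite size_dword ltn_neqAle eq_sym f2 leq_ddeg.
Qed.

(** The terms with one block: three of them are the stated ones, the words [xx]
    and [yy] have bracket 0, and the others have at least three letters. *)
Lemma cubic_dsum1 N :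
  cubic (fun x y => @dsum N.+1 1 x y - (x + y + 2^-1 *: br x y)).
Proof.
pose P := ('I_N.+2 * 'I_N.+2)%type.
pose h (p : P) x y := ((p.1 + p.2) * (p.1`! * p.2`!))%:R^-1 *:
   bword x y (nseq p.1 true ++ nseq p.2 false).
have E x y : @dsum N.+1 1 x y = \sum_(p : P | (0 < p.1 + p.2)%N) h p x y.
  rewrite /dsum (reindex (fun p : P => [ffun => p] : {ffun 'I_1 -> P}))/=; last first.
    exists (fun f => f ord0) => [p _|f _]; first by rewrite ffunE.
    by apply/ffunP => i; rewrite ffunE (ord1 i).
  apply: eq_big => [p|p _].
    apply/forallP/idP => [/(_ ord0)|H i]; by rewrite ffunE.
  rewrite /dcoef /ddeg /dword enum_ordSl/=.
  have -> : enum 'I_0 = [::] by apply: size0nil; rewrite size_enum_ord.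
  rewrite /= cats0 !big_ord_recl !big_ord0 !ffunE/= addn0 muln1 mul1n.
  by rewrite expr0 mul1r.
pose o (i j : nat) : P := (inord i, inord j).
have oE i j : (i <= 1)%N -> (j <= 1)%N -> ((o i j).1 = i :> nat) * ((o i j).2 = j :> nat).
  by move=> i1 j1; rewrite !inordK// ltnS; lia.
have oN i j i' j' : (i <= 1)%N -> (j <= 1)%N -> (i' <= 1)%N -> (j' <= 1)%N ->
    (i, j) != (i', j') -> o i j != o i' j'.
  move=> i1 j1 i2 j2; apply: contraNneq => oo.
  by have := oE _ _ i1 j1; rewrite oo !(oE _ _ i2 j2) => -[-> ->].
apply: (@cubic_ext (fun x y => \sum_(p : P | [&& (0 < p.1 + p.2)%N,
   p != o 1%N 0%N, p != o 0%N 1%N & p != o 1%N 1%N]) h p x y)) => [x y|].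
  have h10 : h (o 1 0)%N x y = x by rewrite /h !oE//= invr1 scale1r.
  have h01 : h (o 0 1)%N x y = y by rewrite /h !oE//= invr1 scale1r.
  have h11 : h (o 1 1)%N x y = 2^-1 *: br x y by rewrite /h !oE.
  rewrite E [in RHS](bigD1 (o 1 0))%N ?oE//= h10.
  rewrite [in RHS](bigD1 (o 0 1))%N ?oE ?oN//= h01.
  rewrite [in RHS](bigD1 (o 1 1))%N ?oE ?oN//= h11.
  rewrite !addrA (addrC _ (\sum_(_ | _) _)) addrK.
  by apply: eq_bigl => p; rewrite !andbA.
apply: cubic_sum => -[a b] /and4P[/= ab0 n10 n01 n11].
have [ab3|ab2] := ltnP 2 (a + b).
  by apply: cubic_word; rewrite size_cat !size_nseq.
apply: (@cubic_ext (fun _ _ => 0)); last exact: cubic0.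
have no i j : (i <= 1)%N -> (j <= 1)%N -> (a, b) != o i j -> (a == i :> nat) && (b == j :> nat) = false.
  move=> i1 j1; apply: contraNF => /andP[/eqP ai /eqP bj].
  have [oi oj] := oE _ _ i1 j1.
  apply/eqP; congr pair; apply/val_inj.
    exact: etrans ai (esym oi).
  exact: etrans bj (esym oj).
move=> x y; rewrite /h/=.
have := no _ _ (leqnn _) (leq0n _) n10; have := no _ _ (leq0n _) (leqnn _) n01.
have := no _ _ (leqnn _) (leqnn _) n11.
move: ab0 ab2 {no n10 n01 n11}.
move: (nat_of_ord a) (nat_of_ord b) => {a b}.
move=> [|[|[|a]]] [|[|[|b]]] //= ab0 ab2; try lia.
all: by move=> *; rewrite /bword/= brxx scaler0.
Qed.

(** Besides associativity, this form of the product is all that the theory of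
    the group rests on. *)
Lemma bch_expansion N :
  cubic (fun x y => bch br N.+1 x y - (x + y + 2^-1 *: br x y)).
Proof.
have bchE x y : bch br N.+1 x y = \sum_(1 <= k < N.+2) @dsum N.+1 k x y.
  by apply: eq_bigr => k _; apply: eq_bigr => f _; rewrite dynkin_term.
apply: (@cubic_ext (fun x y => (@dsum N.+1 1 x y - (x + y + 2^-1 *: br x y)) +
    \sum_(2 <= k < N.+2) @dsum N.+1 k x y)).
  by move=> x y; rewrite bchE [in RHS]big_ltn// addrAC.
apply: cubicD; first exact: cubic_dsum1.
apply: (@cubic_ext (fun x y => \sum_(k <- index_iota 2 N.+2 | (1 < k)%N)
   @dsum N.+1 k x y)).
  move=> x y; rewrite big_seq_cond [RHS]big_seq; apply: eq_bigl => k.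
  by rewrite mem_index_iota; case: (ltnP 1 k); rewrite ?andbT.
apply: cubic_sum => k; rewrite leq_eqVlt => /orP[/eqP<-|].
  exact: cubic_dsum2.
exact: cubic_dsum.
Qed.

End BakerCampbellHausdorff.

(** * Stratified groups in exponential coordinates *)

Section StratifiedGroup.
Context (R : realType) (n : nat) (G : stratified_group R n).
Local Notation V := 'rV[R]_n.
Local Notation H1 := (layer G 1).
Local Notation "x ** y" := (gmul G x y) (at level 40, left associativity).

Lemma gmul_expansion : exists2 C, cubic (lie G) C &
  forall x y, x ** y = x + y + 2^-1 *: lie G x y + C x y.
Proof.
have := @gmul_bch _ _ G; have := layer_sum G; case: (step G) => [|N] V0 mulE.
  exists (fun _ _ => 0) => [|x y]; first exact: cubic0.
  have all0 (z w : V) : z = w.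
    suff z0 (v : V) : v = 0 by rewrite (z0 z) (z0 w).
    by apply/eqP; rewrite -memv0; have := memvf v; rewrite V0 big_ord0.
  exact: all0.
have [L L3 LE] := bch_expansion (@liexx _ _ G) N.
exists (fun x y => bch (lie G) N.+1 x y - (x + y + 2^-1 *: lie G x y)).
  by exists L.
by move=> x y; rewrite mulE addrC subrK.
Qed.

Lemma bword_line s t (h : V) w : (1 < size w)%N ->
  bword (lie G) (s *: h) (t *: h) w = 0.
Proof.
elim: w => [|b w IH] //; case: w IH => [|c [|e w]] IH // _.
  by case: b; case: c IH => _; rewrite /bword/= linearZl_LR/= linearZr_LR/= liexx !scaler0.
by rewrite bword_cons IH// linear0r.
Qed.

(** All brackets of multiples of [h] vanish, so lines are one-parameter
    subgroups. *)
Lemma gmul_line s t h : (s *: h) ** (t *: h) = (s + t) *: h.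
Proof.
have [C [L /allP L3 CE] ->] := gmul_expansion.
rewrite CE big_seq big1 => [|cw /L3 cw3]; last first.
  by rewrite bword_line ?scaler0// ltnW.
by rewrite linearZl_LR/= linearZr_LR/= liexx !scaler0 !addr0 scalerDl.
Qed.

Lemma gmulV x : x ** - x = 0.
Proof. by rewrite -[X in X ** _]scale1r -scaleN1r gmul_line subrr scale0r. Qed.

Lemma gmulNV x : - x ** x = 0.
Proof. by rewrite -{2}[x]opprK gmulV. Qed.

Lemma ginvE x : ginv G x = - x.
Proof. by rewrite -[LHS](gmulg0 G) -(gmulV x) gmulA gmulVg gmul0g. Qed.

Lemma gmulKV x y : - x ** (x ** y) = y.
Proof. by rewrite gmulA gmulNV gmul0g. Qed.

Lemma gmulVK x y : x ** (- x ** y) = y.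
Proof. by rewrite gmulA gmulV gmul0g. Qed.

Lemma goppM x y : - (x ** y) = - y ** - x.
Proof.
have E : x ** y ** (- y ** - x) = 0.
  by rewrite gmulA -(gmulA G x) gmulV gmulg0 gmulV.
by rewrite -[RHS](gmulKV (x ** y)) E gmulg0.
Qed.

Definition hcomp (j : 'I_(step G)) (x : V) : V := sumv_pi_for (layer_sum G) j x.

Lemma hcomp_sum x : x = \sum_j hcomp j x.
Proof. by rewrite /hcomp sumv_pi_sum// memvf. Qed.

Lemma hcomp_in j x : hcomp j x \in layer G j.+1.
Proof. exact: memv_sum_pi. Qed.

Lemma layer_notin j x : ~~ (0 < j <= step G)%N -> x \in layer G j -> x = 0.
Proof. by move=> /layer_out ->; rewrite memv0 => /eqP. Qed.

Lemma hcomp_layer i j x : x \in layer G i ->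
  hcomp j x = if i == j.+1 then x else 0.
Proof.
have [/andP[]|/layer_notin/[apply]->] := boolP (0 < i <= step G)%N; last first.
  by rewrite /hcomp linear0 if_same.
case: i => // i _ lei xi.
pose us (k : 'I_(step G)) : V := hcomp k x - (if k == Ordinal lei then x else 0).
have us_in k : true -> us k \in layer G k.+1.
  move=> _; rewrite memvB ?hcomp_in//.
  by case: eqP => [->//|_]; exact: mem0v.
have us0 : \sum_k us k = 0.
  by rewrite sumrB -hcomp_sum -big_mkcond/= big_pred1_eq subrr.
have /directv_sum_independent/(_ _ us_in us0 j erefl)/eqP := layer_direct G.
by rewrite subr_eq0 => /eqP ->; rewrite eqSS eq_sym -val_eqE.
Qed.

(** An identity that is additive in [x] may be checked on each layer. *)
Lemma layer_ind (P : V -> Prop) :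
  (forall x y, P x -> P y -> P (x + y)) ->
  (forall j x, (0 < j)%N -> x \in layer G j -> P x) -> forall x, P x.
Proof.
move=> PD Pl x; rewrite (hcomp_sum x); elim/big_ind: _ => //.
  by apply: (Pl 1%N) => //; exact: mem0v.
by move=> j _; apply: Pl (hcomp_in j x).
Qed.

(** [scaled_dilation r x] is [r^-1] times the dilation of [x] by [r], made
    sense of at [r = 0], where it is the projection onto the first layer. *)
Definition scaled_dilation (r : R) (x : V) : V :=
  \sum_(j < step G) r ^+ j *: hcomp j x.

Definition proj1 : V -> V := scaled_dilation 0.

Lemma dilation_scaled r x : dilation G r x = r *: scaled_dilation r x.
Proof.
by rewrite /dilation scaler_sumr; apply: eq_bigr => j _; rewrite scalerA exprS.
Qed.

Lemma scaled_dilationD r x y :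
  scaled_dilation r (x + y) = scaled_dilation r x + scaled_dilation r y.
Proof.
rewrite /scaled_dilation -big_split; apply: eq_bigr => j _ /=.
by rewrite /hcomp linearD scalerDr.
Qed.

Lemma scaled_dilationZ r a x :
  scaled_dilation r (a *: x) = a *: scaled_dilation r x.
Proof.
rewrite /scaled_dilation scaler_sumr; apply: eq_bigr => j _ /=.
by rewrite /hcomp linearZ/= !scalerA mulrC.
Qed.

Lemma scaled_dilation_layer r j x : x \in layer G j.+1 ->
  scaled_dilation r x = r ^+ j *: x.
Proof.
move=> xj; rewrite /scaled_dilation.
have [jn|nj] := ltnP j (step G); last first.
  rewrite (layer_notin _ xj) ?scaler0 ?ltnNge ?nj//.
  by rewrite big1// => i _; rewrite /hcomp linear0 scaler0.
rewrite (bigD1 (Ordinal jn))//= (hcomp_layer _ xj) eqxx big1 ?addr0// => i ij.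
rewrite (hcomp_layer _ xj) eqSS ifN ?scaler0//.
by rewrite eq_sym; apply: contraNneq ij => ij; apply/eqP/val_inj.
Qed.

Lemma dilationD r x y : dilation G r (x + y) = dilation G r x + dilation G r y.
Proof. by rewrite !dilation_scaled scaled_dilationD scalerDr. Qed.

Lemma dilationZ r a x : dilation G r (a *: x) = a *: dilation G r x.
Proof. by rewrite !dilation_scaled scaled_dilationZ !scalerA mulrC. Qed.

Lemma dilationr0 r : dilation G r 0 = 0.
Proof. by rewrite -[X in dilation G r X](scale0r (0 : V)) dilationZ scale0r. Qed.

Lemma dilation0r x : dilation G 0 x = 0.
Proof. by rewrite dilation_scaled scale0r. Qed.

Lemma dilation_layer r j x : (0 < j)%N -> x \in layer G j ->
  dilation G r x = r ^+ j *: x.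
Proof.
case: j => // j _ xj.
by rewrite dilation_scaled (scaled_dilation_layer _ xj) scalerA exprS.
Qed.

Lemma dilation_h r h : h \in H1 -> dilation G r h = r *: h.
Proof. by move=> hH; rewrite (dilation_layer _ _ hH)// expr1. Qed.

Lemma dilationA r s x : dilation G r (dilation G s x) = dilation G (r * s) x.
Proof.
elim/layer_ind: x => [x y IHx IHy|j x j0 xj].
  by rewrite !dilationD IHx IHy.
by rewrite !(dilation_layer _ j0 xj) dilationZ (dilation_layer _ j0 xj) scalerA
  exprMn mulrC.
Qed.

Lemma dilation1 x : dilation G 1 x = x.
Proof.
elim/layer_ind: x => [x y IHx IHy|j x j0 xj]; first by rewrite dilationD IHx IHy.
by rewrite (dilation_layer _ j0 xj) expr1n scale1r.
Qed.

Lemma dilationK r x : r != 0 -> dilation G r^-1 (dilation G r x) = x.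
Proof. by move=> r0; rewrite dilationA mulVf// dilation1. Qed.

Lemma dilationVK r x : r != 0 -> dilation G r (dilation G r^-1 x) = x.
Proof. by move=> r0; rewrite dilationA mulfV// dilation1. Qed.

Lemma dilation_lie r x y :
  dilation G r (lie G x y) = lie G (dilation G r x) (dilation G r y).
Proof.
elim/layer_ind: x => [x x' IHx IHx'|i x i0 xi].
  by rewrite !(linearDl, dilationD)/= IHx IHx'.
elim/layer_ind: y => [y y' IHy IHy'|j y j0 yj].
  by rewrite !(linearDr, dilationD)/= IHy IHy'.
rewrite (dilation_layer _ _ (lie_layer xi yj)) ?addn_gt0 ?i0//.
rewrite (dilation_layer _ i0 xi) (dilation_layer _ j0 yj).
by rewrite linearZl_LR/= linearZr_LR/= scalerA exprD.
Qed.

Lemma dilation_bword r x y w :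
  dilation G r (bword (lie G) x y w)
  = bword (lie G) (dilation G r x) (dilation G r y) w.
Proof.
elim: w => [|b [|c w] IH]; first by rewrite dilationr0.
  by case: b.
by rewrite !bword_cons dilation_lie IH; case: b.
Qed.

Lemma dilationM r x y :
  dilation G r (x ** y) = dilation G r x ** dilation G r y.
Proof.
have [C [L _ CE] mulE] := gmul_expansion.
rewrite !mulE !dilationD dilationZ dilation_lie !CE; congr (_ + _).
elim/big_rec2: _ => [|cw u v _ <-]; first by rewrite dilationr0.
by rewrite dilationD dilationZ dilation_bword.
Qed.

Lemma proj1D x y : proj1 (x + y) = proj1 x + proj1 y.
Proof. exact: scaled_dilationD. Qed.

Lemma proj1Z a x : proj1 (a *: x) = a *: proj1 x.
Proof. exact: scaled_dilationZ. Qed.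

Lemma proj1_h h : h \in H1 -> proj1 h = h.
Proof. by move=> hH; rewrite /proj1 (scaled_dilation_layer _ hH) scale1r. Qed.

Lemma proj1_layer j x : (1 < j)%N -> x \in layer G j -> proj1 x = 0.
Proof.
case: j => [|[|j]]// _ xj.
by rewrite /proj1 (scaled_dilation_layer _ xj) expr0n scale0r.
Qed.

Lemma proj1_in x : proj1 x \in H1.
Proof.
apply: rpred_sum => -[[|j] jn] _; last by rewrite expr0n scale0r mem0v.
by rewrite expr0 scale1r; exact: hcomp_in.
Qed.

Lemma proj1_lie x y : proj1 (lie G x y) = 0.
Proof.
elim/layer_ind: x => [x x' IHx IHx'|i x i0 xi].
  by rewrite linearDl/= proj1D IHx IHx' addr0.
elim/layer_ind: y => [y y' IHy IHy'|j y j0 yj].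
  by rewrite linearDr/= proj1D IHy IHy' addr0.
by apply: proj1_layer (lie_layer xi yj); rewrite -addn1 leq_add.
Qed.

Lemma proj1M x y : proj1 (x ** y) = proj1 x + proj1 y.
Proof.
have [C [L /allP L3 CE] mulE] := gmul_expansion.
rewrite mulE !proj1D proj1Z proj1_lie scaler0 addr0 CE.
suff -> : proj1 (\sum_(cw <- L) cw.1 *: bword (lie G) x y cw.2) = 0.
  by rewrite addr0.
have p0 : proj1 0 = 0 by rewrite -[X in proj1 X](scale0r (0 : V)) proj1Z scale0r.
rewrite big_seq; apply: (big_ind (fun v => proj1 v = 0)) => //.
  by move=> v w v0 w0; rewrite proj1D v0 w0 addr0.
move=> [c [|a [|b w]]] /L3//= _.
by rewrite bword_cons proj1Z proj1_lie scaler0.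
Qed.

Lemma lieZZ a b x y : lie G (a *: x) (b *: y) = (a * b) *: lie G x y.
Proof. by rewrite linearZl_LR/= linearZr_LR/= scalerA. Qed.

Lemma lie_polymap (I T : Type) (c : I -> T -> R) (X Y : T -> V) :
  polymap c X -> polymap c Y -> polymap c (fun t => lie G (X t) (Y t)).
Proof.
move=> pX pY i0 j.
apply: (@polyfun_ext _ _ _ _ (fun t => \sum_i \sum_k
    X t 0 i * (Y t 0 k * lie G (delta_mx 0 i) (delta_mx 0 k) i0 j))) => [t|].
  rewrite [in RHS](row_sum_delta (X t)) [in RHS](row_sum_delta (Y t)).
  rewrite linear_sumlz/= summxE; apply: eq_bigr => i _.
  rewrite linear_sumr/= summxE; apply: eq_bigr => k _.
  by rewrite lieZZ mxE mulrA.
apply: polyfun_sum => i _; apply: polyfun_sum => k _.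
apply: polyfun_mul; first exact: pX.
by apply: polyfun_mul; [exact: pY|exact: polyfun_cst].
Qed.

Section PolymapClosure.
Context (I T : Type) (c : I -> T -> R).
Implicit Types X Y : T -> V.

Lemma polymap_cst m p (A : 'M[R]_(m, p)) : polymap c (fun=> A).
Proof. by move=> i j; exact: polyfun_cst. Qed.

Lemma polymapD m p (X Y : T -> 'M[R]_(m, p)) :
  polymap c X -> polymap c Y -> polymap c (fun t => X t + Y t).
Proof.
move=> pX pY i j; apply: polyfun_ext (polyfun_add (pX i j) (pY i j)) => t.
by rewrite mxE.
Qed.

Lemma polymapZ m p (a : T -> R) (X : T -> 'M[R]_(m, p)) :
  polyfun c a -> polymap c X -> polymap c (fun t => a t *: X t).
Proof.
move=> pa pX i j; apply: polyfun_ext (polyfun_mul pa (pX i j)) => t.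
by rewrite mxE.
Qed.

Lemma polymapN m p (X : T -> 'M[R]_(m, p)) :
  polymap c X -> polymap c (fun t => - X t).
Proof.
move=> pX i j; apply: polyfun_ext (polyfun_mul (polyfun_cst c (-1)) (pX i j)).
by move=> t; rewrite mxE mulN1r.
Qed.

Lemma polymap_sum m p (J : Type) (r : seq J) (X : J -> T -> 'M[R]_(m, p)) :
  (forall j, polymap c (X j)) -> polymap c (fun t => \sum_(j <- r) X j t).
Proof.
move=> pX i j; apply: (@polyfun_ext _ _ _ _ (fun t => \sum_(k <- r) X k t i j)).
  by move=> t; rewrite summxE.
by apply: polyfun_sum => k _; exact: pX.
Qed.

Lemma polyfunX a k : polyfun c a -> polyfun c (fun t => a t ^+ k).
Proof.
move=> pa; elim: k => [|k IH]; first exact: (polyfun_cst c 1).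
by apply: polyfun_ext (polyfun_mul pa IH) => t; rewrite exprS.
Qed.

Lemma bword_polymap X Y w : polymap c X -> polymap c Y ->
  polymap c (fun t => bword (lie G) (X t) (Y t) w).
Proof.
move=> pX pY; elim: w => [|b [|b' w] IH]; first exact: polymap_cst.
  by case: b.
have : polymap c (fun t => lie G (if b then X t else Y t)
   (bword (lie G) (X t) (Y t) (b' :: w))).
  by apply: lie_polymap => //; case: b.
by [].
Qed.

Lemma gmul_polymap X Y : polymap c X -> polymap c Y ->
  polymap c (fun t => X t ** Y t).
Proof.
move=> pX pY; have [C [L _ CE] mulE] := gmul_expansion.
suff : polymap c (fun t => X t + Y t + 2^-1 *: lie G (X t) (Y t) +
    \sum_(cw <- L) cw.1 *: bword (lie G) (X t) (Y t) cw.2).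
  by move=> H i j; apply: polyfun_ext (H i j) => t; rewrite mulE CE.
apply: polymapD.
  apply: polymapD; first exact: polymapD.
  by apply: polymapZ; [exact: polyfun_cst|exact: lie_polymap].
apply: polymap_sum => cw; apply: polymapZ; first exact: polyfun_cst.
exact: bword_polymap.
Qed.

Lemma scaled_dilation_polymap (a : T -> R) X :
  polyfun c a -> polymap c X -> polymap c (fun t => scaled_dilation (a t) (X t)).
Proof.
move=> pa pX; apply: polymap_sum => j; apply: polymapZ; first exact: polyfunX.
move=> i0 i; apply: (@polyfun_ext _ _ _ _ (fun t => \sum_k X t 0 k *
   hcomp j (delta_mx 0 k) i0 i)) => [t|].
  rewrite [in RHS](row_sum_delta (X t)) /hcomp linear_sum/= summxE.
  by apply: eq_bigr => k _; rewrite linearZ/= mxE.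
apply: polyfun_sum => k _; apply: polyfun_mul; first exact: pX.
exact: polyfun_cst.
Qed.

Lemma dilation_polymap (a : T -> R) X :
  polyfun c a -> polymap c X -> polymap c (fun t => dilation G (a t) (X t)).
Proof.
move=> pa pX; have : polymap c (fun t => a t *: scaled_dilation (a t) (X t)).
  by apply: polymapZ => //; exact: scaled_dilation_polymap.
move=> H i j; apply: polyfun_ext (H i j) => t.
by rewrite dilation_scaled.
Qed.

End PolymapClosure.

End StratifiedGroup.

(** * Conjugation and Chow's condition *)

Section AdjointAction.
Context (R : realType) (n : nat) (G : stratified_group R n).
Local Notation V := 'rV[R]_n.
Local Notation H1 := (layer G 1).
Local Notation "x ** y" := (gmul G x y) (at level 40, left associativity).
Local Notation var := (fun _ : unit => @id R).

Lemma polymap_closed0 m (Q : R -> 'rV[R]_m) (A : set 'rV[R]_m) :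
  polymap var Q -> closed A -> (forall k, A (Q k.+1%:R^-1)) -> A (Q 0).
Proof.
move=> pQ cA AQ; apply: (@closed_cvg _ _ \oo _ (fun k => Q (harmonic k)) A) => //.
  by apply: nearW => k; exact: AQ.
apply: (cvg_comp _ _ (@cvg_harmonic R)).
by apply: (polymap_continuous _ pQ) => _ x; exact: cvg_id.
Qed.

Lemma closed_point m (v : 'rV[R]_m) : closed [set v].
Proof. exact/accessible_closed_set1/hausdorff_accessible/norm_hausdorff. Qed.

Lemma closed_vspace m (U : {vspace 'rV[R]_m}) :
  closed [set v : 'rV[R]_m | v \in U].
Proof.
pose K : 'M[R]_m := lin1_mx (\1 - projv U)%VF.
have UE v : (v \in U) = (v *m K == 0).
  rewrite /K mul_rV_lin1 /= add_lfunE opp_lfunE id_lfunE subr_eq0 eq_sym.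
  apply/idP/eqP => [/projv_id//|<-]; exact: memv_proj.
have -> : [set v : 'rV[R]_m | v \in U] = (mulmxr K) @^-1` [set 0].
  by apply/seteqP; split=> v /=; rewrite UE => /eqP.
apply: closed_comp (@closed_point m 0) => v _.
apply: (@polymap_continuous _ _ _ (@mxcoord R 1 m)).
  by move=> ij; exact: mxcoord_continuous.
by apply: polyfun_mulmx => i j; [exact: polymap_mxcoord|exact: polyfun_cst].
Qed.

Definition gconj (x y : V) : V := x ** y ** - x.

Lemma gconj0 x : gconj x 0 = 0.
Proof. by rewrite /gconj gmulg0 gmulV. Qed.

Lemma gconj0g y : gconj 0 y = y.
Proof. by rewrite /gconj oppr0 gmulg0 gmul0g. Qed.

Lemma gconjM x y z : gconj x (y ** z) = gconj x y ** gconj x z.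
Proof. by rewrite /gconj !gmulA -(gmulA G (x ** y) (- x)) gmulNV gmulg0. Qed.

Lemma gconjMl x y z : gconj (x ** y) z = gconj x (gconj y z).
Proof. by rewrite /gconj goppM !gmulA. Qed.

Lemma scaleS_gmul m y : m.+1%:R *: y = (m%:R *: y) ** y.
Proof. by rewrite -[X in _ ** X]scale1r gmul_line -natr1. Qed.

Lemma gconj_natmul x m y : gconj x (m%:R *: y) = m%:R *: gconj x y.
Proof.
elim: m => [|m IH]; first by rewrite !scale0r gconj0.
by rewrite !scaleS_gmul gconjM IH.
Qed.

(** Conjugation maps one-parameter subgroups, which are lines, to
    one-parameter subgroups; so it coincides with its differential at the unit
    element. *)
Lemma gconj_linear x : exists A : 'M[R]_n, forall y, gconj x y = y *m A.
Proof.
have pF : polymap (@mxcoord R 1 n) (gconj x).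
  apply: gmul_polymap; last exact: polymap_cst.
  by apply: gmul_polymap; [exact: polymap_cst|exact: polymap_mxcoord].
have [D pD DE] := polymap_slope pF.
exists (D (0, 0)) => y.
pose Q (t : R) : V := y *m D (0, t *: y).
have <- : Q 0 = gconj x y; last by rewrite /Q scale0r.
apply: (@polymap_closed0 _ Q [set gconj x y]).
- apply: polyfun_mulmx => i j; first exact: polyfun_cst.
  apply: (@polyfun_comp _ _ _ _ _ _ _ (fun t : R => ((0 : V), t *: y)) _ _ (pD i j)).
  move=> [] [i0 k] /=; first exact: polyfun_cst.
  rewrite /mxcoord/=; apply: polymapZ (polymap_cst _ _) _ _.
  exact: (polyfun_var _ tt).
- exact: closed_point.
- move=> k; rewrite /Q/=.
  have := DE 0 (k.+1%:R^-1 *: y); rewrite gconj0 !subr0 -scalemxAl => E.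
  have := gconj_natmul x k.+1 (k.+1%:R^-1 *: y).
  by rewrite E !scalerA mulfV ?pnatr_eq0// !scale1r.
Qed.

Lemma gconjZ x a y : gconj x (a *: y) = a *: gconj x y.
Proof. by have [A AE] := gconj_linear x; rewrite !AE scalemxAl. Qed.

(** Conjugation is linear, so [w] may be replaced by [s w]: the product of [s e]
    and [s w] is then needed up to order [s^2] only, which is where the bracket
    enters with its coefficient 1/2. *)
Lemma gconj_derivative (e w : V) : exists2 Q : R -> V,
  polymap var Q & Q 0 = lie G e w /\
  forall s, gconj (s *: e) w = w + s *: Q s.
Proof.
have [C [L /allP L3 CE] mulE] := gmul_expansion G.
pose E s x y : V := 2^-1 *: lie G x y +
  \sum_(cw <- L) (cw.1 * s ^+ (size cw.2 - 2)) *: bword (lie G) x y cw.2.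
have EE s x y : (s *: x) ** (s *: y) = s *: (x + y) + s ^+ 2 *: E s x y.
  rewrite mulE CE lieZZ scalerDr -!addrA; do 2![congr (_ + _)].
  rewrite scalerDr scalerA mulrC -expr2 -scalerA; congr (_ + _).
  rewrite scaler_sumr big_seq [RHS]big_seq; apply: eq_bigr => cw /L3 cw3.
  by rewrite bwordZ !scalerA mulrCA -exprD subnKC// ltnW.
have E0 x y : E 0 x y = 2^-1 *: lie G x y.
  rewrite /E big_seq big1 ?addr0// => cw /L3 cw3.
  by rewrite expr0n subn_eq0 leqNgt cw3 mulr0 scale0r.
have pE X Y : polymap var X -> polymap var Y ->
    polymap var (fun s => E s (X s) (Y s)).
  move=> pX pY; apply: polymapD.
    by apply: polymapZ; [exact: polyfun_cst|exact: lie_polymap].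
  apply: polymap_sum => cw; apply: polymapZ; last exact: bword_polymap.
  apply: polyfun_mul; first exact: polyfun_cst.
  by apply: polyfunX; exact: (polyfun_var _ tt).
have pid : polyfun var id by exact: (polyfun_var _ tt).
pose a s : V := e + w + s *: E s e w.
have pa : polymap var a.
  apply: polymapD; first exact: polymap_cst.
  apply: polymapZ => //; apply: pE; exact: polymap_cst.
exists (fun s => E s e w + E s (a s) (- e)).
  apply: polymapD; apply: pE => //; exact: polymap_cst.
split=> [|s].
  rewrite !E0 /a scale0r addr0 linearNr linearDl/= liexx add0r.
  rewrite (br_anti (@liexx _ _ G) e w) opprK -scalerDl.
  have -> : 2^-1 + 2^-1 = 1 :> R by lra.
  exact: scale1r.
have [->|s0] := eqVneq s 0; first by rewrite !scale0r gconj0g addr0.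
apply: (scalerI s0); rewrite -gconjZ /gconj EE.
have -> : s *: (e + w) + s ^+ 2 *: E s e w = s *: a s.
  by rewrite /a [RHS]scalerDr scalerA expr2.
rewrite -scalerN EE.
have -> : a s - e = w + s *: E s e w by rewrite /a addrAC [e + w]addrC addrK.
move: (E s e w) (E s (a s) (- e)) => E1 E2.
by rewrite !scalerDr !scalerA -expr2 addrA.
Qed.

Definition gprod (l : seq V) : V := foldr (gmul G) 0 l.

Lemma gprod_cat l l' : gprod (l ++ l') = gprod l ** gprod l'.
Proof. by elim: l => [|h l IH] /=; rewrite ?gmul0g// IH gmulA. Qed.

Definition horizontal (l : seq V) : bool := all [in H1] l.

Definition word_inv (l : seq V) : seq V := rev [seq - h | h <- l].

Lemma gprod_inv l : gprod (word_inv l) = - gprod l.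
Proof.
rewrite /word_inv; elim: l => [|h l IH]; first by rewrite /= oppr0.
by rewrite map_cons rev_cons -cats1 gprod_cat IH /= gmulg0 goppM.
Qed.

Lemma horizontal_inv l : horizontal l -> horizontal (word_inv l).
Proof.
move=> /allP lH; apply/allP => v; rewrite mem_rev => /mapP[h /lH hH ->].
by rewrite /= memvN.
Qed.

(** The derivatives of the product [t_1 h_1 ... t_k h_k] in the variables
    [t_i] at [t = 1], translated back to the unit element. *)
Fixpoint velocities (l : seq V) : seq V :=
  if l is h :: l' then gconj (- gprod l') h :: velocities l' else [::].

Lemma size_velocities l : size (velocities l) = size l.
Proof. by elim: l => //= h l ->. Qed.

Lemma velocities_cat l l' :
  (<<velocities l'>> <= <<velocities (l ++ l')>>)%VS.
Proof.
elim: l => //= h l IH; apply: subv_trans IH _.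
by rewrite span_cons addvSr.
Qed.

Lemma velocities_conj l v : horizontal l -> v \in velocities l ->
  exists l' h, [/\ horizontal l', h \in H1 & v = gconj (gprod l') h].
Proof.
elim: l => //= h l IH /andP[hH lH]; rewrite in_cons => /orP[/eqP->|/IH]; last exact.
by exists (word_inv l), h; rewrite horizontal_inv// gprod_inv.
Qed.

Lemma lie_closed_full (W : {vspace V}) : (H1 <= W)%VS ->
  (forall e w, e \in H1 -> w \in W -> lie G e w \in W) -> W = fullv.
Proof.
move=> HW eW.
pose N : {vspace V} :=
  (\bigcap_(i < \dim W) (linfun (applyr (lie G) (vbasis W)`_i) @^-1: W))%VS.
have NP x : reflect (forall w, w \in W -> lie G x w \in W) (x \in N).
  rewrite memvE; apply: (iffP subv_bigcapP) => [H w wW|H i _].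
    rewrite (coord_vbasis wW) linear_sumr/=; apply: rpred_sum => i _.
    rewrite linearZr_LR/= rpredZ//; have := H i isT.
    by rewrite -memvE -memv_preim lfunE.
  by rewrite -memvE -memv_preim lfunE/= H// vbasis_mem// mem_nth// size_tuple.
have Nfull : N = fullv.
  apply: (@layer1_generates _ _ G).
    by apply/subvP => e eH; apply/NP => w; exact: eW.
  move=> x y /NP xN /NP yN; apply/NP => w wW.
  have := lie_jacobi G x y w.
  rewrite (br_anti (@liexx _ _ G) (lie G x y) w) => /eqP; rewrite subr_eq0 => /eqP <-.
  by rewrite memvD ?xN ?yN// (br_anti (@liexx _ _ G) x w) memvN xN.
apply: (@layer1_generates _ _ G) => // x y _ yW.
by move: y yW; apply/NP; rewrite Nfull memvf.
Qed.

(** Chow's condition. For a word with velocities of maximal rank, inserting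
    further letters in front cannot enlarge the span [W] of the velocities, so
    that [W] contains all conjugates of horizontal vectors by products of
    horizontal vectors. Then [W] is invariant under conjugation, hence under
    brackets with the first layer. *)
Lemma velocities_span : exists2 l, horizontal l & <<velocities l>>%VS = fullv.
Proof.
pose P k := `[< exists2 l, horizontal l & \dim <<velocities l>> = k >].
have P0 : exists k, P k by exists (\dim <<velocities [::]>>); apply/asboolP; exists [::].
have Pn k : P k -> (k <= \dim {: V})%N.
  by move=> /asboolP[l _ <-]; exact/dimvS/subvf.
have [_ /asboolP[l lH <-] lmax] := ex_maxnP P0 Pn.
exists l => //; set W := <<_>>%VS.
have conjW l1 h : horizontal l1 -> h \in H1 -> gconj (gprod l1) h \in W.
  move=> l1H hH; pose l3 := (word_inv l1 ++ word_inv l) ++ l.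
  have l3H : horizontal (h :: l3).
    by rewrite /= hH /l3 /horizontal !all_cat -!/(horizontal _) !horizontal_inv.
  have /eqP-> : W == <<velocities (h :: l3)>>%VS.
    rewrite eqEdim lmax ?andbT; last by apply/asboolP; exists (h :: l3).
    by rewrite -cat_cons velocities_cat.
  have -> : gprod l1 = - gprod l3.
    by rewrite /l3 !gprod_cat !gprod_inv -gmulA gmulNV gmulg0 opprK.
  by rewrite memv_span// mem_head.
apply: lie_closed_full => [|e w eH wW].
  by apply/subvP => h hH; rewrite -[h]gconj0g; exact: (conjW [::]).
have invW s : gconj (s *: e) w \in W.
  have [A AE] := gconj_linear (s *: e).
  pose f := linfun (mulmxr A : V -> V).
  have fE v : f v = gconj (s *: e) v by rewrite lfunE/= AE.
  rewrite -fE.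
  have : (f @: W <= W)%VS.
    rewrite /W limg_span; apply/span_subvP => _ /mapP[v vl ->].
    have [l1 [h [l1H hH ->]]] := velocities_conj lH vl.
    rewrite fE -gconjMl.
    apply: (conjW ((s *: e) :: l1)) => //=.
    by rewrite rpredZ.
  by move=> /subvP; apply; exact: memv_img.
have [Q pQ [<- QE]] := gconj_derivative e w.
apply: (polymap_closed0 pQ (@closed_vspace _ W)) => k /=.
pose s := k.+1%:R^-1 : R; have s0 : s != 0 by rewrite invr_eq0 pnatr_eq0.
have -> : Q s = s^-1 *: (gconj (s *: e) w - w).
  by rewrite QE addrAC subrr add0r scalerA mulVf ?scale1r.
by rewrite rpredZ// rpredB.
Qed.

End AdjointAction.

(** * Local generation by horizontal words *)

Section MatrixNorm.
Context (R : realType).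

Lemma mxcoord_le m n (A : 'M[R]_(m, n)) i j : `|A i j| <= `|A|.
Proof.
rewrite [leRHS]/Num.norm/= mx_normrE.
exact: (le_bigmax _ (fun ij : 'I_m * 'I_n => `|A ij.1 ij.2|) (i, j)).
Qed.

Lemma mx_norm_leP m n (A : 'M[R]_(m, n)) c : 0 <= c ->
  (forall i j, `|A i j| <= c) -> `|A| <= c.
Proof.
move=> c0 Ac; rewrite [leLHS]/Num.norm/= mx_normrE.
by apply/bigmax_leP; split=> // -[i j] _ /=.
Qed.

Lemma mulmx_norm m n p (A : 'M[R]_(m, n)) (B : 'M[R]_(n, p)) :
  `|A *m B| <= n%:R * (`|A| * `|B|).
Proof.
apply: mx_norm_leP => [|i j]; first by rewrite !mulr_ge0.
rewrite mxE; apply: le_trans (ler_norm_sum _ _ _) _.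
rewrite mulr_natl -[X in _ *+ X]card_ord -sumr_const.
apply: ler_sum => k _; rewrite normrM.
by rewrite ler_pM// mxcoord_le.
Qed.

HB.instance Definition _ m n := Complete.on 'M[R]_(m, n).

(** The surjectivity part of the inverse function theorem: [F t = z] says that
    [t] is a fixed point of [t + z - F t], a contraction near [0]. *)
Lemma locally_surjective n (F : 'rV[R]_n -> 'rV[R]_n)
    (D : 'rV[R]_n * 'rV[R]_n -> 'M[R]_n) :
  {for (0, 0), continuous D} -> D (0, 0) = 1%:M ->
  (forall x y, F y - F x = (y - x) *m D (x, y)) -> F 0 = 0 ->
  exists2 e : R, 0 < e &
    forall z, `|z| < e -> exists2 t, `|t| <= 1 & F t = z.
Proof.
move=> cD D1 DE F0.
have c0 : 0 < (2 * n.+1%:R)^-1 :> R by rewrite invr_gt0 mulr_gt0.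
have [r /andP[r0 r1] Dr] : exists2 r : R, 0 < r <= 1 &
    forall x y, `|x| <= r -> `|y| <= r -> `|1%:M - D (x, y)| <= (2 * n.+1%:R)^-1.
  move: cD => /cvgrPdist_le/(_ _ c0); rewrite D1 => -[[A B] /= [nA nB] AB].
  move/nbhs_ballP: nA => [a /= a0 aA]; move/nbhs_ballP: nB => [b /= b0 bB].
  exists (Num.min (a / 2) (Num.min (b / 2) 1)).
    by rewrite !lt_min !divr_gt0//= ltr01 !ge_min lexx !orbT.
  move=> x y; rewrite !le_min => /and3P[xa _ _] /and3P[_ yb _].
  have := AB (x, y); apply; split=> /=.
    apply: aA; rewrite -ball_normE /ball_/= sub0r normrN.
    by apply: le_lt_trans xa _; rewrite ltr_pdivrMr// ltr_pMr// ltr1n.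
  apply: bB; rewrite -ball_normE /ball_/= sub0r normrN.
  by apply: le_lt_trans yb _; rewrite ltr_pdivrMr// ltr_pMr// ltr1n.
exists (r / 2); first by rewrite divr_gt0.
move=> z zr; pose T t := t + z - F t.
pose U := closed_ball (0 : 'rV[R]_n) r.
have UE t : U t <-> `|t| <= r.
  by rewrite /U closed_ballE// /closed_ball_/= sub0r normrN.
have TT s t : U s -> U t -> `|T t - T s| <= 2^-1 * `|t - s|.
  move=> /UE sr /UE tr.
  have -> : T t - T s = (t - s) *m (1%:M - D (s, t)).
    by rewrite mulmxBr mulmx1 -DE; apply/rowP => j; rewrite !mxE; ring.
  apply: le_trans (mulmx_norm _ _) _.
  rewrite mulrCA mulrC ler_wpM2r//.
  apply: (@le_trans _ _ (n%:R * (2 * n.+1%:R)^-1)).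
    by rewrite ler_wpM2l// Dr.
  by rewrite invfM mulrCA ler_piMr// ler_pdivrMr// mul1r ler_nat.
have TU : set_fun U U T.
  move=> t Ut; apply/UE.
  have U0 : U 0 by apply/UE; rewrite normr0 ltW.
  have -> : T t = T t - T 0 + z by rewrite /T F0 add0r subr0 subrK.
  apply: le_trans (ler_normD _ _) _; rewrite [leRHS]splitr lerD ?(ltW zr)//.
  apply: le_trans (TT _ _ U0 Ut) _; rewrite subr0 mulrC ler_wpM2r//.
  exact/UE.
pose Tf : {fun U >-> U} := mkfun TU.
have ctr : is_contraction Tf.
  exists (2^-1)%:nng; split; first by rewrite /= invf_lt1// ltr1n.
  by move=> [x y] /= [Ux Uy]; apply: TT.
have [||t Ut tT] := banach_fixed_point ctr.
- exact: closed_ball_closed.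
- by exists 0; apply/UE; rewrite normr0 ltW.
exists t; first by move/UE: Ut => /le_trans; apply.
move: tT; rewrite /= /T => /rowP tT; apply/rowP => j.
by have := tT j; rewrite !mxE; lra.
Qed.

End MatrixNorm.

Section Generation.
Context (R : realType) (n : nat) (G : stratified_group R n).
Local Notation V := 'rV[R]_n.
Local Notation H1 := (layer G 1).
Local Notation "x ** y" := (gmul G x y) (at level 40, left associativity).

Definition wprod k (h : 'I_k -> V) (t : 'rV[R]_k) : V :=
  gprod G [seq t 0 i *: h i | i <- enum 'I_k].

Lemma gprod_polymap (I J T : Type) (c : I -> T -> R) (X : J -> T -> V)
    (r : seq J) : (forall j, polymap c (X j)) ->
  polymap c (fun t => gprod G [seq X j t | j <- r]).
Proof.
move=> pX; elim: r => [|j r IH] /=; first exact: polymap_cst.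
exact: gmul_polymap.
Qed.

Lemma wprod_polymap k (h : 'I_k -> V) : polymap (@mxcoord R 1 k) (wprod h).
Proof.
apply: gprod_polymap => j; apply: polymapZ; last exact: polymap_cst.
exact: (polyfun_var _ (0, j)).
Qed.

(** A word in the letters [h_i] depends on the coefficient of [h_i] as on
    multiplication on the right by a one-parameter subgroup. *)
Lemma gprod_perturb (J : eqType) (h : J -> V) (r : seq J) (i : J) (s : R) :
  uniq r -> i \in r ->
  gprod G [seq (1 + s *+ (j == i)) *: h j | j <- r]
  = gprod G [seq h j | j <- r] **
    (s *: nth 0 (velocities G [seq h j | j <- r]) (index i r)).
Proof.
have opp_id (r' : seq J) : i \notin r' ->
    [seq (1 + s *+ (j == i)) *: h j | j <- r'] = [seq h j | j <- r'].
  move=> ir'; apply/eq_in_map => j jr'.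
  have /negbTE -> : j != i by apply: contraNneq ir' => <-.
  by rewrite mulr0n addr0 scale1r.
elim: r => // j r IH /= /andP[jr ur].
rewrite in_cons eq_sym; have [ji _|ji /= ir] := eqVneq j i.
  move: jr; rewrite ji => jr; rewrite /= mulr1n opp_id//.
  by rewrite -gconjZ /gconj opprK !gmulA -(gmulA G (h i)) gmulV gmulg0
    -[X in X ** (s *: _)]scale1r gmul_line.
by rewrite /= mulr0n addr0 scale1r IH// gmulA.
Qed.

(** The rows of the derivative of a word at [t = 1] are its velocities, which
    span by Chow's condition. *)
Lemma wprod_submersion : exists k (h : 'I_k -> V),
  (forall i, h i \in H1) /\
  exists D : 'rV[R]_k * 'rV[R]_k -> 'M[R]_(k, n),
  [/\ polymap (@slope_coord R k) D,
      forall s t, - wprod h (const_mx 1) ** wprod h t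
                - - wprod h (const_mx 1) ** wprod h s = (t - s) *m D (s, t) &
      exists S : 'M[R]_(n, k), S *m D (const_mx 1, const_mx 1) = 1%:M].
Proof.
have [l lH lfull] := velocities_span G.
pose vs := velocities G l; pose k := size vs.
pose h (i : 'I_k) := l`_i.
have kl : k = size l by rewrite /k size_velocities.
have hl : [seq h i | i <- enum 'I_k] = l.
  apply: (@eq_from_nth _ 0); first by rewrite size_map size_enum_ord.
  rewrite size_map size_enum_ord => i ik.
  by rewrite (nth_map (Ordinal ik)) ?size_enum_ord// /h nth_enum_ord.
exists k, h; split=> [i|].
  by move/allP: lH; apply; rewrite mem_nth// -kl.
set P := wprod h (const_mx 1).
have PE : P = gprod G l.
  rewrite /P /wprod -[in RHS]hl; congr (gprod G _).
  by apply: eq_map => i; rewrite mxE scale1r.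
have pF : polymap (@mxcoord R 1 k) (fun t => - P ** wprod h t).
  by apply: gmul_polymap; [exact: polymap_cst|exact: wprod_polymap].
have [D pD DE] := polymap_slope pF; exists D; split=> //.
have rowD (i : 'I_k) : row i (D (const_mx 1, const_mx 1)) = vs`_i.
  pose Q (s : R) : V := delta_mx 0 i *m D (const_mx 1, const_mx 1 + s *: delta_mx 0 i).
  rewrite rowE; have -> : delta_mx 0 i *m D (const_mx 1, const_mx 1) = Q 0.
    by rewrite /Q scale0r addr0.
  apply: (@polymap_closed0 R _ Q [set vs`_i]).
  - apply: polyfun_mulmx => a b; first exact: polyfun_cst.
    apply: (polyfun_comp _ (pD a b)) => -[] [a' b'] /=; first exact: polyfun_cst.
    apply: polymapD; first exact: polymap_cst.
    by apply: polymapZ; [exact: (polyfun_var _ tt)|exact: polymap_cst].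
  - exact: closed_point.
  - move=> m; set s := m.+1%:R^-1; have s0 : s != 0 :> R by rewrite invr_eq0 pnatr_eq0.
    rewrite /Q /=; have := DE (const_mx 1) (const_mx 1 + s *: delta_mx 0 i).
    rewrite addrAC subrr add0r -scalemxAl -/P gmulNV subr0.
    have -> : wprod h (const_mx 1 + s *: delta_mx 0 i) = P ** (s *: vs`_i).
      have := @gprod_perturb _ h (enum 'I_k) i s (enum_uniq _) (mem_enum _ _).
      rewrite index_enum_ord hl -PE => <-; congr (gprod G _).
      by apply: eq_map => j; rewrite !mxE eqxx mulr_natr.
    by rewrite gmulKV => /(scalerI s0).
have spanD (v : V) : exists c : 'rV[R]_k, c *m D (const_mx 1, const_mx 1) = v.
  have : v \in <<in_tuple vs>>%VS by rewrite lfull memvf.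
  move=> /coord_span vE.
  exists (\row_i coord (in_tuple vs) i v); rewrite mulmx_sum_row [RHS]vE.
  by apply: eq_bigr => i _; rewrite mxE rowD.
have /choice[c cP] := spanD.
exists (\matrix_j c (delta_mx 0 j)); apply/row_matrixP => j.
by rewrite row_mul rowK cP row1.
Qed.

(** Multiplying a word that is a submersion at [t = 1] by the inverse of its
    product there gives words that fill a neighbourhood of the unit element. *)
Lemma local_generation : exists (l : seq V) (K : nat) (B e : R),
  [/\ horizontal G l, 0 < e & forall z, `|z| < e ->
    exists w : seq (R * V), [/\ size w = K,
      forall th, th \in w -> `|th.1| <= B /\ th.2 \in l &
      gprod G [seq th.1 *: th.2 | th <- w] = z]].
Proof.
have [k [h [hH [D [pD DE [S S1]]]]]] := wprod_submersion.
set P := wprod h (const_mx 1) in DE.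
pose F (t : V) : V := - P ** wprod h (const_mx 1 + t *m S).
pose DF (z : V * V) : 'M[R]_n :=
  S *m D (const_mx 1 + z.1 *m S, const_mx 1 + z.2 *m S).
have [e e0 eP] : exists2 e : R, 0 < e &
    forall z, `|z| < e -> exists2 t, `|t| <= 1 & F t = z.
  apply: (@locally_surjective _ _ F DF).
  - apply: (@polymap_continuous _ _ _ (@slope_coord R n)).
      exact: slope_coord_continuous.
    apply: polyfun_mulmx => a b; first exact: polyfun_cst.
    apply: (polyfun_comp _ (pD a b)) => -[] [a' b'] /=.
      apply: polymapD; first exact: polymap_cst.
      apply: polyfun_mulmx => i j; last exact: polyfun_cst.
      exact: (polyfun_var _ (inl (i, j))).
    apply: polymapD; first exact: polymap_cst.
    apply: polyfun_mulmx => i j; last exact: polyfun_cst.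
    exact: (polyfun_var _ (inr (i, j))).
  - by rewrite /DF /= !mul0mx addr0.
  - move=> x y; rewrite /F DE /DF /= mulmxA; congr (_ *m _).
    by rewrite opprD addrACA subrr add0r mulmxBl.
  - by rewrite /F mul0mx addr0 gmulNV.
pose B' := 1 + n%:R * (1 * `|S|) : R.
exists [seq h i | i <- enum 'I_k], (k + k)%N, B', e; split=> //.
  by apply/allP => _ /mapP[i _ ->]; exact: hH.
move=> z /eP[t t1 <-].
exists ([seq (-1, h i) | i <- rev (enum 'I_k)] ++
        [seq ((const_mx 1 + t *m S) 0 i, h i) | i <- enum 'I_k]); split.
- by rewrite size_cat !size_map size_rev -?enumT !size_enum_ord.
- have B1 : 1 <= B' by rewrite lerDl !mulr_ge0.
  move=> th; rewrite mem_cat => /orP[] /mapP[i _ ->] /=; split.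
  + by rewrite normrN1.
  + by rewrite map_f// mem_enum.
  + rewrite mxE; apply: le_trans (ler_normD _ _) _; rewrite mxE normr1 lerD2l.
    apply: le_trans (mxcoord_le _ _ _) _; apply: le_trans (mulmx_norm _ _) _.
    by rewrite ler_wpM2l// ler_wpM2r.
  + by rewrite map_f// mem_enum.
- rewrite map_cat gprod_cat -!map_comp; congr (_ ** _); last first.
    by rewrite /wprod -enumT.
  rewrite /P /wprod -gprod_inv /word_inv -map_comp -map_rev; congr (gprod G _).
  by apply: eq_map => i /=; rewrite mxE scale1r scaleN1r.
Qed.

End Generation.

(** * Words with arbitrary signs *)

Section SignedWords.
Context (R : realType) (n : nat) (G : stratified_group R n).
Local Notation V := 'rV[R]_n.
Local Notation H1 := (layer G 1).
Local Notation "x ** y" := (gmul G x y) (at level 40, left associativity).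

Lemma fin_lower_bound (J : finType) (f : J -> R) : (forall j, 0 < f j) ->
  exists2 c : R, 0 < c & forall j, c <= f j.
Proof.
move=> f0; exists (\big[Num.min/1]_j f j).
  by apply: lt_bigmin.
by move=> j; exact: bigmin_le.
Qed.

Lemma polyfun_adj (I T : Type) (c : I -> T -> R) m (A : T -> 'M[R]_m) :
  polymap c A -> polymap c (fun t => \adj (A t)).
Proof.
move=> pA i j; apply: (@polyfun_ext _ _ _ _ (fun t => cofactor (A t) j i)).
  by move=> t; rewrite mxE.
apply: polyfun_mul; first exact: polyfun_cst.
apply: polyfun_det => a b.
by apply: (@polyfun_ext _ _ _ _ (fun t => A t (lift j a) (lift i b))) => [t|];
   [rewrite !mxE|exact: pA].
Qed.

(** An invertible derivative at [0] bounds the difference quotient from below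
    near [0], by Cramer's rule. *)
Lemma slope_lower_bound (F : V -> V) (M : V * V -> 'M[R]_n) :
  polymap (@slope_coord R n) M ->
  (forall x y, F y - F x = (y - x) *m M (x, y)) -> \det (M (0, 0)) != 0 ->
  exists2 r : R, 0 < r & exists2 c : R, 0 < c &
    forall x y, `|x| <= r -> `|y| <= r -> c * `|y - x| <= `|F y - F x|.
Proof.
move=> pM ME d0; set a := `|\det (M (0, 0))|.
have a0 : 0 < a by rewrite normr_gt0.
pose b := `|\adj (M (0, 0))| + 1.
have b0 : 0 < b by rewrite ltr_wpDl.
have cdet : {for (0, 0), continuous (fun z => \det (M z))}.
  apply: (@polyfun_continuous _ _ _ (@slope_coord R n)).
    exact: slope_coord_continuous.
  exact: polyfun_det.
have cadj : {for (0, 0), continuous (fun z => \adj (M z))}.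
  apply: (@polymap_continuous _ _ _ (@slope_coord R n)).
    exact: slope_coord_continuous.
  exact: polyfun_adj.
have [r r0 rP] : exists2 r : R, 0 < r & forall x y, `|x| <= r -> `|y| <= r ->
    a / 2 <= `|\det (M (x, y))| /\ `|\adj (M (x, y))| <= b.
  have /nbhs_ballP[r /= r0 rP] : \forall z \near ((0, 0) : V * V),
      a / 2 <= `|\det (M z)| /\ `|\adj (M z)| <= b.
    near=> z; split.
      have : `|\det (M (0, 0)) - \det (M z)| <= a / 2.
        near: z; move/cvgrPdist_le: cdet; apply; exact: divr_gt0.
      move=> H; have := lerB_dist (\det (M (0, 0))) (\det (M z)).
      move=> /le_trans/(_ H); rewrite -/a; lra.
    have : `|\adj (M (0, 0)) - \adj (M z)| <= 1.
      by near: z; move/cvgrPdist_le: cadj; apply.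
    move=> H; have := lerB_dist (\adj (M z)) (\adj (M (0, 0))).
    by rewrite distrC => /le_trans/(_ H); rewrite /b; lra.
  exists (r / 2); first exact: divr_gt0.
  have small (x : V) : `|x| <= r / 2 -> ball (0 : V) r x.
    rewrite -ball_normE /ball_/= sub0r normrN => /le_lt_trans; apply.
    by rewrite ltr_pdivrMr// ltr_pMr// ltr1n.
  by move=> x y /small xr /small yr; apply: rP; split.
exists r => //; exists (a / 2 / (n.+1%:R * b)).
  by rewrite !divr_gt0// mulr_gt0.
move=> x y /rP H /H[{}H Hb].
rewrite mulrAC ler_pdivrMr ?mulr_gt0//.
apply: (@le_trans _ _ (`|\det (M (x, y))| * `|y - x|)); first by rewrite ler_wpM2r.
rewrite -normrZ.
have -> : \det (M (x, y)) *: (y - x) = (F y - F x) *m \adj (M (x, y)).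
  by rewrite ME -mulmxA mul_mx_adj -scalemx1 -scalemxAr mulmx1.
apply: le_trans (mulmx_norm _ _) _; rewrite mulrCA ler_wpM2l//.
by rewrite ler_pM// ler_nat.
Unshelve. all: by end_near. Qed.

Definition sign_mx k (e : {ffun 'I_k -> bool}) : 'M[R]_k :=
  diag_mx (\row_i (-1) ^+ e i).

Lemma sign_mxK k (e : {ffun 'I_k -> bool}) : sign_mx e *m sign_mx e = 1%:M.
Proof.
rewrite /sign_mx mulmx_diag -diag_const_mx; congr diag_mx.
by apply/rowP => i; rewrite !mxE -expr2 sqrr_sign.
Qed.

Lemma mulmx_sign k (e : {ffun 'I_k -> bool}) (t : 'rV[R]_k) i :
  (t *m sign_mx e) 0 i = (-1) ^+ e i * t 0 i.
Proof. by rewrite /sign_mx mul_mx_diag !mxE mulrC. Qed.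

(** For each choice [e] of signs, the derivative of the product along the family
    [(t0 + t S) e] is invertible unless a polynomial in [(t0, S)] vanishes. None of
    these polynomials is zero: the signs [e] can be undone by changing the signs
    of [t0] and of the columns of [S]. Hence they have common nonzeros, and these
    may be taken arbitrarily close to 0. *)
Lemma signed_words : exists (k : nat) (h : 'I_k -> V) (P : V),
  (forall i, h i \in H1) /\
  forall eta : R, 0 < eta -> exists (t0 : 'rV[R]_k) (S : 'M[R]_(n, k)) (r c : R),
  [/\ 0 < r, 0 < c, forall t : V, `|t| <= r -> `|t0 + t *m S| <= eta &
    forall e t t', `|t| <= r -> `|t'| <= r ->
      c * `|t' - t| <= `|P ** wprod G h ((t0 + t' *m S) *m sign_mx e)
                       - P ** wprod G h ((t0 + t *m S) *m sign_mx e)| ].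
Proof.
have [k [h [hH [D [pD DE [S1 S1E]]]]]] := wprod_submersion G.
exists k, h, (- wprod G h (const_mx 1)); split=> // eta eta0.
set P := - wprod G h (const_mx 1) in DE *.
pose W := ('rV[R]_k * 'M[R]_(n, k))%type.
pose f (e : {ffun 'I_k -> bool}) (z : W) : R :=
  \det (z.2 *m sign_mx e *m D (z.1 *m sign_mx e, z.1 *m sign_mx e)).
pose cW := paircoord (@mxcoord R 1 k) (@mxcoord R n k).
have p1 : polymap cW (fun z : W => z.1).
  by move=> i j; exact: (polyfun_var cW (inl (i, j))).
have p2 : polymap cW (fun z : W => z.2).
  by move=> i j; exact: (polyfun_var cW (inr (i, j))).
have pf e : polyfun cW (f e).
  have pe : polymap cW (fun z : W => z.1 *m sign_mx e).
    by apply: polyfun_mulmx => //; exact: polymap_cst.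
  apply: polyfun_det; apply: polyfun_mulmx.
    by apply: polyfun_mulmx => //; exact: polymap_cst.
  move=> i j; apply: (polyfun_comp _ (pD i j)) => -[] [a b]; exact: pe.
have f0 e : exists z, f e z != 0.
  exists (const_mx 1 *m sign_mx e, S1 *m sign_mx e); rewrite /f /=.
  rewrite -(mulmxA S1) sign_mxK mulmx1 -(mulmxA (const_mx 1)) sign_mxK mulmx1.
  by rewrite S1E det1 oner_neq0.
have [v vP] : exists v : W, forall e : R, 0 < e ->
    exists s, [/\ 0 < s, s < e & forall j, f j (0 + s *: v) != 0].
  apply: (@polyfun_common_nonzero R _ W cW _ f 0) => //.
  by apply: paircoord_affine; exact: mxcoord_affine.
have [s [s0 sv fs]] := vP (eta / 2 / (`|v.1| + 1))
  (divr_gt0 (divr_gt0 eta0 (ltr0n _ 2)) (ltr_wpDl (normr_ge0 _) ltr01)).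
pose t0 := s *: v.1; pose S := s *: v.2.
have t0_small : `|t0| <= eta / 2.
  rewrite normrZ gtr0_norm//; move: sv; rewrite ltr_pdivlMr ?ltr_wpDl// => /ltW.
  by apply: le_trans; rewrite ler_wpM2l ?(ltW s0)// lerDl.
pose F e (t : V) := P ** wprod G h ((t0 + t *m S) *m sign_mx e).
pose M e (z : V * V) := S *m sign_mx e *m
  D ((t0 + z.1 *m S) *m sign_mx e, (t0 + z.2 *m S) *m sign_mx e).
have FM e x y : F e y - F e x = (y - x) *m M e (x, y).
  rewrite /F DE /M /= !mulmxA; congr (_ *m _).
  rewrite -[LHS]mulmxBl; congr (_ *m _).
  by rewrite opprD addrACA subrr add0r mulmxBl.
have pM e : polymap (@slope_coord R n) (M e).
  have aff (H : V * V -> V) : polymap (@slope_coord R n) H ->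
      polymap (@slope_coord R n) (fun z => (t0 + H z *m S) *m sign_mx e).
    move=> pH; apply: polyfun_mulmx; last exact: polymap_cst.
    apply: polymapD; first exact: polymap_cst.
    by apply: polyfun_mulmx => //; exact: polymap_cst.
  apply: polyfun_mulmx; first exact: polymap_cst.
  move=> i j; apply: (polyfun_comp _ (pD i j)) => -[] [a b].
    by apply: aff => {}a {}b; exact: (polyfun_var _ (inl (a, b))).
  by apply: aff => {}a {}b; exact: (polyfun_var _ (inr (a, b))).
have M0 e : \det (M e (0, 0)) != 0.
  by rewrite /M /= mul0mx addr0; have := fs e; rewrite add0r.
have /choice[r /all_and2[r0 /choice[c rc]]] : forall e, exists r : R, 0 < r /\ exists c : R, 0 < c /\
    forall x y, `|x| <= r -> `|y| <= r -> c * `|y - x| <= `|F e y - F e x|.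
  move=> e; have [r r0 [c c0 rc]] := slope_lower_bound (pM e) (FM e) (M0 e).
  by exists r; split=> //; exists c.
have [r1 r10 r1P] := fin_lower_bound r0.
have [c1 c10 c1P] := fin_lower_bound (fun e => (rc e).1).
pose r2 := eta / 2 / (n%:R * `|S| + 1).
have nS : 0 < n%:R * `|S| + 1 by rewrite ltr_wpDl// mulr_ge0.
have r20 : 0 < r2 by rewrite !divr_gt0.
exists t0, S, (Num.min r1 r2), c1; split=> //.
- by rewrite lt_min r10.
- move=> t; rewrite le_min => /andP[_ tr2].
  rewrite (le_trans (ler_normD _ _))// [leRHS]splitr lerD//.
  apply: le_trans (mulmx_norm _ _) _.
  move: tr2; rewrite /r2 ler_pdivlMr//; apply: le_trans.
  by rewrite mulrCA ler_wpM2l// lerDl.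
- move=> e t t'; rewrite !le_min => /andP[tr _] /andP[t'r _].
  apply: (@le_trans _ _ (c e * `|t' - t|)); first by rewrite ler_wpM2r.
  by apply: (rc e).2; apply: le_trans (r1P e).
Qed.

End SignedWords.

(** * Lebesgue outer measure *)

Section LebesgueOuterMeasure.
Context (R : realType) (n : nat).
Local Notation V := 'rV[R]_n.
Local Open Scope ereal_scope.

Definition vol (a b : V) : R := (\prod_i (b 0 i - a 0 i))%R.

Definition box_cover (D : set nat) (a b : nat -> V) (A : set V) : Prop :=
  (forall k i, a k 0 i <= b k 0 i)%R /\
  A `<=` \bigcup_(k in D) box (a k) (b k).

(** Covers are indexed by sets of naturals so that the empty set has measure 0
    also in dimension 0, where every box has volume 1. *)
Definition leb (A : set V) : \bar R :=
  ereal_inf [set s | exists D a b,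
    box_cover D a b A /\ s = \esum_(k in D) (vol (a k) (b k))%:E].

Lemma vol_ge0 (a b : V) : (forall i, a 0 i <= b 0 i)%R -> (0 <= vol a b)%R.
Proof. by move=> ab; apply: prodr_ge0 => i _; rewrite subr_ge0. Qed.

Lemma leb_le D a b A : box_cover D a b A ->
  leb A <= \esum_(k in D) (vol (a k) (b k))%:E.
Proof. by move=> c; apply: ereal_inf_lbound; exists D, a, b. Qed.

Lemma leb_ge0 A : 0 <= leb A.
Proof.
apply: le_ereal_inf_tmp => _ [D [a [b [[ab _] ->]]]].
by apply: esum_ge0 => k _; rewrite lee_fin vol_ge0.
Qed.

Lemma leb0 : leb set0 = 0.
Proof.
apply/eqP; rewrite eq_le leb_ge0 andbT.
have /leb_le : box_cover set0 (fun=> 0%R) (fun=> 0%R) set0 by split.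
by rewrite esum_set0.
Qed.

Lemma leb_adherent A (e : R) : (0 < e)%R -> leb A < +oo ->
  exists D a b, box_cover D a b A /\
    \esum_(k in D) (vol (a k) (b k))%:E <= leb A + e%:E.
Proof.
move=> e0 Aoo.
have Afin : leb A \is a fin_num by rewrite ge0_fin_numE// leb_ge0.
have [_ [D [a [b [c ->]]]] /ltW H] := lb_ereal_inf_adherent e0 Afin.
by exists D, a, b.
Qed.

Lemma leb_subset_sigma_subadditive A F : subset_sigma_subadditive leb A F.
Proof.
move=> AF; have [[i ioo]|] := pselect (exists i, leb (F i) = +oo).
  by rewrite (eseries_pinfty _ _ ioo) ?leey// => k _;
    rewrite -ltNye (lt_le_trans _ (leb_ge0 _)).
rewrite -forallNE => Foo.
apply/lee_addgt0Pr => e e0.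
rewrite (le_trans _ (epsilon_trick _ _ _))//; last exact: ltW.
  2: by move=> k; exact: leb_ge0.
pose Q i (c : set nat * (nat -> V) * (nat -> V)) :=
  box_cover c.1.1 c.1.2 c.2 (F i) /\
  \esum_(k in c.1.1) (vol (c.1.2 k) (c.2 k))%:E
    <= leb (F i) + (e / (2 ^ i.+1)%:R)%:E.
have /choice[c cP] : forall i, exists c, Q i c.
  move=> i; have [||D [a [b [H1 H2]]]] := @leb_adherent (F i) (e / (2 ^ i.+1)%:R).
  - by rewrite divr_gt0// ltr0n expn_gt0.
  - by rewrite ltey; apply/eqP/Foo.
  - by exists (D, a, b).
pose D i := (c i).1.1; pose a i := (c i).1.2; pose b i := (c i).2.
(* The box [k] of the cover of [F i] is numbered by the code of [(i, k)]. *)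
pose P : set (nat * nat) := setT `*`` D.
pose p (m : nat) : nat * nat := odflt (0, 0)%N (unpickle m).
have pK x : p (pickle x) = x by rewrite /p pickleK.
pose a' m := a (p m).1 (p m).2; pose b' m := b (p m).1 (p m).2.
have ab i k j : (a i k 0 j <= b i k 0 j)%R by have [[+ _] _] := cP i; apply.
apply: (@le_trans _ _ (\esum_(m in pickle @` P) (vol (a' m) (b' m))%:E)).
  apply: leb_le; split=> [k i|]; first exact: ab.
  move=> x /AF[i _ Fix]; have [[_ /(_ _ Fix)[k Dk bk]] _] := cP i.
  exists (pickle (i, k)); first by exists (i, k).
  by rewrite /a' /b' pK.
rewrite esum_image; last by move=> x y _ _; exact: (pcan_inj pickleK).
under eq_esum do rewrite /a' /b' pK.
rewrite -(@esum_esum _ _ _ setT D (fun i k => (vol (a i k) (b i k))%:E)); last first.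
  by move=> i k _ _; rewrite lee_fin vol_ge0.
rewrite -nneseries_esumT; last first.
  by move=> i; apply: esum_ge0 => k _; rewrite lee_fin vol_ge0.
apply: lee_nneseries => [i _ _|i _]; last exact: (cP i).2.
by apply: esum_ge0 => k _; rewrite lee_fin vol_ge0.
Qed.

HB.instance Definition _ := isSubsetOuterMeasure.Build R V leb
  leb0 leb_ge0 leb_subset_sigma_subadditive.

Lemma vol_split (a b : V) i c :
  (a 0 i <= c)%R -> (c <= b 0 i)%R ->
  let m := (\row_j if j == i then c else b 0 j)%R in
  let m' := (\row_j if j == i then c else a 0 j)%R in
  vol a b = (vol a m + vol m' b)%R.
Proof.
move=> ac cb m m'; rewrite /vol (bigD1 i)//= [in RHS](bigD1 i)//=.
rewrite [X in (_ = _ + X)%R](bigD1 i)//= !mxE eqxx.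
rewrite [X in (_ = _ * X + _)%R](eq_bigr (fun j => b 0 j - a 0 j)%R); last first.
  by move=> j /negbTE ji; rewrite mxE ji.
rewrite [X in (_ = _ + _ * X)%R](eq_bigr (fun j => b 0 j - a 0 j)%R); last first.
  by move=> j /negbTE ji; rewrite mxE ji.
by rewrite -mulrDl; congr (_ * _)%R; ring.
Qed.

(** A hyperplane cuts a box into two boxes whose volumes add up. *)
Lemma halfspace_measurable i (c : R) :
  leb.-caratheodory [set z : V | (z 0 i <= c)%R].
Proof.
apply: le_caratheodory_measurable => X.
apply: le_ereal_inf_tmp => _ [D [a [b [[ab Xab] ->]]]].
pose m k := (Num.max (a k 0 i) (Num.min (b k 0 i) c))%R.
have am k : (a k 0 i <= m k)%R by rewrite le_max lexx.
have mb k : (m k <= b k 0 i)%R by rewrite ge_max ab ge_min lexx.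
pose b' k : V := (\row_j if j == i then m k else b k 0 j)%R.
pose a' k : V := (\row_j if j == i then m k else a k 0 j)%R.
have ab' k j : (a k 0 j <= b' k 0 j)%R.
  by rewrite mxE; case: eqP => [->|_]; [exact: am|exact: ab].
have a'b k j : (a' k 0 j <= b k 0 j)%R.
  by rewrite mxE; case: eqP => [->|_]; [exact: mb|exact: ab].
have -> : \esum_(k in D) (vol (a k) (b k))%:E =
    \esum_(k in D) (vol (a k) (b' k))%:E + \esum_(k in D) (vol (a' k) (b k))%:E.
  rewrite -esumD; last 2 first.
  - by move=> k _; rewrite lee_fin vol_ge0.
  - by move=> k _; rewrite lee_fin vol_ge0.
  by apply: eq_esum => k _; rewrite -EFinD (vol_split (am k) (mb k)).
apply: leeD; apply: leb_le; split=> // x [Xx] /=.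
  move=> xc; have [k Dk bk] := Xab _ Xx; exists k => // j.
  have /andP[h1 h2] := bk j; rewrite h1 mxE; case: eqP => [->|//].
  by rewrite /m le_max le_min xc andbT; have /andP[_ ->] := bk i; rewrite orbT.
move=> /negP; rewrite -ltNge => cx; have [k Dk bk] := Xab _ Xx; exists k => // j.
have /andP[h1 h2] := bk j; rewrite h2 andbT mxE; case: eqP => [->|//].
by rewrite /m ge_max ge_min (ltW cx) orbT andbT; have /andP[->] := bk i.
Qed.

Definition hobox (a b : V) : set V :=
  [set z | forall i, (a 0 i < z 0 i <= b 0 i)%R].

Lemma hobox_measurable a b : leb.-caratheodory (hobox a b).
Proof.
have -> : hobox a b = \big[setI/setT]_i ([set z : V | (z 0 i <= b 0 i)%R] `&`
    ~` [set z : V | (z 0 i <= a 0 i)%R]).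
  apply/seteqP; split=> [z H|z].
    elim/big_rec: _ => // i A _ Az; split=> //; split=> /=.
      by have /andP[] := H i.
    by apply/negP; rewrite -ltNge; have /andP[] := H i.
  move=> H i; move: H; rewrite (bigD1 i)//= => -[[/= zb /negP za] _].
  by rewrite zb andbT ltNge.
apply: (big_ind (fun A => leb.-caratheodory A)).
- by rewrite -setC0; apply/caratheodory_measurable_setC/caratheodory_measurable_set0.
- exact: caratheodory_measurable_setI.
- move=> i _; apply: caratheodory_measurable_setI; first exact: halfspace_measurable.
  by apply: caratheodory_measurable_setC; exact: halfspace_measurable.
Qed.

Lemma open_measurable_leb (O : set V) : open O -> leb.-caratheodory O.
Proof.
move=> oO.
pose I := ({ffun 'I_n -> rat} * {ffun 'I_n -> rat})%type.
pose B (q : I) := hobox (\row_i ratr (q.1 i)) (\row_i ratr (q.2 i)).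
pose F (m : nat) := if unpickle m is Some q then
  (if `[< B q `<=` O >] then B q else set0) else set0.
have -> : O = \bigcup_m F m.
  apply/seteqP; split=> z; last first.
    move=> [m _]; rewrite /F; case: unpickle => [q|//].
    by case: asboolP => // BO /BO.
  rewrite openE in oO; move=> /oO/nbhs_ballP[r /= r0 zO].
  have /choice[p pP] : forall i, exists p : rat * rat,
      [/\ z 0 i - r < ratr p.1, ratr p.1 < z 0 i, z 0 i < ratr p.2 & ratr p.2 < z 0 i + r]%R.
    move=> i.
    have [p] := @rat_in_itvoo R (z 0 i - r)%R (z 0 i)%R (ltac:(by rewrite ltrBlDr ltrDl)).
    have [q] := @rat_in_itvoo R (z 0 i)%R (z 0 i + r)%R (ltac:(by rewrite ltrDl)).
    rewrite !in_itv/= => /andP[h1 h2] /andP[h3 h4].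
    by exists (p, q).
  pose q : I := ([ffun i => (p i).1], [ffun i => (p i).2]).
  exists (pickle q) => //; rewrite /F pickleK.
  have zq : B q z by move=> i; rewrite !mxE !ffunE; have [_ -> /ltW-> _] := pP i.
  case: asboolP => // -[] y By; apply: zO.
  rewrite -ball_normE /ball_/= [ltLHS]/Num.norm/= mx_normrE.
  apply/bigmax_ltP; split=> // -[i0 i] _ /=; rewrite !mxE (ord1 i0).
  have := By i; rewrite !mxE !ffunE => /andP[h1 h2]; have [h3 h4 h5 h6] := pP i.
  rewrite ltr_norml; apply/andP; split; lra.
apply: caratheodory_measurable_bigcup => m; rewrite /F.
case: unpickle => [q|]; last exact: caratheodory_measurable_set0.
by case: asboolP => _; [exact: hobox_measurable|exact: caratheodory_measurable_set0].
Qed.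

Lemma negligible_measurable N : lebesgue_negligible N -> leb.-caratheodory N.
Proof.
move=> N0; have lN : leb N <= 0.
  apply/lee_addgt0Pr => e e0; rewrite add0e.
  have [D [a [b [ab NU le]]]] := N0 e e0.
  by apply: le_trans le; apply: leb_le.
apply: le_caratheodory_measurable => X.
rewrite [Y in Y + _](_ : _ = 0).
  by rewrite add0e; exact: le_outer_measure.
apply/eqP; rewrite eq_le leb_ge0 andbT; apply: le_trans lN.
exact: le_outer_measure.
Qed.

Lemma lebesgue_caratheodory A : lebesgue_measurable_set A -> leb.-caratheodory A.
Proof.
move=> [X [N [sX /negligible_measurable mN ->]]].
apply: caratheodory_measurable_setU => //.
apply: (smallest_sub _ _ sX); last exact: open_measurable_leb.
split; first exact: caratheodory_measurable_set0.
  by move=> B mB; rewrite setTD; exact: caratheodory_measurable_setC.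
by move=> F mF; exact: caratheodory_measurable_bigcup.
Qed.

Lemma leb_box (a b : V) : (forall i, a 0 i <= b 0 i)%R ->
  leb (box a b) <= (vol a b)%:E.
Proof.
move=> ab; have : box_cover [set 0%N] (fun=> a) (fun=> b) (box a b).
  by split=> // x abx; exists 0%N.
by move/leb_le; rewrite esum_set1// lee_fin vol_ge0.
Qed.

Lemma leb_continuity_above (E : nat -> set V) (e : R) :
  (0 < e)%R -> leb (E 0%N) < +oo -> (forall j, leb.-caratheodory (E j)) ->
  (forall i j, (i <= j)%N -> E j `<=` E i) -> \bigcap_j E j = set0 ->
  exists j, leb (E j) < e%:E.
Proof.
move=> e0 E0 mE nE capE.
pose mu0 : {outer_measure set V -> \bar R} := leb.
pose mu : {measure set (caratheodory_type mu0) -> \bar R} := mu0.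
have : mu \o E @ \oo --> mu (\bigcap_j E j).
  apply: nonincreasing_cvg_mu => //.
    by rewrite capE; exact: measurable0.
  by move=> i j ij; apply/subsetPset; exact: nE.
rewrite capE measure0 => /fine_cvgP[fE /cvgrPdist_lt/(_ e e0) cE].
near \oo => j; exists j.
have fj : leb (E j) \is a fin_num by near: j.
rewrite -(fineK fj) lte_fin.
have : (`|0 - fine (leb (E j))| < e)%R by near: j.
by rewrite sub0r normrN; apply: le_lt_trans; exact: ler_norm.
Unshelve. all: by end_near. Qed.

End LebesgueOuterMeasure.

(** * Volumes of covers and preimages under expanding maps *)

Section LebesguePositivity.
Context (R : realType).

Lemma polyfun_closed0 (Q : R -> R) (A : set R) :
  polyfun (fun _ : unit => @id R) Q -> closed A ->
  (forall k, A (Q k.+1%:R^-1)) -> A (Q 0).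
Proof.
move=> pQ cA AQ; apply: (@closed_cvg _ _ \oo _ (fun k => Q (harmonic k)) A) => //.
  by apply: nearW => k; exact: AQ.
apply: (cvg_comp _ _ (@cvg_harmonic R)).
by apply: (polyfun_continuous _ pQ) => _ x; exact: cvg_id.
Qed.

Local Open Scope ereal_scope.

Lemma integral_indic_itv (a b c e w : R) : (a <= b)%R -> (c <= e)%R -> (0 <= w)%R ->
  \int[lebesgue_measure]_(y in `[a, b]) (w%:E * (\1_`[c, e] y)%:E) <= (w * (e - c))%:E.
Proof.
move=> ab ce w0; rewrite ge0_integralZl//; last first.
  by apply/measurable_EFinP; exact: measurable_indic.
rewrite integral_indic// EFinM; apply: lee_wpmul2l; first by rewrite lee_fin.
apply: (@le_trans _ _ (lebesgue_measure (`[c, e]%classic : set R))).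
  by apply: le_measure; rewrite ?inE//; exact: measurableI.
rewrite lebesgue_measure_itv/= lte_fin; case: ifP => // _.
by rewrite lee_fin subr_ge0.
Qed.

(** Countable covers of a box by boxes: slicing along the last coordinate
    reduces the dimension, and integrating the inequality of the slices gives
    the claim. *)
Lemma cover_vol (m : nat) (a b : nat -> R) (D : set nat) (A B : nat -> nat -> R) :
  (forall k i, A k i <= B k i)%R -> (forall i, a i <= b i)%R ->
  (forall z : nat -> R, (forall i, (i < m)%N -> a i <= z i <= b i)%R ->
     exists2 k, D k & forall i, (i < m)%N -> (A k i <= z i <= B k i)%R) ->
  (\prod_(i < m) (b i - a i))%:E
    <= \esum_(k in D) (\prod_(i < m) (B k i - A k i))%:E.
Proof.
move=> AB ab; elim: m D => [|m IH] D cov.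
  have [|k Dk _] := cov a; first by [].
  rewrite big_ord0; apply: esum_ge; exists [set k].
    by split=> // _ ->.
  by rewrite fsbig_set1 big_ord0.
pose w k := (\prod_(i < m) (B k i - A k i))%R.
have w0 k : (0 <= w k)%R by apply: prodr_ge0 => i _; rewrite subr_ge0.
pose v := (\prod_(i < m) (b i - a i))%R.
pose c k := (if k \in D then w k else 0)%R.
have c0 k : (0 <= c k)%R by rewrite /c; case: ifP.
pose g k y := (c k)%:E * (\1_`[A k m, B k m] y)%:E : \bar R.
have g0 k y : 0 <= g k y by rewrite mule_ge0// lee_fin.
have slice y : `[a m, b m]%classic y -> v%:E <= \sum_(k <oo) g k y.
  rewrite /= in_itv/= => yab.
  pose Dy := D `&` [set k | (A k m <= y <= B k m)%R].
  apply: (@le_trans _ _ (\esum_(k in Dy) (w k)%:E)).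
    apply: IH => z zab.
    have [i im|k Dk zk] := cov (fun i => if i == m then y else z i).
      case: eqP => [->//|/eqP im']; apply: zab.
      by rewrite ltn_neqAle im' -ltnS.
    exists k; first by split=> //=; have := zk m (ltnSn m); rewrite eqxx.
    move=> i im; have := zk i (ltnW im).
    by rewrite (ltn_eqF im); apply; rewrite ltnS ltnW.
  rewrite nneseries_esumT//; rewrite esum_mkcond; apply: le_esum => k _.
  rewrite /g /c indicE /Dy in_setI; case: (k \in D) => /=; last by rewrite mul0e.
  rewrite (_ : (y \in `[A k m, B k m]%classic) = (k \in [set k | (A k m <= y <= B k m)%R])).
    by case: ifP => _; rewrite ?mule1 ?mule0.
  by apply/idP/idP; rewrite !inE /= in_itv.
have mg k : measurable_fun `[a m, b m] (g k).
  by apply: measurable_funeM; apply/measurable_EFinP; exact: measurable_indic.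
have : \int[lebesgue_measure]_(y in `[a m, b m]) (cst v%:E y)
    <= \int[lebesgue_measure]_(y in `[a m, b m]) (\sum_(k <oo) g k y).
  apply: ge0_le_integral => //.
  - by move=> y _; rewrite lee_fin; apply: prodr_ge0 => i _; rewrite subr_ge0.
  - by apply: (ge0_emeasurable_sum (P := xpredT)) => [k y _ _|k _]; [exact: g0|exact: mg].
rewrite integral_cst//= lebesgue_measure_itv/= lte_fin.
have -> : v%:E * (if (a m < b m)%R then (b m)%:E - (a m)%:E else 0)
    = (\prod_(i < m.+1) (b i - a i))%:E.
  rewrite big_ord_recr/= EFinM; congr (_ * _).
  case: ltP => // ba; apply/eqP.
  by rewrite eqe eq_sym subr_eq0 eq_le ba ab.
move=> /le_trans; apply.
rewrite integral_nneseries// [leRHS]esum_mkcond -nneseries_esumT; last first.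
  move=> k; case: ifP => // _; rewrite lee_fin.
  by apply: prodr_ge0 => i _; rewrite subr_ge0.
apply: lee_nneseries => [k _ _|k _]; first exact: integral_ge0.
apply: le_trans (integral_indic_itv (ab m) (AB k m) (c0 k)) _.
rewrite /c; case: ifP => _; last by rewrite mul0r.
by rewrite big_ord_recr.
Qed.

Context (n : nat).
Local Notation V := 'rV[R]_n.

Lemma leb_box_ge (a b : V) : (forall i, a 0%R i <= b 0%R i)%R ->
  (vol a b)%:E <= leb (box a b).
Proof.
move=> ab; apply: le_ereal_inf_tmp => _ [D [A [B [[AB cov] ->]]]].
pose f (x : V) (i : nat) : R := if insub i is Some j then x 0%R j else 0%R.
have fE (x : V) (i : 'I_n) : f x i = x 0%R i by rewrite /f valK.
have volE (x y : V) : vol x y = (\prod_(i < n) (f y i - f x i))%R.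
  by apply: eq_bigr => i _; rewrite !fE.
rewrite volE; under eq_esum do rewrite volE.
have fle (x y : V) : (forall i, x 0 i <= y 0 i)%R -> forall i, (f x i <= f y i)%R.
  by move=> xy i; rewrite /f; case: insubP.
apply: (@cover_vol n (f a) (f b) D (fun k => f (A k)) (fun k => f (B k))) => [k|i|z zab]; [exact/fle/AB|exact: fle|].
have [|k Dk bk] := cov (\row_i z i)%R.
  by move=> i; rewrite mxE -!fE zab.
exists k => // i im; have := bk (Ordinal im).
by rewrite mxE -!fE.
Qed.

Section Pullback.
Context (T : set V) (F : V -> V) (c : R).
Hypothesis c0 : (0 < c)%R.
Hypothesis Fc : forall s t, T s -> T t -> (c * `|s - t| <= `|F s - F t|)%R.
Let C := ((4 / c) ^+ n)%R.
Let pull E := leb (T `&` F @^-1` E).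

(** The preimage of a box with sides comparable to [s] has diameter of order
    [s / c]. *)
Lemma pull_cube (a b : V) s : (0 < s)%R ->
  (forall i, s <= b 0%R i - a 0%R i <= 2 * s)%R ->
  pull (box a b) <= (C * vol a b)%:E.
Proof.
move=> s0 abs.
have ab i : (a 0 i <= b 0 i)%R by have /andP[+ _] := abs i; lra.
have volC : (0 <= C * vol a b)%R.
  by rewrite mulr_ge0 ?vol_ge0// exprn_ge0// divr_ge0// ltW.
rewrite /pull; have [->|/set0P[t0 [Tt0 Ft0]]] := eqVneq (T `&` F @^-1` box a b) set0.
  by rewrite outer_measure0 lee_fin.
pose r := (2 * s / c)%R.
pose p := (t0 - const_mx r)%R; pose q := (t0 + const_mx r)%R.
have r0 : (0 <= r)%R by rewrite divr_ge0 ?mulr_ge0 ?ltW.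
have pq i : (p 0 i <= q 0 i)%R by rewrite !mxE; lra.
apply: (@le_trans _ _ (leb (box p q))).
  apply: le_outer_measure => t [Tt Ft] i.
  have : (`|t - t0| <= r)%R.
    rewrite /r ler_pdivlMr// mulrC; apply: le_trans (Fc Tt Tt0) _.
    apply: mx_norm_leP => [|j k]; first by rewrite mulr_ge0 ?ltW.
    rewrite !mxE (ord1 j) ler_norml.
    have /andP[h1 h2] := Ft k; have /andP[h3 h4] := Ft0 k; have /andP[h5 h6] := abs k.
    by apply/andP; split; lra.
  move=> /(le_trans (mxcoord_le _ 0%R i)); rewrite !mxE ler_norml => /andP[h1 h2].
  by apply/andP; split; lra.
apply: le_trans (leb_box pq) _; rewrite lee_fin /C /vol.
rewrite -[X in (_ ^+ X)%R]card_ord -prodr_const -big_split/=.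
apply: ler_prod => i _; apply/andP; split; first by rewrite subr_ge0.
rewrite !mxE; have /andP[h _] := abs i.
apply: (@le_trans _ _ (4 / c * s)%R).
  by rewrite /r le_eqVlt; apply/orP; left; apply/eqP; field; rewrite gt_eqF.
by rewrite ler_wpM2l// divr_ge0// ltW.
Qed.

(** Long boxes are bisected until their sides are comparable; that the sides
    are bounded below makes this terminate. *)
Lemma pull_fat_box (m : nat) (a b : V) s : (0 < s)%R ->
  (forall i, s <= b 0%R i - a 0%R i)%R ->
  (\sum_i (b 0%R i - a 0%R i) <= m%:R * s)%R ->
  pull (box a b) <= (C * vol a b)%:E.
Proof.
move=> s0; elim: m a b => [|m IH] a b abs absum.
  apply: (pull_cube s0) => i; rewrite abs/=.
  apply: (@le_trans _ _ (\sum_i (b 0 i - a 0 i))%R).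
    rewrite (bigD1 i)//= lerDl; apply: sumr_ge0 => j _.
    exact: le_trans (ltW s0) (abs j).
  by apply: le_trans absum _; rewrite mul0r mulr_ge0// ltW.
have [|/forallPn[i]] := boolP [forall i, (b 0%R i - a 0%R i <= 2 * s)%R].
  by move=> /forallP H; apply: (pull_cube s0) => i; rewrite abs H.
rewrite -ltNge => li; pose c' := ((a 0 i + b 0 i) / 2)%R.
have ac : (a 0 i <= c')%R by rewrite /c'; lra.
have cb : (c' <= b 0 i)%R by rewrite /c'; lra.
pose p := (\row_j if j == i then c' else b 0 j)%R : V.
pose q := (\row_j if j == i then c' else a 0 j)%R : V.
have pE j : (j != i)%N -> p 0%R j = b 0%R j by rewrite mxE => /negbTE ->.
have qE j : (j != i)%N -> q 0%R j = a 0%R j by rewrite mxE => /negbTE ->.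
have pi : p 0%R i = c' by rewrite mxE eqxx.
have qi : q 0%R i = c' by rewrite mxE eqxx.
apply: (@le_trans _ _ (pull (box a p) + pull (box q b))).
  apply: le_trans (outer_measureU2 _ _ _); apply: le_outer_measure => t [Tt Ft] /=.
  have [Fc'|cF] := leP (F t 0%R i) c'; [left|right]; split=> // j;
    have /andP[h1 h2] := Ft j; have [->|ji] := eqVneq j i.
  - by rewrite pi Fc' andbT; have /andP[] := Ft i.
  - by rewrite pE// h1 h2.
  - by rewrite qi (ltW cF); have /andP[] := Ft i.
  - by rewrite qE// h1 h2.
rewrite (vol_split ac cb) mulrDr EFinD; apply: leeD; apply: IH.
- move=> j; have [->|ji] := eqVneq j i; last by rewrite pE.
  by rewrite pi /c'; lra.
- move: absum; rewrite (bigD1 i)//= [in X in _ -> X](bigD1 i)//= pi.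
  rewrite [X in _ -> (_ + X <= _)%R](eq_bigr (fun j => b 0 j - a 0 j)%R); last first.
    by move=> j ji; rewrite pE.
  by rewrite -natr1 mulrDl mul1r /c'; lra.
- move=> j; have [->|ji] := eqVneq j i; last by rewrite qE.
  by rewrite qi /c'; lra.
- move: absum; rewrite (bigD1 i)//= [in X in _ -> X](bigD1 i)//= qi.
  rewrite [X in _ -> (_ + X <= _)%R](eq_bigr (fun j => b 0 j - a 0 j)%R); last first.
    by move=> j ji; rewrite qE.
  by rewrite -natr1 mulrDl mul1r /c'; lra.
Qed.

(** Degenerate boxes are limits of boxes with positive sides. *)
Lemma pull_box (a b : V) : (forall i, a 0%R i <= b 0%R i)%R ->
  pull (box a b) <= (C * vol a b)%:E.
Proof.
move=> ab; pose be (e : R) := (b + const_mx e)%R.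
have fat k : pull (box a b) <= (C * vol a (be k.+1%:R^-1))%:E.
  set s := k.+1%:R^-1%R; have s0 : (0 < s)%R by rewrite invr_gt0.
  have [m lem] : exists m : nat, (\sum_i (be s 0%R i - a 0%R i) / s <= m%:R)%R.
    have := archi_boundP (_ : 0 <= \sum_i (be s 0%R i - a 0%R i) / s)%R.
    set N := Num.bound _ => H; exists N; apply/ltW/H.
    apply: sumr_ge0 => i _; apply: divr_ge0; last exact: ltW.
    by rewrite !mxE; have := ab i; lra.
  apply: (@le_trans _ _ (pull (box a (be s)))).
    apply: le_outer_measure => t [Tt Ft]; split=> // i; rewrite !mxE.
    by have /andP[-> h] := Ft i; rewrite (le_trans h)// lerDl ltW.
  apply: (@pull_fat_box m _ _ s) => //.
    by move=> i; rewrite !mxE; have := ab i; lra.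
  by rewrite -ler_pdivrMr// mulr_suml.
have pfin : pull (box a b) \is a fin_num.
  rewrite ge0_fin_numE ?outer_measure_ge0//.
  by apply: le_lt_trans (fat 0%N) _; rewrite ltry.
rewrite -(fineK pfin) lee_fin.
have := @polyfun_closed0 (fun e => C * vol a (be e))%R
  [set x | fine (pull (box a b)) <= x]%R.
rewrite /=; have -> : be 0%R = b by apply/rowP => i; rewrite !mxE addr0.
apply.
- apply: polyfun_mul; first exact: polyfun_cst.
  apply: polyfun_prod => i _.
  apply: (@polyfun_ext _ _ _ _ (fun e => e + (b 0 i - a 0 i))%R).
    by move=> e; rewrite !mxE; ring.
  by apply: polyfun_add; [exact: (polyfun_var _ tt)|exact: polyfun_cst].
- exact: closed_ge.
- by move=> k; rewrite -lee_fin fineK.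
Qed.

(** Pulling back a cover by boxes multiplies the total volume by at most
    [C]. *)
Lemma leb_pullback (E : set V) (e : R) : leb E < e%:E -> pull E <= (C * e)%:E.
Proof.
move=> /ereal_inf_lt[_ [D [a [b [[ab cov] ->]]]] lte].
pose H k := if k \in D then T `&` F @^-1` box (a k) (b k) else set0.
apply: (@le_trans _ _ (leb (\bigcup_k H k))).
  apply: le_outer_measure => t [Tt /cov[k Dk bk]]; exists k => //.
  by rewrite /H mem_set.
apply: le_trans (outer_measure_sigma_subadditive _ _) _.
have C0 : (0 <= C)%R by rewrite exprn_ge0// divr_ge0// ltW.
pose w k := if k \in D then (vol (a k) (b k))%:E else 0.
have w0 k : 0 <= w k by rewrite /w; case: ifP => // _; rewrite lee_fin vol_ge0.
apply: (@le_trans _ _ (\sum_(k <oo) (C%:E * w k))).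
  apply: lee_nneseries => [k _ _|k _]; first exact: outer_measure_ge0.
  rewrite /H /w; case: ifP => _; first by rewrite -EFinM; exact: pull_box.
  by rewrite outer_measure0 mule0.
rewrite nneseriesZl// nneseries_esumT// -esum_mkcond EFinM.
by apply: lee_wpmul2l; [rewrite lee_fin|exact: ltW].
Qed.

End Pullback.

End LebesguePositivity.

(** * The topology of a homogeneous distance *)

Section HomogeneousDistance.
Context (R : realType) (n : nat) (G : stratified_group R n).
Local Notation V := 'rV[R]_n.
Local Notation H1 := (layer G 1).
Local Notation "x ** y" := (gmul G x y) (at level 40, left associativity).
Context (d : V -> V -> R) (d_hom : homogeneous_distance G d).
Local Notation nrm := (d 0).

Lemma dist_nrm x y : d x y = nrm (- x ** y).
Proof. by rewrite -(hdist_left_invariant d_hom (- x)) gmulNV. Qed.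

Lemma dist_mulr x w : d x (x ** w) = nrm w.
Proof. by rewrite dist_nrm gmulKV. Qed.

Lemma distxx x : d x x = 0.
Proof. exact/(hdist_eq0 d_hom). Qed.

Lemma dist_ge0 x y : 0 <= d x y.
Proof.
have := hdist_triangle d_hom x y x.
by rewrite distxx [d y x](hdist_sym d_hom) -mulr2n pmulrn_lge0.
Qed.

Lemma nrm0_eq0 z : nrm z = 0 -> z = 0.
Proof. by move=> /(hdist_eq0 d_hom) <-. Qed.

Lemma nrmN z : nrm (- z) = nrm z.
Proof. by rewrite -{1}(gmulg0 G (- z)) -dist_nrm (hdist_sym d_hom). Qed.

Lemma nrmM x y : nrm (x ** y) <= nrm x + nrm y.
Proof. by rewrite -(dist_mulr x y) (hdist_triangle d_hom). Qed.

Lemma nrm_dilation r z : 0 <= r -> nrm (dilation G r z) = r * nrm z.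
Proof.
rewrite le_eqVlt => /orP[/eqP <-|r0]; first by rewrite dilation0r mul0r distxx.
by rewrite -(hdist_dilation d_hom _ _ r0) dilationr0.
Qed.

Lemma nrmZ r h : h \in H1 -> nrm (r *: h) = `|r| * nrm h.
Proof.
move=> hH; have [r0|r0] := leP 0 r.
  by rewrite -(dilation_h r hH) nrm_dilation// ger0_norm.
rewrite -nrmN -scaleNr -(dilation_h (- r) hH) nrm_dilation ?oppr_ge0 ?ltW//.
by rewrite ltr0_norm.
Qed.

Lemma pair_var_continuous (T1 T2 : topologicalType) (I1 I2 : Type)
  (c1 : I1 -> T1 -> R) (c2 : I2 -> T2 -> R) k (F : T1 * T2 -> 'rV[R]_k) :
  (forall i, continuous (c1 i)) -> (forall i, continuous (c2 i)) ->
  polymap (paircoord c1 c2) F -> continuous F.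
Proof.
move=> h1 h2; apply: polymap_continuous; exact: paircoord_continuous.
Qed.

Lemma gmull_continuous x : continuous (gmul G x).
Proof.
apply: (@polymap_continuous _ _ _ (@mxcoord R 1 n)).
  by move=> i; exact: mxcoord_continuous.
by apply: gmul_polymap; [exact: polymap_cst|exact: polymap_mxcoord].
Qed.

Lemma dilation_r_continuous x : continuous (fun r => dilation G r x).
Proof.
apply: (@polymap_continuous _ _ _ (fun _ : unit => @id R)).
  by move=> _ y; exact: cvg_id.
by apply: dilation_polymap; [exact: (polyfun_var _ tt)|exact: polymap_cst].
Qed.

Lemma dist_continuous_r x : continuous (d x).
Proof.
move=> y; apply: (@continuous_comp _ _ _ (fun y => (x, y)) (fun z => d z.1 z.2)).
  move=> A [[B C] /= [Bx Cy] BCA]; apply: filterS Cy => z Cz.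
  by apply: BCA; split=> //=; exact: nbhs_singleton Bx.
exact: (hdist_continuous d_hom).
Qed.

Lemma sphere_compact (e : R) : compact [set z : V | `|z| = e].
Proof.
apply: bounded_closed_compact.
  exists e; split; first exact: num_real.
  by move=> c ec z /= ->; exact: ltW.
have -> : [set z : V | `|z| = e] = (fun z : V => `|z|) @^-1` [set e] by [].
apply: closed_comp; last exact: closed_eq.
by move=> z _; exact: norm_continuous.
Qed.

(** A homogeneous distance induces the topology: on a sphere of a norm it is
    bounded below, and every point outside of the ball is dilated into the
    sphere by some factor in [0, 1]. *)
Lemma nrm_small (e : R) : 0 < e ->
  exists2 m : R, 0 < m & forall z, nrm z < m -> `|z| < e.
Proof.
move=> e0.
have [m m0 mP] : exists2 m : R, 0 < m & forall z, `|z| = e -> m <= nrm z.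
  have [S0|/set0P Sn] := eqVneq [set z : V | `|z| = e] set0.
    exists 1 => // z ze; have : [set z : V | `|z| = e] z by [].
    by rewrite S0.
  have [|c ce cmin] := @EVT_min_rV R n nrm _ Sn (@sphere_compact e).
    by apply: continuous_subspaceT; exact: dist_continuous_r.
  exists (nrm c) => [|z ze]; last by apply: cmin; rewrite inE.
  rewrite lt_neqAle dist_ge0 andbT eq_sym; apply/eqP => /nrm0_eq0 c0.
  by move: ce; rewrite inE /= c0 normr0 => e0'; rewrite e0' ltxx in e0.
exists m => // z zm; rewrite ltNge; apply/negP => ez.
have cf : {within `[0, 1], continuous (fun r => `|dilation G r z|)}.
  apply: continuous_subspaceT => r.
  by apply: continuous_comp; [exact: dilation_r_continuous|exact: norm_continuous].
have [] := IVT (@ler01 R) cf (v := e).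
  rewrite dilation0r dilation1 normr0 ge_min ltW//= le_max ez orbT//.
move=> r; rewrite in_itv/= => /andP[r0 r1] /mP.
rewrite nrm_dilation// leNgt => /negP; apply.
by apply: le_lt_trans zm; rewrite ler_piMl// dist_ge0.
Qed.

Lemma open_dball x (O : set V) : nbhs x O ->
  exists2 m : R, 0 < m & forall z, d x z < m -> O z.
Proof.
move=> Ox; have : nbhs (0 : V) (gmul G x @^-1` O).
  by apply: gmull_continuous; rewrite gmulg0.
move=> /nbhs_ballP[e /= e0 eO]; have [m m0 mP] := nrm_small e0.
exists m => // z; rewrite dist_nrm => /mP ze.
have := eO (- x ** z); rewrite /= gmulVK; apply.
by rewrite -ball_normE /ball_/= sub0r normrN.
Qed.

Lemma dball_nbhs x (m : R) : 0 < m -> \forall z \near x, d x z < m.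
Proof.
move=> m0; have := @dist_continuous_r x x; rewrite /continuous_at distxx.
move=> /cvgrPdist_lt/(_ _ m0); apply: filterS => z.
by rewrite sub0r normrN ger0_norm ?dist_ge0.
Qed.

Lemma dilation_gprod r (l : seq V) :
  dilation G r (gprod G l) = gprod G [seq dilation G r h | h <- l].
Proof. by elim: l => [|h l IH] /=; rewrite ?dilationr0// dilationM IH. Qed.

(** By homogeneity the word for [z] may be chosen with factors of norm
    comparable to that of [z]. *)
Lemma generation : exists (l : seq V) (K : nat) (C : R),
  [/\ horizontal G l, 0 <= C & forall z,
    exists w : seq (R * V), [/\ size w = K,
      forall th, th \in w -> nrm (th.1 *: th.2) <= C * nrm z /\ th.2 \in l &
      gprod G [seq th.1 *: th.2 | th <- w] = z]].
Proof.
have [l [K [B [e [lH e0 lP]]]]] := local_generation G.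
have [m m0 mP] := nrm_small e0.
pose S := \sum_(h <- l) nrm h.
have S0 : 0 <= S by apply: sumr_ge0 => h _; exact: dist_ge0.
have lS h : h \in l -> nrm h <= S.
  move=> hl; rewrite /S (big_rem h)//= lerDl; apply: sumr_ge0 => *.
  exact: dist_ge0.
exists l, K, (2 / m * (`|B| * S)); split=> //.
  by rewrite !mulr_ge0// invr_ge0 ltW.
move=> z; pose rho := 2 / m * nrm z.
have rho0 : 0 <= rho by rewrite !mulr_ge0 ?dist_ge0// invr_ge0 ltW.
have [zeta zetaP zE] : exists2 zeta, `|zeta| < e & dilation G rho zeta = z.
  have [z0|z0] := eqVneq (nrm z) 0.
    by exists 0; rewrite ?normr0 ?dilationr0// (nrm0_eq0 z0).
  have rn0 : rho != 0 by rewrite mulf_neq0// mulf_neq0 ?pnatr_eq0// invr_neq0// gt_eqF.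
  exists (dilation G rho^-1 z); last by rewrite dilationVK.
  apply: mP; rewrite nrm_dilation ?invr_ge0// /rho.
  have -> : (2 / m * nrm z)^-1 * nrm z = m / 2.
    by field; rewrite z0 gt_eqF.
  by rewrite ltr_pdivrMr// ltr_pMr// ltr1n.
have [w [wK wl wz]] := lP _ zetaP.
have lH1 h : h \in l -> h \in H1 by move/allP: lH; apply.
exists [seq (rho * th.1, th.2) | th <- w]; split; first by rewrite size_map.
  move=> _ /mapP[th thw ->] /=; have [thB thl] := wl _ thw; split=> //.
  rewrite (nrmZ _ (lH1 _ thl)) normrM (ger0_norm rho0) -[leLHS]mulrA.
  rewrite [leRHS](_ : _ = rho * (`|B| * S)); last by rewrite /rho; ring.
  rewrite ler_wpM2l// ler_pM ?dist_ge0 ?lS//.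
  exact: le_trans thB (ler_norm _).
rewrite -zE -wz dilation_gprod -!map_comp; congr (gprod G _).
apply/eq_in_map => th thw /=; have [_ thl] := wl _ thw.
by rewrite dilationZ (dilation_h _ (lH1 _ thl)) scalerA mulrC.
Qed.

End HomogeneousDistance.

(** * Local upper bounds for h-convex functions *)

Section LocalUpperBound.
Context (R : realType) (n : nat) (G : stratified_group R n).
Local Notation V := 'rV[R]_n.
Local Notation H1 := (layer G 1).
Local Notation "x ** y" := (gmul G x y) (at level 40, left associativity).
Context (Om : set V) (u : V -> R) (u_conv : hconvex G Om u).

Lemma hconvex_line y h l : h \in H1 ->
  (forall t, 0 <= t <= 1 -> Om (y ** (t *: h))) -> 0 <= l <= 1 ->
  u (y ** (l *: h)) <= l * u (y ** h) + (1 - l) * u y.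
Proof.
move=> hH yOm l01.
have Oy : Om y by rewrite -(gmulg0 G y) -(scale0r h); apply: yOm; rewrite lexx ler01.
have Oyh : Om (y ** h) by rewrite -(scale1r h); apply: yOm; rewrite lexx ler01.
have := u_conv Oy Oyh; rewrite ginvE gmulKV => /(_ hH).
rewrite -(dilation_h l hH); apply => // _ [t /= + <-].
by rewrite in_itv/= (dilation_h t hH); exact: yOm.
Qed.

Lemma hconvex_mid y h : h \in H1 ->
  (forall t, `|t| <= 1 -> Om (y ** (t *: h))) ->
  2 * u y <= u (y ** h) + u (y ** - h).
Proof.
move=> hH yOm.
have E t : y ** - h ** (t *: (2 *: h)) = y ** ((2 * t - 1) *: h).
  by rewrite -gmulA -scaleN1r scalerA gmul_line; congr (_ ** (_ *: _)); ring.
have := @hconvex_line (y ** - h) (2 *: h) 2^-1 (rpredZ _ hH).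
rewrite E.
have -> : y ** - h ** (2 *: h) = y ** h.
  by have := E 1; rewrite scale1r => ->; rewrite mulr1 (_ : 2 - 1 = 1) ?scale1r//; ring.
rewrite mulfV ?pnatr_eq0// subrr scale0r gmulg0.
have h01 : 0 <= (2^-1 : R) <= 1 by apply/andP; split; lra.
move=> H.
suff : u y <= 2^-1 * u (y ** h) + (1 - 2^-1) * u (y ** - h) by lra.
apply: H => // t /andP[t0 t1]; rewrite E; apply: yOm.
by rewrite ler_norml; apply/andP; split; lra.
Qed.

(** By convexity the value at [x] is at most the larger of the values at
    [x (s h)] and at [x (- s h)]; iterating this gives a binary tree rooted at [x],
    and a bound by the values at its leaves. *)
Lemma tree_bound (J : eqType) (h : J -> V) (r : seq J) (s : J -> R) x M :
  (forall j, h j \in H1) -> uniq r ->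
  (forall c : J -> R, (forall j, `|c j| <= `|s j|) ->
     Om (x ** gprod G [seq c j *: h j | j <- r])) ->
  (forall e : J -> bool,
     u (x ** gprod G [seq ((-1) ^+ e j * s j) *: h j | j <- r]) <= M) ->
  u x <= M.
Proof.
move=> hH; elim: r x => [|j r IH] x /=.
  by move=> _ _ /(_ (fun=> true)); rewrite gmulg0.
move=> /andP[jr ur] xOm xM.
have upd (T : Type) (c : J -> T) (v : T) (f : J -> T -> V) :
    [seq f i (if i == j then v else c i) | i <- r] = [seq f i (c i) | i <- r].
  apply/eq_in_map => i ir; case: eqP => // ij.
  by move: jr; rewrite -ij ir.
have child (b : bool) : u (x ** (((-1) ^+ b * s j) *: h j)) <= M.
  apply: IH => // [c cs|e].
    have := xOm (fun i => if i == j then (-1) ^+ b * s j else c i).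
    rewrite eqxx (upd _ _ _ (fun i a => a *: h i)) gmulA; apply => i.
    by case: eqP => // ->; rewrite normrM normr_sign mul1r.
  have := xM (fun i => if i == j then b else e i).
  by rewrite eqxx (upd bool _ _ (fun i a => ((-1) ^+ a * s i) *: h i)) gmulA.
have mid : 2 * u x <= u (x ** (s j *: h j)) + u (x ** - (s j *: h j)).
  apply: hconvex_mid => [|t t1]; first by rewrite rpredZ.
  have := xOm (fun i => if i == j then t * s j else 0).
  rewrite eqxx (upd _ _ _ (fun i a => a *: h i)) scalerA.
  have -> : gprod G [seq 0 *: h i | i <- r] = 0.
    by elim: (r) => //= a l ->; rewrite scale0r gmulg0.
  rewrite gmulg0; apply => i; case: eqP => [->|_]; last by rewrite normr0.
  by rewrite normrM ler_piMl.
have := child false; have := child true.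
rewrite expr0 expr1 mul1r mulN1r scaleNr; lra.
Qed.

(** Left translations are Lipschitz, locally uniformly in the translation, since
    the difference quotients of the product are continuous in both factors. *)
Lemma gmul_lipschitz (a0 p0 : V) : exists2 r : R, 0 < r & exists2 L : R, 0 < L &
  forall a p q, `|a - a0| <= r -> `|p - p0| <= r -> `|q - p0| <= r ->
    `|a ** p - a ** q| <= L * `|p - q|.
Proof.
pose f (w : 'rV[R]_(n + n)) : V := lsubmx w ** rsubmx w.
have pf : polymap (@mxcoord R 1 (n + n)) f.
  apply: gmul_polymap => i j.
    apply: (@polyfun_ext R _ _ (@mxcoord R 1 (n + n)) (fun w : 'rV[R]_(n + n) => w i (lshift n j))) => [w|].
      by rewrite mxE.
    exact: (polyfun_var _ (i, lshift n j)).
  apply: (@polyfun_ext R _ _ (@mxcoord R 1 (n + n)) (fun w : 'rV[R]_(n + n) => w i (rshift n j))) => [w|].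
    by rewrite mxE.
  exact: (polyfun_var _ (i, rshift n j)).
have [D pD DE] := polymap_slope pf.
pose w0 := row_mx a0 p0.
have cD : {for (w0, w0), continuous D}.
  apply: (@polymap_continuous _ _ _ (@slope_coord R (n + n))) => //.
  exact: slope_coord_continuous.
pose B := `|D (w0, w0)| + 1; have B0 : 0 < B by rewrite ltr_wpDl.
have /nbhs_ballP[r /= r0 rP] : \forall z \near (w0, w0), `|D z| <= B.
  move/cvgrPdist_le: cD => /(_ _ ltr01); apply: filterS => z H.
  have := lerB_dist (D z) (D (w0, w0)).
  by rewrite distrC => /le_trans/(_ H); rewrite /B; lra.
exists (r / 2); first exact: divr_gt0.
exists ((n + n)%:R * B + 1); first by rewrite ltr_wpDl// mulr_ge0// ltW.
move=> a p q ha hp hq.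
have close b s : `|b - a0| <= r / 2 -> `|s - p0| <= r / 2 -> ball w0 r (row_mx b s).
  move=> hb hs; rewrite -ball_normE /ball_/= distrC /w0 opp_row_mx add_row_mx.
  apply: (@le_lt_trans _ _ (r / 2)); last by rewrite ltr_pdivrMr// ltr_pMr// ltr1n.
  apply: mx_norm_leP => [|i j]; first by rewrite divr_ge0// ltW.
  rewrite mxE; case: splitP => k _; exact: le_trans (mxcoord_le _ _ _) _.
have := DE (row_mx a q) (row_mx a p); rewrite /f !row_mxKl !row_mxKr => ->.
have -> : row_mx a p - row_mx a q = row_mx (0 : V) (p - q).
  by rewrite opp_row_mx add_row_mx subrr.
apply: le_trans (mulmx_norm _ _) _.
have npq : `|row_mx (0 : V) (p - q)| <= `|p - q|.
  apply: mx_norm_leP => // i j; rewrite mxE; case: splitP => k _.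
    by rewrite mxE normr0.
  exact: mxcoord_le.
have DB : `|D (row_mx a q, row_mx a p)| <= B by apply: rP; split; exact: close.
rewrite [leRHS]mulrDl mul1r; apply: ler_wpDr => //.
by rewrite -mulrA ler_wpM2l// mulrC ler_pM.
Qed.

Lemma leb_bigcup_fin (J : finType) (A : J -> set V) (r : R) :
  (forall j, (leb (A j) <= r%:E)%E) ->
  (leb [set x | exists j, A j x] <= (#|J|%:R * r)%:E)%E.
Proof.
move=> Ar.
have -> : [set x | exists j, A j x] = \big[setU/set0]_j A j.
  apply/seteqP; split=> [x [j Ajx]|x].
    by rewrite (bigD1 j)//=; left.
  elim/big_rec: _ => // j X _ IH [Ajx|/IH//]; by exists j.
rewrite mulr_natl -sumr_const.
elim/big_rec2: _ => [|j X s _ IH]; first by rewrite leb0.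
apply: le_trans (outer_measureU2 _ _ _) _.
by rewrite EFinD; apply: leeD; [exact: Ar|exact: IH].
Qed.

Lemma wprod_row k (h : 'I_k -> V) (c : 'I_k -> R) :
  wprod G h (\row_i c i) = gprod G [seq c i *: h i | i <- enum 'I_k].
Proof. by congr (gprod G _); apply: eq_map => i; rewrite mxE. Qed.

Hypothesis (Om_open : open Om) (u_meas : lebesgue_measurable_fun Om u).

(** The set where [u > j] in a box [B] around [x0] has arbitrarily small measure
    for large [j]. The leaves of the trees of [tree_bound] depend on [n] parameters
    in a way that is bi-Lipschitz, uniformly for roots [x] near [x0]. So the
    parameters for which some leaf lies in this set have small measure, and some
    choice of parameters has all leaves outside of it: then [u x <= j]. *)
Lemma local_upper_bound x0 : Om x0 -> exists M, \forall x \near x0, u x <= M.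
Proof.
move=> Ox0.
have [k [h [P [hH words]]]] := signed_words G.
have [rho rho0 [L L0 lip]] := gmul_lipschitz (P ** - x0) x0.
have [delta [delta0 drho dOm]] : exists delta : R, [/\ 0 < delta, delta <= rho &
    forall z, `|z - x0| <= delta -> Om z].
  have oOm := Om_open; rewrite openE in oOm.
  have /nbhs_ballP[e /= e0 eOm] := oOm _ Ox0.
  exists (Num.min rho (e / 2)); split.
  - by rewrite lt_min rho0 divr_gt0.
  - by rewrite ge_min lexx.
  - move=> z; rewrite le_min => /andP[_ ze]; apply: eOm.
    rewrite -ball_normE /ball_/= distrC (le_lt_trans ze)//.
    by rewrite ltr_pdivrMr// ltr_pMr// ltr1n.
pose B := box (x0 - const_mx delta) (x0 + const_mx delta).
have BP z : B z <-> `|z - x0| <= delta.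
  split=> [Bz|zd i].
    apply: mx_norm_leP => [|i j]; first exact: ltW.
    have := Bz j; rewrite !mxE (ord1 i) => /andP[h1 h2].
    by rewrite ler_norml; apply/andP; split; lra.
  have := le_trans (mxcoord_le _ 0 i) zd; rewrite !mxE ler_norml => /andP[h1 h2].
  by apply/andP; split; lra.
have cw : continuous (fun z : V * 'rV[R]_k => z.1 ** wprod G h z.2).
  apply: (@pair_var_continuous _ _ _ _ _ (@mxcoord R 1 n) (@mxcoord R 1 k)).
  - by move=> i; exact: mxcoord_continuous.
  - by move=> i; exact: mxcoord_continuous.
  - apply: gmul_polymap => i j; first exact: (polyfun_var _ (inl (i, j))).
    apply: (polyfun_comp _ (@wprod_polymap _ _ G _ h i j)) => a.
    exact: (polyfun_var _ (inr a)).
have w0 : wprod G h 0 = 0.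
  rewrite /wprod; elim: (enum 'I_k) => //= i r ->.
  by rewrite mxE scale0r gmulg0.
have [r1 r10 r1P] : exists2 r1 : R, 0 < r1 & forall x t, `|x - x0| < r1 ->
    `|t| < r1 -> B (x ** wprod G h t).
  have /cvgrPdist_le/(_ _ delta0)/nbhs_ballP[r /= r0 rP] := cw (x0, 0).
  exists r => // x t xr tr; apply/BP; rewrite distrC.
  have := rP (x, t); rewrite /= w0 gmulg0; apply; split=> /=.
    by rewrite -ball_normE /ball_/= distrC.
  by rewrite -ball_normE /ball_/= sub0r normrN.
have [t0 [S [r [c [r0 c0 small lower]]]]] := words (r1 / 2) (divr_gt0 r10 (ltr0n _ 2)).
have r1h : r1 / 2 < r1 by rewrite ltr_pdivrMr// ltr_pMr// ltr1n.
pose F x e (t : V) := x ** wprod G h ((t0 + t *m S) *m sign_mx R e).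
have sign_norm e (t : 'rV[R]_k) : `|t *m sign_mx R e| <= `|t|.
  apply: mx_norm_leP => // i j; rewrite (ord1 i) mulmx_sign normrM normr_sign mul1r.
  exact: mxcoord_le.
have FB x e t : `|x - x0| < r1 -> `|t| <= r -> B (F x e t).
  move=> xr tr; apply: r1P => //; apply: le_lt_trans (sign_norm _ _) _.
  by apply: le_lt_trans r1h; exact: small.
pose Q := box (- const_mx r : V) (const_mx r).
have QP t : Q t -> `|t| <= r.
  move=> Qt; apply: mx_norm_leP => [|i j]; first exact: ltW.
  by have := Qt j; rewrite !mxE (ord1 i) ler_norml.
pose v := (2 * r) ^+ n; have v0 : 0 < v by rewrite exprn_gt0// mulr_gt0.
have volQ : (v%:E <= leb Q)%E.
  have -> : v = vol (- const_mx r : V) (const_mx r).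
    rewrite /vol (eq_bigr (fun=> 2 * r)); last by move=> i _; rewrite !mxE; ring.
    by rewrite prodr_const card_ord.
  by apply: leb_box_ge => i; rewrite !mxE; have := r0; lra.
pose C := (4 / (c / L)) ^+ n; have C0 : 0 < C by rewrite exprn_gt0// !divr_gt0.
pose N := #|{ffun 'I_k -> bool}|.
(* The [N] sets of bad parameters will have measure at most [C * eps] each, and
   the cube [Q] of parameters has measure at least [v]. *)
pose eps := v / (2 * (N%:R * C + 1)).
have NC0 : 0 < N%:R * C + 1 by rewrite ltr_wpDl// mulr_ge0// ltW.
have eps0 : 0 < eps by rewrite divr_gt0// mulr_gt0.
pose E (j : nat) := B `&` [set z | j%:R < u z].
have mB : (@leb R n).-caratheodory B.
  rewrite -[B]setCK; apply: caratheodory_measurable_setC; apply: open_measurable_leb.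
  have -> : ~` B = (fun z => `|z - x0|) @^-1` [set a | delta < a].
    apply/seteqP; split=> z /=; first by move=> Bz; rewrite ltNge; apply/negP => /BP.
    by move=> zd /BP; rewrite leNgt zd.
  apply: open_comp; last exact: open_gt.
  move=> z _; apply: continuous_comp; last exact: norm_continuous.
  apply: (@polymap_continuous _ _ _ (@mxcoord R 1 n) _ _ (fun z => z - x0)).
    by move=> i; exact: mxcoord_continuous.
  by apply: polymapD; [exact: polymap_mxcoord|exact: polymap_cst].
have [||||j Ej] := @leb_continuity_above _ _ E eps eps0.
- apply: (@le_lt_trans _ _ (leb B)); first by apply: le_outer_measure => z [].
  apply: le_lt_trans (leb_box _) _; last by rewrite ltry.
  by move=> i; rewrite !mxE; move: delta0; lra.
- move=> j; have -> : E j = B `\` (Om `&` u @^-1` `]-oo, j%:R]).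
    apply/seteqP; split=> z /= [Bz uz]; split=> //.
      by move=> [_]; rewrite in_itv/= leNgt uz.
    rewrite /= ltNge; apply/negP => uj; apply: uz; split; last by rewrite in_itv.
    exact/dOm/BP.
  apply: caratheodory_measurable_setD => //; apply: lebesgue_caratheodory.
  by apply: u_meas; exact: measurable_itv.
- move=> i j ij z [Bz uz]; split=> //.
  by apply: le_lt_trans uz; rewrite ler_nat.
- apply/seteqP; split=> // z Ez.
  have [_ /=] := Ez (Num.bound `|u z|) I; rewrite ltNge => /negP; apply.
  rewrite ltW//; apply: le_lt_trans (ler_norm _) _.
  by have := archi_boundP (normr_ge0 (u z)).
exists j%:R; near=> x.
have xr1 : `|x - x0| < r1.
  rewrite distrC; near: x; have := @cvg_id _ (nbhs x0).
  by move/cvgrPdist_lt => /(_ _ r10).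
have Px : `|P ** - x - P ** - x0| <= rho.
  rewrite distrC; near: x.
  have : {for x0, continuous (fun x => P ** - x)}.
    apply: (@polymap_continuous _ _ _ (@mxcoord R 1 n)).
      by move=> i; exact: mxcoord_continuous.
    apply: gmul_polymap; first exact: polymap_cst.
    by apply: polymapN; exact: polymap_mxcoord.
  by move/cvgrPdist_le => /(_ _ rho0).
have pullE e : (leb (Q `&` F x e @^-1` E j) <= (C * eps)%:E)%E.
  apply: leb_pullback Ej; first exact: divr_gt0.
  move=> s t /QP sr /QP tr; rewrite mulrAC ler_pdivrMr// [leRHS]mulrC.
  apply: le_trans (lower e _ _ tr sr) _.
  have split_mul y : P ** y = (P ** - x) ** (x ** y).
    by rewrite -gmulA gmulKV.
  rewrite (split_mul (wprod _ _ ((t0 + s *m S) *m _))).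
  rewrite (split_mul (wprod _ _ ((t0 + t *m S) *m _))); apply: lip => //.
    by apply: le_trans drho; apply/BP/FB.
  by apply: le_trans drho; apply/BP/FB.
have [t [Qt tE]] : exists t, Q t /\ forall e, ~ E j (F x e t).
  apply: contrapT => /forallNP H.
  have QE : Q `<=` [set t | exists e, (Q `&` F x e @^-1` E j) t].
    move=> t Qt; apply: contrapT => /forallNP Ht; apply: (H t); split=> // e Ee.
    exact: (Ht e).
  have := le_trans volQ (le_trans (le_outer_measure _ _ _ QE) (leb_bigcup_fin pullE)).
  rewrite lee_fin -/N leNgt => /negP; apply.
  rewrite mulrA /eps mulrCA; apply: (@le_lt_trans _ _ (v / 2)).
    rewrite ler_wpM2l ?(ltW v0)// invfM mulrCA ler_piMr// ler_pdivrMr//.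
    by rewrite mul1r lerDl.
  by rewrite ltr_pdivrMr// ltr_pMr// ltr1n.
have tr := QP _ Qt.
apply: (@tree_bound _ h (enum 'I_k) (fun i => (t0 + t *m S) 0 i)) => //.
- exact: enum_uniq.
- move=> a al; rewrite -wprod_row; apply/dOm/BP/r1P => //.
  apply: le_lt_trans r1h; apply: mx_norm_leP => [|i' i]; first by rewrite divr_ge0// ltW.
  rewrite mxE; apply: le_trans (al i) _; apply: le_trans (mxcoord_le _ _ _) _.
  exact: small.
- move=> e; have := tE (finfun e); rewrite /F.
  have -> : (t0 + t *m S) *m sign_mx R (finfun e) =
      \row_i ((-1) ^+ e i * (t0 + t *m S) 0 i).
    by apply/rowP => i; rewrite mulmx_sign [in RHS]mxE ffunE.
  rewrite wprod_row => nE; rewrite leNgt; apply/negP => ju; apply: nE.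
  split=> //; rewrite -wprod_row.
  have := FB x (finfun e) t xr1 tr; rewrite /F.
  congr (B (_ ** wprod G h _)).
  by apply/rowP => i; rewrite mulmx_sign [in RHS]mxE ffunE.
Unshelve. all: by end_near. Qed.

End LocalUpperBound.

(** * Local Lipschitz continuity of h-convex functions *)

Section LocalLipschitz.
Context (R : realType) (n : nat) (G : stratified_group R n).
Local Notation V := 'rV[R]_n.
Local Notation H1 := (layer G 1).
Local Notation "x ** y" := (gmul G x y) (at level 40, left associativity).
Context (d : V -> V -> R) (d_hom : homogeneous_distance G d).
Local Notation nrm := (d 0).
Context (Om : set V) (u : V -> R) (u_conv : hconvex G Om u).

Lemma dist_mul_le x y h : d x (y ** h) <= d x y + nrm h.
Proof. by rewrite -(dist_mulr d_hom y h) (hdist_triangle d_hom). Qed.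

Lemma dist_seg_le x y h (t : R) : h \in H1 -> `|t| <= 1 ->
  d x (y ** (t *: h)) <= d x y + nrm h.
Proof.
move=> hH t1; apply: le_trans (dist_mul_le _ _ _) _.
by rewrite lerD2l (nrmZ d_hom)// ler_piMl// (dist_ge0 d_hom).
Qed.

(** The defect [M - u] at most doubles with each letter. *)
Lemma lower_word x0 r M b (w : seq V) y :
  (forall z, d x0 z < r -> Om z /\ u z <= M) ->
  horizontal G w -> (forall h, h \in w -> nrm h <= b) ->
  d x0 y + (size w)%:R * b < r ->
  2 ^+ size w * (u y - M) <= u (y ** gprod G w) - M.
Proof.
move=> OmM; elim: w y => [|h w IH] y /=.
  by move=> _ _ _; rewrite gmulg0 mul1r.
move=> /andP[hH wH] wb yr.
have hb : nrm h <= b by apply: wb; rewrite mem_head.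
have b0 : 0 <= b by apply: le_trans hb; exact: (dist_ge0 d_hom).
have sb0 : 0 <= (size w)%:R * b by rewrite mulr_ge0.
move: yr; rewrite -natr1 mulrDl mul1r => yr.
have inr t : `|t| <= 1 -> d x0 (y ** (t *: h)) < r.
  by move=> t1; apply: le_lt_trans (dist_seg_le _ _ hH t1) _; lra.
have mid : 2 * u y <= u (y ** h) + u (y ** - h).
  by apply: (hconvex_mid u_conv) => // t t1; exact: (OmM _ (inr _ t1)).1.
have /OmM[_ hM] : d x0 (y ** - h) < r.
  by rewrite -scaleN1r; apply: inr; rewrite normrN1.
rewrite gmulA; apply: le_trans (IH (y ** h) wH _ _).
- rewrite exprSr -mulrA ler_wpM2l ?exprn_ge0//; lra.
- by move=> h' h'w; apply: wb; rewrite in_cons h'w orbT.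
- by have := dist_mul_le x0 y h; lra.
Qed.

(** The segment from [y] to [y h] is extended to length [r / 2], where [u] is still
    bounded. *)
Lemma horizontal_lipschitz x0 r A y h :
  (forall z, d x0 z < r -> Om z /\ `|u z| <= A) ->
  h \in H1 -> 0 < r -> nrm h <= r / 2 -> d x0 y < r / 2 ->
  u (y ** h) - u y <= 4 * A / r * nrm h.
Proof.
move=> OmA hH r0 hr yr.
have [h0|h0] := eqVneq (nrm h) 0.
  by rewrite h0 mulr0 (nrm0_eq0 d_hom h0) gmulg0 subrr.
have hp : 0 < nrm h by rewrite lt_neqAle eq_sym h0 (dist_ge0 d_hom).
pose l := nrm h / (r / 2).
have l0 : 0 < l by rewrite !divr_gt0.
have l1 : l <= 1 by rewrite ler_pdivrMr ?divr_gt0// mul1r.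
pose h' := l^-1 *: h.
have h'H : h' \in H1 by rewrite rpredZ.
have nh' : nrm h' = r / 2.
  rewrite (nrmZ d_hom)// gtr0_norm ?invr_gt0// /l.
  by field; rewrite h0 gt_eqF.
have inr t : `|t| <= 1 -> d x0 (y ** (t *: h')) < r.
  move=> t1; apply: le_lt_trans (dist_seg_le _ _ h'H t1) _.
  by rewrite nh'; lra.
have l01 : 0 <= l <= 1 by rewrite (ltW l0).
have := @hconvex_line _ _ _ _ _ u_conv y h' l h'H _ l01.
rewrite scalerA mulfV ?gt_eqF// scale1r => /(_ _)/le_trans H.
have [_ uy] : Om y /\ `|u y| <= A by apply: OmA; lra.
have /OmA[_ uh'] : d x0 (y ** h') < r by rewrite -(scale1r h') inr ?normr1.
have : u (y ** h) <= l * u (y ** h') + (1 - l) * u y.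
  apply: H => // t /andP[t0 t1]; apply: (OmA _ _).1; apply: inr.
  by rewrite ger0_norm.
move: uy uh'; rewrite !ler_norml => /andP[uy1 uy2] /andP[uh1 uh2] H2.
have -> : 4 * A / r * nrm h = l * (2 * A).
  by rewrite /l; field; rewrite gt_eqF.
have : l * (u (y ** h') - u y) <= l * (2 * A) by rewrite ler_wpM2l ?(ltW l0)//; lra.
lra.
Qed.

Lemma word_lipschitz x0 r A b (w : seq V) y :
  (forall z, d x0 z < r -> Om z /\ `|u z| <= A) -> 0 < r -> 0 <= A ->
  horizontal G w -> (forall h, h \in w -> nrm h <= b) -> b <= r / 2 ->
  d x0 y + (size w)%:R * b < r / 2 ->
  `|u (y ** gprod G w) - u y| <= (size w)%:R * (4 * A / r * b).
Proof.
move=> OmA r0 A0; elim: w y => [|h w IH] y /=.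
  by move=> _ _ _ _; rewrite gmulg0 subrr normr0 mul0r.
move=> /andP[hH wH] wb br yr.
have hb : nrm h <= b by apply: wb; rewrite mem_head.
have b0 : 0 <= b by apply: le_trans hb; exact: (dist_ge0 d_hom).
have sb0 : 0 <= (size w)%:R * b by rewrite mulr_ge0.
have {}yr : d x0 y + ((size w)%:R * b + b) < r / 2.
  by move: yr; rewrite -natr1 mulrDl mul1r.
have yh := dist_mul_le x0 y h.
have step1 : `|u (y ** h) - u y| <= 4 * A / r * b.
  have Lb : 4 * A / r * nrm h <= 4 * A / r * b.
    by rewrite ler_wpM2l// divr_ge0 ?mulr_ge0// ltW.
  rewrite ler_norml; apply/andP; split; last first.
    by apply: le_trans Lb; apply: (horizontal_lipschitz OmA) => //; lra.
  have := @horizontal_lipschitz x0 r A (y ** h) (- h) OmA.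
  rewrite -gmulA gmulV gmulg0 (nrmN d_hom) rpredN => H.
  have : u y - u (y ** h) <= 4 * A / r * nrm h by apply: H => //; lra.
  lra.
have step2 : `|u (y ** h ** gprod G w) - u (y ** h)| <= (size w)%:R * (4 * A / r * b).
  apply: IH => //; last by lra.
  by move=> h' h'w; apply: wb; rewrite in_cons h'w orbT.
rewrite gmulA -(subrKA (u (y ** h))) -natr1 [leRHS]mulrDl mul1r.
by apply: le_trans (ler_normD _ _) _; exact: lerD step2 step1.
Qed.

Hypothesis (Om_open : open Om) (u_meas : lebesgue_measurable_fun Om u).

(** A local upper bound for an h-convex function entails a lower bound, because
    [2 u(y) <= u(y h) + u(y h^-1)] can be iterated along words; boundedness
    entails Lipschitz bounds along horizontal lines, and these add up along
    words of bounded length. *)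
Lemma local_lipschitz x0 : Om x0 -> exists r L : R, [/\ 0 < r, 0 <= L &
  forall y z, d x0 y < r -> d x0 z < r -> `|u y - u z| <= L * d y z].
Proof.
move=> Ox0; have [M nM] := local_upper_bound u_conv Om_open u_meas Ox0.
have [l [K [C [lH C0 gen]]]] := generation d_hom.
have [r0 r00 r0P] : exists2 r0 : R, 0 < r0 &
    forall z, d x0 z < r0 -> Om z /\ u z <= M.
  apply: (open_dball d_hom (O := [set z | Om z /\ u z <= M])).
  by apply: filterI nM; exact: open_nbhs_nbhs.
have genw z : exists w, [/\ size w = K, horizontal G w,
    forall h, h \in w -> nrm h <= C * nrm z & gprod G w = z].
  have [w [wK wl wz]] := gen z; exists [seq th.1 *: th.2 | th <- w].
  split=> //; first by rewrite size_map.
    apply/allP => _ /mapP[th thw ->]; have [_ thl] := wl _ thw.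
    by rewrite rpredZ//; move/allP: lH; apply.
  by move=> _ /mapP[th thw ->]; have [] := wl _ thw.
have KC0 : 0 <= K%:R * C by rewrite mulr_ge0.
pose r1 := r0 / (K%:R * C + 1).
have r10 : 0 < r1 by rewrite divr_gt0// ltr_wpDl.
have r10' : r1 <= r0 by rewrite ler_pdivrMr ?ltr_wpDl// ler_peMr ?(ltW r00)// lerDr.
pose A := `|M| + 2 ^+ K * (M - u x0).
have Mu : u x0 <= M by apply: (r0P _ _).2; rewrite (distxx d_hom).
have A0 : 0 <= A by rewrite addr_ge0// mulr_ge0 ?exprn_ge0// subr_ge0.
have r1P z : d x0 z < r1 -> Om z /\ `|u z| <= A.
  move=> zr; have [Oz uM] := r0P _ (lt_le_trans zr r10'); split=> //.
  have [w [wK wH wb wz]] := genw (- x0 ** z).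
  have := @lower_word x0 r0 M (C * d x0 z) w x0 r0P wH.
  rewrite {1}(dist_nrm d_hom x0 z) => /(_ wb).
  rewrite (distxx d_hom)// add0r wK wz gmulVK => H.
  have {}H : 2 ^+ K * (u x0 - M) <= u z - M.
    apply: H; move: zr; rewrite ltr_pdivlMr ?ltr_wpDl//; apply: le_lt_trans.
    have := dist_ge0 d_hom x0 z; rewrite mulrA => dz; nra.
  have P0 : 0 <= 2 ^+ K * (M - u x0) by rewrite mulr_ge0 ?exprn_ge0// subr_ge0.
  have := ler_norm M; have := ler_norm (- M); rewrite normrN => N1 N2.
  rewrite ler_norml /A; apply/andP; split; last by lra.
  have -> : 2 ^+ K * (M - u x0) = - (2 ^+ K * (u x0 - M)) by ring.
  lra.
pose r2 := r1 / (4 * (1 + K%:R * C + C)).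
have den0 : 0 < 4 * (1 + K%:R * C + C) by lra.
have r20 : 0 < r2 by rewrite divr_gt0.
have r2E : r2 * (4 * (1 + K%:R * C + C)) = r1 by rewrite divfK// gt_eqF.
exists r2, (K%:R * (4 * A / r1 * C)); split=> //.
  by rewrite !mulr_ge0// invr_ge0 ltW.
move=> y z yr zr; rewrite distrC.
have [w [wK wH wb wz]] := genw (- y ** z).
have yz : d y z < 2 * r2.
  apply: le_lt_trans (hdist_triangle d_hom y x0 z) _.
  by rewrite [d y x0](hdist_sym d_hom); lra.
have yz0 := dist_ge0 d_hom y z.
rewrite -{1}(gmulVK G y z) -wz.
have -> : K%:R * (4 * A / r1 * C) * d y z = (size w)%:R * (4 * A / r1 * (C * d y z)).
  by rewrite wK; ring.
apply: (word_lipschitz r1P) => //.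
- by rewrite (dist_nrm d_hom y z).
- nra.
- rewrite wK; nra.
Qed.

End LocalLipschitz.

(** * Blowups of h-convex functions *)

Section Blowup.
Context (R : realType) (n : nat) (G : stratified_group R n).
Local Notation V := 'rV[R]_n.
Local Notation H1 := (layer G 1).
Local Notation "x ** y" := (gmul G x y) (at level 40, left associativity).
Context (d : V -> V -> R) (d_hom : homogeneous_distance G d).
Local Notation nrm := (d 0).

Definition ev0 (P : R -> Prop) : Prop :=
  exists2 e : R, 0 < e & forall r, 0 < r -> r < e -> P r.

Lemma ev0I P Q : ev0 P -> ev0 Q -> ev0 (fun r => P r /\ Q r).
Proof.
move=> [a a0 aP] [b b0 bQ]; exists (Num.min a b); first by rewrite lt_min a0.
by move=> r r0; rewrite lt_min => /andP[ra rb]; split; [exact: aP|exact: bQ].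
Qed.

Lemma ev0W (P Q : R -> Prop) : (forall r, 0 < r -> P r -> Q r) -> ev0 P -> ev0 Q.
Proof. by move=> PQ [a a0 aP]; exists a => // r r0 ra; apply: PQ => //; exact: aP. Qed.

Lemma ev0_ex P : ev0 P -> exists2 r, 0 < r & P r.
Proof.
move=> [a a0 aP]; exists (a / 2); first exact: divr_gt0.
by apply: aP; rewrite ?divr_gt0// ltr_pdivrMr// ltr_pMr// ltr1n.
Qed.

Lemma ev0_lt (a : R) : 0 < a -> ev0 (fun r => r < a).
Proof. by move=> a0; exists a. Qed.

Lemma ev0_scale s P : 0 < s -> ev0 P -> ev0 (fun r => P (r * s)).
Proof.
move=> s0 [a a0 aP]; exists (a / s); first exact: divr_gt0.
by move=> r r0; rewrite ltr_pdivlMr// => ra; apply: aP => //; exact: mulr_gt0.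
Qed.

Definition quot (u : V -> R) (x : V) (r : R) (z : V) : R :=
  (u (x ** dilation G r z) - u x) / r.

(** The upper limit of the difference quotients at [0]: upper limits, unlike
    lower ones, preserve convexity, and unlike limits along subsequences they
    are homogeneous. *)
Definition blowup (u : V -> R) (x z : V) : R :=
  inf [set c | ev0 (fun r => quot u x r z <= c)].

(** What a blowup at [x] requires of [u]. *)
Definition regular_at (u : V -> R) (x : V) (rho L : R) : Prop :=
  [/\ 0 < rho, 0 <= L,
      forall y z, d x y < rho -> d x z < rho -> `|u y - u z| <= L * d y z &
      forall y h l, h \in H1 ->
        (forall t, 0 <= t <= 1 -> d x (y ** (t *: h)) < rho) -> 0 <= l <= 1 ->
        u (y ** (l *: h)) <= l * u (y ** h) + (1 - l) * u y].

Record sublinear (U : V -> R) : Prop := Sublinear {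
  sublinear_hom : forall s z, 0 < s -> U (dilation G s z) = s * U z;
  sublinear_conv : forall z h l, h \in H1 -> 0 <= l <= 1 ->
    U (z ** (l *: h)) <= l * U (z ** h) + (1 - l) * U z;
  sublinear_lip : exists2 L, 0 <= L & forall z w, `|U z - U w| <= L * d z w
}.

Lemma quot0 u x r : quot u x r 0 = 0.
Proof. by rewrite /quot dilationr0 gmulg0 subrr mul0r. Qed.

Section AtPoint.
Context (u : V -> R) (x : V) (rho L : R) (reg : regular_at u x rho L).

Lemma quot_in z : ev0 (fun r => d x (x ** dilation G r z) < rho).
Proof.
have [rho0 _ _ _] := reg; exists (rho / (nrm z + 1)).
  by rewrite divr_gt0// ltr_wpDl// (dist_ge0 d_hom).
move=> r r0; rewrite ltr_pdivlMr ?ltr_wpDl ?(dist_ge0 d_hom)// => zr.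
rewrite (dist_mulr d_hom) (nrm_dilation d_hom) ?(ltW r0)//.
by apply: le_lt_trans zr; rewrite mulrDr mulr1 lerDl ltW.
Qed.

Lemma quot_lip_at r z w : 0 < r -> r * nrm z < rho -> r * nrm w < rho ->
  `|quot u x r z - quot u x r w| <= L * d z w.
Proof.
move=> r0 zr wr; have [rho0 L0 lip _] := reg.
have din v : r * nrm v < rho -> d x (x ** dilation G r v) < rho.
  by rewrite (dist_mulr d_hom) (nrm_dilation d_hom)// ltW.
have := lip _ _ (din _ zr) (din _ wr).
rewrite (hdist_left_invariant d_hom) (hdist_dilation d_hom)// => H.
rewrite /quot -mulrBl opprB addrA subrK normrM normfV (gtr0_norm r0).
by rewrite ler_pdivrMr// -mulrA [d z w * r]mulrC.
Qed.

Lemma quot_lip z w : ev0 (fun r => `|quot u x r z - quot u x r w| <= L * d z w).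
Proof.
apply: ev0W (ev0I (quot_in z) (quot_in w)) => r r0.
rewrite !(dist_mulr d_hom) !(nrm_dilation d_hom) ?(ltW r0)// => -[zr wr].
exact: quot_lip_at.
Qed.

Lemma blowup_has_inf z :
  has_inf [set c | ev0 (fun r => quot u x r z <= c)].
Proof.
split.
  exists (L * d z 0); apply: ev0W (quot_lip z 0) => r r0.
  by rewrite quot0 subr0 ler_norml => /andP[].
exists (- (L * d z 0)) => c /= cz.
have [r r0 []] := ev0_ex (ev0I cz (quot_lip z 0)).
by rewrite quot0 subr0 ler_norml => qc /andP[/le_trans H _]; exact: H.
Qed.

Lemma blowup_le z c : ev0 (fun r => quot u x r z <= c) -> blowup u x z <= c.
Proof. by move=> H; apply: ge_inf => //; have [] := blowup_has_inf z. Qed.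

Lemma blowup_lt z c : blowup u x z < c -> ev0 (fun r => quot u x r z < c).
Proof.
move=> /(inf_lt (blowup_has_inf z).1)[b bz bc].
by apply: ev0W bz => r _ /le_lt_trans; apply.
Qed.

Lemma blowup_eq z c : ev0 (fun r => quot u x r z = c) -> blowup u x z = c.
Proof.
move=> H; apply/eqP; rewrite eq_le; apply/andP; split.
  by apply: blowup_le; apply: ev0W H => r _ ->.
rewrite leNgt; apply/negP => /blowup_lt Hc.
by have [r _ [-> ]] := ev0_ex (ev0I H Hc); rewrite ltxx.
Qed.

Lemma quot_conv z h l : h \in H1 -> 0 <= l <= 1 -> ev0 (fun r =>
  quot u x r (z ** (l *: h)) <= l * quot u x r (z ** h) + (1 - l) * quot u x r z).
Proof.
move=> hH l01; have [rho0 L0 _ conv] := reg.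
exists (rho / (nrm z + nrm h + 1)).
  by rewrite divr_gt0// ltr_wpDl// addr_ge0// (dist_ge0 d_hom).
move=> r r0; rewrite ltr_pdivlMr ?ltr_wpDl ?addr_ge0 ?(dist_ge0 d_hom)// => zr.
have rhH : r *: h \in H1 by rewrite rpredZ.
have E t : x ** dilation G r (z ** (t *: h)) = x ** dilation G r z ** (t *: (r *: h)).
  by rewrite dilationM dilationZ (dilation_h _ hH) gmulA.
have := conv (x ** dilation G r z) (r *: h) l rhH _ l01.
have E1 : x ** dilation G r (z ** h) = x ** dilation G r z ** (r *: h).
  by have := E 1; rewrite !scale1r.
rewrite -(E l) -E1 => H.
rewrite /quot !mulrA -mulrDl ler_pM2r ?invr_gt0//.
suff : u (x ** dilation G r (z ** (l *: h))) <=
  l * u (x ** dilation G r (z ** h)) + (1 - l) * u (x ** dilation G r z) by lra.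
apply: H => t /andP[t0 t1]; rewrite -E (dist_mulr d_hom) (nrm_dilation d_hom) ?(ltW r0)//.
apply: le_lt_trans zr; rewrite ler_wpM2l ?(ltW r0)//.
apply: le_trans (nrmM d_hom _ _) _.
rewrite (nrmZ d_hom)// ger0_norm// -addrA lerD2l.
by apply: ler_wpDr => //; rewrite ler_piMl// (dist_ge0 d_hom).
Qed.

Lemma blowup_sublinear : sublinear (blowup u x).
Proof.
have [_ L0 _ _] := reg.
have homle s z : 0 < s -> blowup u x (dilation G s z) <= s * blowup u x z.
  move=> s0; rewrite -ler_pdivrMl//; apply/ler_addgt0Pr => e e0.
  rewrite ler_pdivrMl//; apply: blowup_le.
  have /blowup_lt : blowup u x z < blowup u x z + e by rewrite ltrDl.
  move=> /(ev0_scale s0); apply: ev0W => r r0.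
  have -> : quot u x r (dilation G s z) = s * quot u x (r * s) z.
    by rewrite /quot dilationA; field; rewrite !gt_eqF.
  by move=> /ltW; rewrite ler_pM2l.
split.
- move=> s z s0; apply/eqP; rewrite eq_le homle//=.
  have := homle s^-1 (dilation G s z); rewrite invr_gt0 => /(_ s0).
  by rewrite dilationK ?gt_eqF// ler_pdivlMl.
- move=> z h l hH l01; have /andP[l0 l1] := l01.
  apply/ler_addgt0Pr => e e0; apply: blowup_le.
  have /blowup_lt H1' : blowup u x (z ** h) < blowup u x (z ** h) + e by rewrite ltrDl.
  have /blowup_lt H2' : blowup u x z < blowup u x z + e by rewrite ltrDl.
  apply: ev0W (ev0I (quot_conv z hH l01) (ev0I H1' H2')) => r _ [Hc [h1 h2]].
  have : l * quot u x r (z ** h) <= l * (blowup u x (z ** h) + e).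
    by rewrite ler_wpM2l// ltW.
  have : (1 - l) * quot u x r z <= (1 - l) * (blowup u x z + e).
    by rewrite ler_wpM2l ?subr_ge0// ltW.
  lra.
- exists L => //.
  have half z w : blowup u x z <= blowup u x w + L * d z w.
    apply/ler_addgt0Pr => e e0; apply: blowup_le.
    have /blowup_lt H2' : blowup u x w < blowup u x w + e by rewrite ltrDl.
    apply: ev0W (ev0I (quot_lip z w) H2') => r _ [].
    by rewrite ler_norml => /andP[_ h1] h2; lra.
  move=> z w; rewrite ler_norml; have := half z w; have := half w z.
  by rewrite [d w z](hdist_sym d_hom) => h1 h2; apply/andP; split; lra.
Qed.

End AtPoint.

Section SublinearTheory.
Context (U : V -> R) (subU : sublinear U).

Lemma sublinear0 : U 0 = 0.
Proof.
have := sublinear_hom subU 0 (ltr0n R 2); rewrite dilationr0; lra.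
Qed.

Lemma sublinear_regular x : exists rho L, regular_at U x rho L.
Proof.
have [L L0 lip] := sublinear_lip subU; exists 1, L; split=> // y h l hH _.
exact: sublinear_conv.
Qed.

Lemma sublinear_scale t h : h \in H1 -> 0 <= t -> U (t *: h) = t * U h.
Proof.
move=> hH; rewrite le_eqVlt => /orP[/eqP <-|t0].
  by rewrite scale0r sublinear0 mul0r.
by rewrite -(dilation_h t hH) (sublinear_hom subU).
Qed.

(** Convexity on the half-line through [z] and [z h] bounds the slope at [z] by
    the slope at infinity, which is [U h] by homogeneity. *)
Lemma sublinear_add z h : h \in H1 -> U (z ** h) <= U z + U h.
Proof.
move=> hH; have [L L0 lip] := sublinear_lip subU.
pose g (e : R) := U h + L * d h (dilation G e z ** h) + (1 - e) * U z.
have gk k : U (z ** h) <= g k.+1%:R^-1.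
  set e := k.+1%:R^-1; have e0 : 0 < e by rewrite invr_gt0.
  have e1 : e <= 1 by rewrite invf_le1// ler1n.
  have eH : e^-1 *: h \in H1 by rewrite rpredZ.
  have := sublinear_conv subU z eH (l := e).
  rewrite (ltW e0) e1 scalerA mulfV ?gt_eqF// scale1r => /(_ isT).
  have -> : z ** (e^-1 *: h) = dilation G e^-1 (dilation G e z ** h).
    by rewrite dilationM dilationK ?gt_eqF// (dilation_h _ hH).
  rewrite (sublinear_hom subU) ?invr_gt0// mulrA mulfV ?gt_eqF// mul1r.
  move=> /le_trans; apply; rewrite /g lerD2r.
  have := lip (dilation G e z ** h) h.
  by rewrite (hdist_sym d_hom) ler_norml => /andP[_]; lra.
have -> : U z + U h = g 0.
  by rewrite /g dilation0r gmul0g (distxx d_hom) mulr0 addr0 subr0 mul1r addrC.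
apply: (@closed_cvg _ _ \oo _ (fun k => g (harmonic k)) [set v | U (z ** h) <= v]) => //.
- by apply: nearW.
- apply: (cvg_comp _ _ (@cvg_harmonic R)).
  apply: cvgD; last first.
    apply: cvgM; last exact: cvg_cst.
    by apply: cvgB; [exact: cvg_cst|exact: cvg_id].
  apply: cvgD; first exact: cvg_cst.
  apply: cvgM; first exact: cvg_cst.
  apply: (@continuous_comp _ _ _ (fun e => dilation G e z ** h) (d h)); last first.
    exact: (dist_continuous_r d_hom).
  apply: (@polymap_continuous _ _ _ (fun _ : unit => @id R)).
    by move=> _ y; exact: cvg_id.
  apply: gmul_polymap; last exact: polymap_cst.
  by apply: dilation_polymap; [exact: (polyfun_var _ tt)|exact: polymap_cst].
Qed.

Lemma sublinear_opp h : h \in H1 -> 0 <= U h + U (- h).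
Proof.
move=> hH; have := @sublinear_add h (- h).
by rewrite rpredN gmulV sublinear0; apply.
Qed.

Lemma sublinear_add_eq z h : h \in H1 -> U (- h) = - U h ->
  U (z ** h) = U z + U h.
Proof.
move=> hH Uh; apply/eqP; rewrite eq_le sublinear_add//=.
have := @sublinear_add (z ** h) (- h).
rewrite rpredN -gmulA gmulV gmulg0 Uh => /(_ hH); lra.
Qed.

End SublinearTheory.

(** Blowing up [U] once more, at [h0], makes it additive in the direction [h0],
    without destroying additivity in other directions. *)
Lemma sublinear_blowup U h0 : sublinear U -> h0 \in H1 ->
  [/\ sublinear (blowup U h0), blowup U h0 h0 = U h0,
      blowup U h0 (- h0) = - U h0,
      forall h, h \in H1 -> blowup U h0 h <= U h &
      forall h, h \in H1 -> U (- h) = - U h ->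
        blowup U h0 h = U h /\ blowup U h0 (- h) = - U h].
Proof.
move=> subU h0H; have [rho [L reg]] := sublinear_regular subU h0.
have subU2 := blowup_sublinear reg.
have ub h : h \in H1 -> blowup U h0 h <= U h.
  move=> hH; apply: (blowup_le reg); exists 1 => // r r0 _.
  rewrite /quot (dilation_h _ hH) ler_pdivrMr//.
  have rhH : r *: h \in H1 by rewrite rpredZ.
  have := sublinear_add subU h0 rhH.
  by rewrite (sublinear_scale subU)// ?(ltW r0)// [U h * r]mulrC; lra.
have line t : -1 <= t -> t <= 1 -> blowup U h0 (t *: h0) = t * U h0.
  move=> t1 t2; apply: (blowup_eq reg); exists 1 => // r r0 r1.
  have rt : 0 <= 1 + t * r.
    have : 0 <= r * (t + 1) by rewrite mulr_ge0 ?(ltW r0)//; lra.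
    lra.
  rewrite /quot dilationZ (dilation_h _ h0H) scalerA -{1}(scale1r h0) gmul_line.
  rewrite (sublinear_scale subU)//.
  by field; rewrite gt_eqF.
split=> //.
- by rewrite -{2}(scale1r h0) line ?mul1r//; lra.
- by rewrite -scaleN1r line ?mulN1r//; lra.
- move=> h hH Uh; have := sublinear_opp subU2 hH; have := ub _ hH.
  have := ub (- h); rewrite rpredN Uh => /(_ hH) h1 h2 h3; split; lra.
Qed.

Lemma sublinear_linearize U (l : seq V) : sublinear U -> horizontal G l ->
  exists W, [/\ sublinear W, forall h, h \in H1 -> W h <= U h,
    forall h, h \in H1 -> U (- h) = - U h -> W h = U h /\ W (- h) = - U h &
    forall h, h \in l -> W (- h) = - W h].
Proof.
move=> subU; elim: l => [|h0 l IH] /=; first by exists U; split.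
move=> /andP[h0H lH]; have [W [subW WU Wlin Wl]] := IH lH.
have [sub2 e1 e2 ub lin] := sublinear_blowup subW h0H.
exists (blowup W h0); split=> //.
- by move=> h hH; apply: le_trans (ub _ hH) (WU _ hH).
- move=> h hH Uh; have [h1 h2] := Wlin h hH Uh.
  by have [|-> ->] := lin h hH; rewrite h1.
- move=> h; rewrite in_cons => /orP[/eqP ->|hl]; first by rewrite e1 e2.
  have hH : h \in H1 by move/allP: lH; apply.
  by have [-> ->] := lin h hH (Wl _ hl).
Qed.

(** A sublinear function that is odd on a generating set of horizontal vectors
    is a homomorphism to the reals. Homomorphisms factor through the first
    layer, because [z] and its first component are linked by dilating the
    powers of [z]. *)
Lemma sublinear_linear U (l : seq V) : sublinear U -> horizontal G l ->
  (forall z, exists w : seq (R * V), (forall th, th \in w -> th.2 \in l) /\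
     gprod G [seq th.1 *: th.2 | th <- w] = z) ->
  (forall h, h \in l -> U (- h) = - U h) ->
  (forall z, U z = U (proj1 G z)) /\ linear_for *%R U.
Proof.
move=> subU lH gen Ul.
have Ut t h : h \in l -> U (t *: h) = t * U h.
  move=> hl; have hH : h \in H1 by move/allP: lH; apply.
  have [t0|t0] := leP 0 t; first exact: sublinear_scale.
  have -> : t *: h = (- t) *: (- h) by rewrite scalerN scaleNr opprK.
  rewrite (sublinear_scale subU) ?rpredN// ?oppr_ge0 ?ltW// Ul//.
  by rewrite mulrNN.
have add z w : U (z ** w) = U z + U w.
  have [ws [wl <-]] := gen w.
  have main z' : U (z' ** gprod G [seq th.1 *: th.2 | th <- ws]) =
      U z' + \sum_(th <- ws) U (th.1 *: th.2).
    elim: ws wl z' => [|th ws IH] wl z' /=.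
      by rewrite gmulg0 big_nil addr0.
    have thl : th.2 \in l by apply: wl; rewrite mem_head.
    rewrite big_cons gmulA IH; last first.
      by move=> th' th'w; apply: wl; rewrite in_cons th'w orbT.
    rewrite (sublinear_add_eq subU) ?addrA//.
      by rewrite rpredZ//; move/allP: lH; apply.
    by rewrite -scaleNr !Ut// mulNr.
  by rewrite main -[in RHS](gmul0g G (gprod _ _)) main (sublinear0 subU) add0r.
have opp z : U (- z) = - U z.
  by apply/eqP; rewrite -addr_eq0 addrC -add gmulV (sublinear0 subU).
have natm m z : U (m%:R *: z) = m%:R * U z.
  elim: m => [|m IH]; first by rewrite scale0r mul0r (sublinear0 subU).
  by rewrite (scaleS_gmul G) add IH -natr1 mulrDl mul1r.
have [L L0 lip] := sublinear_lip subU.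
have cU : continuous U.
  move=> z; apply/(@cvgrPdist_le _ R^o V (nbhs z)) => e e0.
  have e1 : 0 < e / (L + 1) by rewrite divr_gt0// ltr_wpDl.
  have := dball_nbhs d_hom z e1; apply: filterS => w; rewrite ltr_pdivlMr ?ltr_wpDl// => zw.
  apply: le_trans (lip _ _) _; apply: le_trans (ltW zw).
  by rewrite mulrDr mulr1 mulrC lerDl (dist_ge0 d_hom).
have Up z : U z = U (proj1 G z).
  apply/esym; pose Q (r : R) := scaled_dilation G r z.
  apply: (@polymap_closed0 R n Q [set w | U w = U z]).
  - by apply: scaled_dilation_polymap; [exact: (polyfun_var _ tt)|exact: polymap_cst].
  - have -> : [set w | U w = U z] = U @^-1` [set U z] by [].
    by apply: closed_comp; [move=> ? _; exact: cU|exact: closed_eq].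
  - move=> k; rewrite /Q /=; set r := k.+1%:R^-1.
    have r0 : 0 < r by rewrite invr_gt0.
    have -> : scaled_dilation G r z = dilation G r (k.+1%:R *: z).
      by rewrite dilationZ dilation_scaled scalerA mulfV ?pnatr_eq0// scale1r.
    by rewrite (sublinear_hom subU)// natm mulrA mulVf ?pnatr_eq0// mul1r.
split=> // a z w.
have ZH h : h \in H1 -> U (a *: h) = a * U h.
  move=> hH; have [a0|a0] := leP 0 a; first exact: sublinear_scale.
  rewrite -[a]opprK scaleNr opp (sublinear_scale subU)// ?mulNr//.
  by rewrite oppr_ge0 ltW.
rewrite Up proj1D proj1Z [U z]Up [U w]Up -ZH ?proj1_in// -add [RHS]Up proj1M.
by rewrite proj1Z !(@proj1_h _ _ _ (proj1 G _)) ?proj1_in.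
Qed.

End Blowup.

(** * The scalar product and h-differentials *)

Section InnerProduct.
Context (R : realType) (n : nat) (G : stratified_group R n).
Local Notation V := 'rV[R]_n.
Local Notation H1 := (layer G 1).
Context (ip : {dot V for idfun}).

Lemma ipC x y : ip x y = ip y x.
Proof. by rewrite hermC/= expr0 mul1r. Qed.

Lemma ip_eq0 x : ip x x = 0 -> x = 0.
Proof.
move=> xx; apply/eqP; apply: contraT => /(neq0_dnorm_gt0 (s := ip)).
by rewrite xx ltxx.
Qed.

Lemma riesz (U : {vspace V}) (L : V -> R) : linear_for *%R L ->
  exists2 p, p \in U & forall v, v \in U -> ip p v = L v.
Proof.
move=> linL; pose b := vbasis U.
have LD x y : L (x + y) = L x + L y by rewrite -[x]scale1r linL mul1r scale1r.
have L0 : L 0 = 0 by have := LD 0 0; rewrite addr0; lra.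
have LZ a x : L (a *: x) = a * L x by rewrite -[a *: x]addr0 linL L0 addr0.
pose A := \matrix_(i, j) ip b`_i b`_j : 'M[R]_(\dim U).
have sumb (c : 'rV[R]_(\dim U)) (j : 'I_(\dim U)) : ip (\sum_i c 0 i *: b`_i) b`_j = (c *m A) 0 j.
  rewrite linear_sumlz/= mxE; apply: eq_bigr => i _.
  by rewrite linearZl_LR/= mxE.
have Aunit : A \in unitmx.
  rewrite -row_free_unit; apply: inj_row_free => c cA.
  pose w := \sum_i c 0 i *: b`_i.
  have w0 : w = 0.
    apply: ip_eq0; rewrite {2}/w linear_sumr/= big1// => j _.
    by rewrite linearZr_LR/= sumb cA mxE mulr0.
  have /freeP bfree : free b by exact: basis_free (vbasisP U).
  by apply/rowP => i; rewrite mxE; exact: (bfree (fun i => c 0 i) w0).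
pose c := (\row_j L b`_j) *m invmx A.
exists (\sum_i c 0 i *: b`_i).
  by apply: rpred_sum => i _; rewrite rpredZ// vbasis_mem// mem_nth// size_tuple.
move=> v /coord_vbasis ->; rewrite linear_sumr/=.
have Lsum : L (\sum_i coord b i v *: b`_i) = \sum_i coord b i v * L b`_i.
  by elim/big_rec2: _ => [|i x y _ <-]; rewrite ?L0// linL.
rewrite Lsum; apply: eq_bigr => i _.
by rewrite linearZr_LR/= sumb /c mulmxKV// mxE.
Qed.

Hypothesis ip_orth : layers_orthogonal G ip.

Lemma proj1_orth z : z - proj1 G z \in orthov ip H1.
Proof.
apply/mem_orthovP => h hH.
elim/(layer_ind (G := G)): z => [z w IHz IHw|j z j0 zj].
  by rewrite proj1D opprD addrACA linearDl/= IHz IHw addr0.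
have [j1|j1] := eqVneq j 1%N.
  by rewrite j1 in zj; rewrite (proj1_h zj) subrr linear0l.
rewrite (proj1_layer _ zj); last by lia.
by rewrite subr0; exact: ip_orth zj hH.
Qed.

Lemma ip_proj1 p z : p \in H1 -> ip p z = ip p (proj1 G z).
Proof.
move=> pH; apply/eqP; rewrite -subr_eq0 -linearBr/= ipC.
by apply/eqP; move/mem_orthovP: (proj1_orth z); apply.
Qed.

Lemma pi1_proj1 z : pi1 G ip z = proj1 G z.
Proof.
have cap0 : (H1 :&: orthov ip H1 = 0)%VS.
  apply/eqP; rewrite -subv0; apply/subvP => v; rewrite memv_cap memv0.
  by move=> /andP[vH /mem_orthovP/(_ v vH)/ip_eq0 ->].
have zE : z = proj1 G z + (z - proj1 G z) by rewrite addrC subrK.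
rewrite /pi1 {1}zE linearD/= (daddv_pi_id cap0) ?proj1_in//.
suff -> : daddv_pi H1 (orthov ip H1) (z - proj1 G z) = 0 by rewrite addr0.
have := daddv_pi_add cap0 (w := z - proj1 G z).
have capC : (orthov ip H1 :&: H1 = 0)%VS by rewrite capvC.
have -> : daddv_pi (orthov ip H1) H1 (z - proj1 G z) = z - proj1 G z.
  by apply: daddv_pi_id capC _; exact: proj1_orth.
move=> H.
apply/eqP; rewrite -(inj_eq (addIr (z - proj1 G z))) add0r; apply/eqP/H.
by apply: (subvP (addvSr _ _)); exact: proj1_orth.
Qed.

End InnerProduct.

Section Differentiability.
Context (R : realType) (n : nat) (G : stratified_group R n).
Local Notation V := 'rV[R]_n.
Local Notation H1 := (layer G 1).
Local Notation "x ** y" := (gmul G x y) (at level 40, left associativity).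
Context (ip : {dot V for idfun}) (ip_orth : layers_orthogonal G ip).
Context (d : V -> V -> R) (d_hom : homogeneous_distance G d).
Local Notation nrm := (d 0).
Context (Om : set V) (Om_open : open Om).
Context (u : V -> R) (u_conv : hconvex G Om u).

Lemma hsegmentP x h : hsegment h `<=` gmul G (ginv G x) @` Om ->
  forall t, 0 <= t <= 1 -> Om (x ** (t *: h)).
Proof.
move=> seg t t01; have [|y Oy] := seg (t *: h); first by exists t.
by rewrite ginvE => <-; rewrite gmulVK.
Qed.

(** Secant slopes of [u] along a horizontal segment increase. *)
Lemma hsecant x h r : h \in H1 -> (forall t, 0 <= t <= 1 -> Om (x ** (t *: h))) ->
  0 < r -> r <= 1 -> quot G u x r h <= u (x ** h) - u x.
Proof.
move=> hH seg r0 r1; rewrite /quot (dilation_h _ hH) ler_pdivrMr//.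
have := hconvex_line u_conv hH seg (l := r); rewrite (ltW r0) r1 => /(_ isT).
by rewrite mulrC; lra.
Qed.

Lemma small_segment x h : Om x -> h \in H1 -> exists2 e : R, 0 < e &
  forall r, 0 < r -> r < e -> hsegment (r *: h) `<=` gmul G (ginv G x) @` Om.
Proof.
move=> Ox hH.
have [m m0 mO] := open_dball d_hom (open_nbhs_nbhs (conj Om_open Ox)).
exists (m / (nrm h + 1)).
  by rewrite divr_gt0// ltr_wpDl// (dist_ge0 d_hom).
move=> r r0; rewrite ltr_pdivlMr ?ltr_wpDl ?(dist_ge0 d_hom)// => rm _ [t /= + <-].
rewrite in_itv/= => /andP[t0 t1]; exists (x ** (t *: (r *: h))); last first.
  by rewrite ginvE gmulKV.
apply: mO; rewrite (dist_mulr d_hom) scalerA (nrmZ d_hom)// ger0_norm ?mulr_ge0 ?(ltW r0)//.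
apply: le_lt_trans rm; rewrite mulrDr mulr1.
have := dist_ge0 d_hom 0 h => h0.
apply: ler_wpDr; first exact: ltW.
by rewrite ler_wpM2r// ler_piMl// ltW.
Qed.

(** An h-differential is the only candidate for an h-subgradient, and
    monotonicity of secant slopes makes it one. *)
Lemma differential_subdifferential x (L : {scalar V}) p :
  Om x -> is_hdifferential G ip d u x L -> p \in H1 ->
  (forall h, h \in H1 -> ip p h = L h) ->
  hsubdifferential G ip Om u x = [set p].
Proof.
move=> Ox [_ /eqoP oL] pH pL.
have slope h e : h \in H1 -> 0 < e ->
    ev0 (fun r : R => `|quot G u x r h - L h| <= e * nrm h).
  move=> hH e0; have [m m0 mP] := open_dball d_hom (oL e e0).
  exists (m / (nrm h + 1)).
    by rewrite divr_gt0// ltr_wpDl// (dist_ge0 d_hom).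
  move=> r r0; rewrite ltr_pdivlMr ?ltr_wpDl ?(dist_ge0 d_hom)// => rm.
  have rh : nrm (r *: h) = r * nrm h by rewrite (nrmZ d_hom)// gtr0_norm.
  have : nrm (r *: h) < m by rewrite rh; lra.
  move=> /mP /=; rewrite rh (ger0_norm (mulr_ge0 (ltW r0) (dist_ge0 d_hom 0 h))).
  rewrite linearZ/= /quot (dilation_h _ hH) => H.
  have -> : (u (x ** (r *: h)) - u x) / r - L h =
      (u (x ** (r *: h)) - u x - r * L h) / r.
    by field; rewrite gt_eqF.
  by rewrite normrM normfV (gtr0_norm r0) ler_pdivrMr// -mulrA [nrm h * r]mulrC.
apply/seteqP; split=> [q [qH qsub]|_ ->]; last first.
  split=> // h hH /hsegmentP seg; rewrite pL//.
  suff : L h <= u (x ** h) - u x by lra.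
  apply/ler_addgt0Pr => e e0.
  have e1 : 0 < e / (nrm h + 1) by rewrite divr_gt0// ltr_wpDl// (dist_ge0 d_hom).
  have [r r0 [r1 Hr]] := ev0_ex (ev0I (ev0_lt ltr01) (slope h _ hH e1)).
  have := hsecant hH seg r0 (ltW r1); move: Hr; rewrite ler_norml => /andP[h1 _].
  have : e / (nrm h + 1) * nrm h <= e.
    rewrite mulrAC ler_pdivrMr ?ltr_wpDl ?(dist_ge0 d_hom)//.
    by rewrite mulrDr mulr1 lerDl ltW.
  lra.
have qle h : h \in H1 -> ip q h <= L h.
  move=> hH; apply/ler_addgt0Pr => e e0.
  have e1 : 0 < e / (nrm h + 1) by rewrite divr_gt0// ltr_wpDl// (dist_ge0 d_hom).
  have seg : ev0 (fun r => hsegment (r *: h) `<=` gmul G (ginv G x) @` Om).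
    exact: small_segment.
  have [r r0 [sr Hr]] := ev0_ex (ev0I seg (slope h _ hH e1)).
  have rhH : r *: h \in H1 by rewrite rpredZ.
  have := qsub _ rhH sr; rewrite linearZr_LR/= => H.
  have : ip q h <= quot G u x r h.
    by rewrite /quot (dilation_h _ hH) ler_pdivlMr// mulrC; lra.
  move: Hr; rewrite ler_norml => /andP[_ h1].
  have : e / (nrm h + 1) * nrm h <= e.
    rewrite mulrAC ler_pdivrMr ?ltr_wpDl ?(dist_ge0 d_hom)//.
    by rewrite mulrDr mulr1 lerDl ltW.
  lra.
apply/eqP; rewrite -subr_eq0; apply/eqP/(ip_eq0 (ip := ip)).
have qpH : q - p \in H1 by rewrite rpredB.
have h1 := qle _ qpH; have := qle (- (q - p)); rewrite rpredN => /(_ qpH).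
rewrite linearNr/= linearN/= -pL// in h1 * => h2.
rewrite linearBl/=; lra.
Qed.

End Differentiability.

(** * Unique subgradients are differentials *)

Lemma proj1_dilation (R : realType) (n : nat) (G : stratified_group R n)
    (r : R) (z : 'rV[R]_n) : proj1 G (dilation G r z) = r *: proj1 G z.
Proof.
elim/(layer_ind (G := G)): z => [z w IHz IHw|j z j0 zj].
  by rewrite dilationD !proj1D IHz IHw scalerDr.
rewrite (dilation_layer _ j0 zj) proj1Z.
have [->|j1] := eqVneq j 1%N; first by rewrite expr1.
by rewrite (proj1_layer _ zj) ?scaler0//; lia.
Qed.

Section Converse.
Context (R : realType) (n : nat) (G : stratified_group R n).
Local Notation V := 'rV[R]_n.
Local Notation H1 := (layer G 1).
Local Notation "x ** y" := (gmul G x y) (at level 40, left associativity).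
Context (ip : {dot V for idfun}) (ip_orth : layers_orthogonal G ip).
Context (d : V -> V -> R) (d_hom : homogeneous_distance G d).
Local Notation nrm := (d 0).
Context (Om : set V) (Om_open : open Om).
Context (u : V -> R) (u_conv : hconvex G Om u).
Context (u_meas : lebesgue_measurable_fun Om u).
Context (x : V) (Om_x : Om x).

Lemma hconvex_regular : exists rho L, regular_at G d u x rho L.
Proof.
have [r [L [r0 L0 lip]]] := local_lipschitz d_hom u_conv Om_open u_meas Om_x.
have [m m0 mO] := open_dball d_hom (open_nbhs_nbhs (conj Om_open Om_x)).
exists (Num.min r m), L; split=> //; first by rewrite lt_min r0.
  by move=> y z; rewrite !lt_min => /andP[yr _] /andP[zr _]; exact: lip.
move=> y h l hH seg l01; apply: (hconvex_line u_conv) => // t /seg.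
by rewrite lt_min => /andP[_ /mO].
Qed.

(** The sphere is contained in the image under a dilation of a ball of the
    norm. *)
Lemma unit_sphere_compact : compact [set z : V | nrm z = 1].
Proof.
have [m m0 mP] := nrm_small d_hom (@ltr01 R).
have m20 : 0 < m / 2 by rewrite divr_gt0.
have ballc : compact [set z : V | `|z| <= 1].
  apply: bounded_closed_compact.
    exists 1; split; first exact: num_real.
    by move=> c c1 z /= z1; exact: le_trans z1 (ltW c1).
  have -> : [set z : V | `|z| <= 1] = (fun z : V => `|z|) @^-1` [set r | r <= 1] by [].
  apply: closed_comp; last exact: closed_le.
  by move=> z _; exact: norm_continuous.
have imc : compact (dilation G (m / 2)^-1 @` [set z : V | `|z| <= 1]).
  apply: continuous_compact => //; apply: continuous_subspaceT => z.
  apply: (@polymap_continuous _ _ _ (@mxcoord R 1 n)).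
    by move=> i; exact: mxcoord_continuous.
  by apply: dilation_polymap; [exact: polyfun_cst|exact: polymap_mxcoord].
apply: (subclosed_compact _ imc).
  have -> : [set z : V | nrm z = 1] = nrm @^-1` [set 1] by [].
  apply: closed_comp; last exact: closed_eq.
  by move=> z _; exact: (dist_continuous_r d_hom).
move=> z /= z1; exists (dilation G (m / 2) z); last by rewrite dilationK ?gt_eqF.
apply/ltW/mP; rewrite (nrm_dilation d_hom) ?(ltW m20)// z1 mulr1.
by rewrite ltr_pdivrMr// ltr_pMr// ltr1n.
Qed.

Lemma ev0_filter : Filter [set P : set R | ev0 P].
Proof.
split; first by exists 1.
  by move=> P Q; exact: ev0I.
by move=> P Q PQ; apply: ev0W => r _; exact: PQ.
Qed.

(** If the subdifferential is a point [p], then the upper blowup of [u] at [x]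
    equals the linear function [p] on the first layer: further blowups produce a
    linear minorant touching it in any prescribed direction, which represents a
    subgradient. Then the blowup is odd on the first layer, hence linear. *)
Lemma blowup_unique p : hsubdifferential G ip Om u x = [set p] ->
  forall z, blowup G u x z = ip p (proj1 G z).
Proof.
move=> subE; have [rho [L reg]] := hconvex_regular.
have subU := blowup_sublinear d_hom reg; set U := blowup G u x in subU *.
have pH : p \in H1.
  by have [] : hsubdifferential G ip Om u x p by rewrite subE.
have [l [K [C [lH _ gen]]]] := generation d_hom.
have gen' z : exists w : seq (R * V), (forall th, th \in w -> th.2 \in l) /\
    gprod G [seq th.1 *: th.2 | th <- w] = z.
  by have [w [_ wl wz]] := gen z; exists w; split=> // th /wl[].
have Up h0 : h0 \in H1 -> U h0 = ip p h0.
  move=> h0H.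
  have [sub0 e1 e2 ub0 _] := sublinear_blowup d_hom subU h0H.
  have [W [subW WU Wlin Wl]] := sublinear_linearize d_hom sub0 lH.
  have [_ linW] := sublinear_linear d_hom subW lH gen' Wl.
  have [q qH qW] := riesz ip H1 linW.
  have : hsubdifferential G ip Om u x q.
    split=> // h hH /hsegmentP seg; rewrite qW//.
    have Uh : U h <= u (x ** h) - u x.
      apply: (blowup_le d_hom reg); exists 1 => // r r0 r1.
      exact: (hsecant u_conv hH seg r0 (ltW r1)).
    rewrite -lerBrDl; apply: le_trans Uh.
    exact: le_trans (WU h hH) (ub0 h hH).
  rewrite subE => /= qp; rewrite -qp qW//.
  by have [-> _] := Wlin h0 h0H (etrans e2 (congr1 -%R (esym e1))).
have [Uproj _] : (forall z, U z = U (proj1 G z)) /\ linear_for *%R U.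
  apply: (sublinear_linear d_hom subU lH gen') => h hl.
  have hH : h \in H1 by move/allP: lH; apply.
  by rewrite !Up ?rpredN// linearNr.
by move=> z; rewrite Uproj Up// proj1_in.
Qed.

(** The lower limits of the difference quotients are controlled by the upper
    ones, through [q(z h) >= 2 q(z) - q(z h^-1)], by induction on the length of
    a word for [z]. *)
Lemma quot_cvg p : p \in H1 -> (forall z, blowup G u x z = ip p (proj1 G z)) ->
  forall z e, 0 < e ->
    ev0 (fun r => `|quot G u x r z - ip p (proj1 G z)| <= e).
Proof.
move=> pH bE; have [rho [L reg]] := hconvex_regular.
pose ell z := ip p (proj1 G z).
have ellM z h : ell (z ** h) = ell z + ell h.
  by rewrite /ell proj1M linearDr.
have ellN h : ell (- h) = - ell h.
  by rewrite /ell -scaleN1r proj1Z scaleN1r linearNr.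
have up z e : 0 < e -> ev0 (fun r => quot G u x r z < ell z + e).
  move=> e0; apply: (blowup_lt d_hom reg).
  by rewrite bE ltrDl.
have mid z h : h \in H1 -> ev0 (fun r =>
    2 * quot G u x r z <= quot G u x r (z ** h) + quot G u x r (z ** - h)).
  move=> hH; have h2H : 2 *: h \in H1 by rewrite rpredZ.
  have h01 : 0 <= (2^-1 : R) <= 1 by apply/andP; split; lra.
  have := quot_conv d_hom reg (z ** - h) h2H h01; apply: ev0W => r r0.
  rewrite scalerA mulVf ?pnatr_eq0// scale1r -gmulA gmulNV gmulg0.
  have -> : z ** - h ** (2 *: h) = z ** h.
    by rewrite -gmulA -scaleN1r gmul_line (_ : -1 + 2 = 1) ?scale1r//; ring.
  lra.
have low z e : 0 < e -> ev0 (fun r => ell z - e <= quot G u x r z).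
  have [l [K [C [lH _ gen]]]] := generation d_hom.
  have [w [_ wl <-]] := gen z.
  have {wl} : horizontal G [seq th.1 *: th.2 | th <- w].
    apply/allP => _ /mapP[th thw ->]; have [_ thl] := wl _ thw.
    by rewrite /= rpredZ//; move/allP: lH; apply.
  move: [seq _ | _ <- _] => {z gen} s.
  elim/last_ind: s e => [|s h IH] e.
    move=> _ e0; exists 1 => // r _ _.
    by rewrite quot0 /ell (_ : proj1 G 0 = 0) ?linear0r ?sub0r ?oppr_le0 ?(ltW e0)//;
      exact: proj1_h (mem0v _).
  rewrite /horizontal all_rcons -/(horizontal G s) => /andP[hH sH] e0.
  rewrite -cats1 gprod_cat /= gmulg0; set z := gprod G s in IH *.
  have e3 : 0 < e / 3 by rewrite divr_gt0.
  apply: ev0W (ev0I (mid z h hH) (ev0I (IH _ sH e3) (up (z ** - h) _ e3))).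
  move=> r _ [h1 [h2]]; rewrite !ellM ellN; lra.
move=> z e e0; apply: ev0W (ev0I (up z e e0) (low z e e0)) => r _ [h1 h2].
by rewrite ler_norml -/(ell z); apply/andP; split; lra.
Qed.

(** Difference quotients are equi-Lipschitz, so that pointwise convergence is
    uniform on the unit sphere, which is differentiability. *)
Lemma unique_subgradient_differential p : hsubdifferential G ip Om u x = [set p] ->
  exists2 L : {scalar V}, is_hdifferential G ip d u x L & forall z, L z = ip p z.
Proof.
move=> subE; have bE := blowup_unique subE.
have pH : p \in H1.
  by have [] : hsubdifferential G ip Om u x p by rewrite subE.
have [rho [L reg]] := hconvex_regular; have [rho0 L0 _ _] := reg.
have subU := blowup_sublinear d_hom reg.
pose ell z := ip p (proj1 G z).
have ell_lip z w : `|ell z - ell w| <= L * d z w.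
  have := fun e (e0 : 0 < e) => ev0_ex (ev0I (quot_lip d_hom reg z w)
    (ev0I (quot_cvg pH bE z e0) (quot_cvg pH bE w e0))).
  move=> H; apply/ler_addgt0Pr => e e0.
  have [r _ [h1 [h2 h3]]] := H (e / 2) (divr_gt0 e0 (ltr0n _ 2)).
  move: h1 h2 h3; rewrite -/(ell z) -/(ell w) !ler_norml.
  by move=> /andP[? ?] /andP[? ?] /andP[? ?]; apply/andP; split; lra.
have unif e : 0 < e ->
    ev0 (fun r => forall z, nrm z = 1 -> `|quot G u x r z - ell z| <= e).
  move=> e0.
  have cover := (near_covering_withinP _).2
    ((compact_near_coveringP _).1 unit_sphere_compact).
  apply: (cover R [set P | ev0 P] (fun r z => `|quot G u x r z - ell z| <= e)).
    exact: ev0_filter.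
  move=> z /= z1; have e2 : 0 < e / 2 by rewrite divr_gt0.
  have e4 : 0 < e / 4 / (L + 1) by rewrite !divr_gt0// ltr_wpDl.
  exists ([set w | d z w < e / 4 / (L + 1)],
      [set r | [/\ 0 < r, r < rho & `|quot G u x r z - ell z| <= e / 2]]).
    split; first exact: (dball_nbhs d_hom z e4).
    have [a a0 aP] := ev0I (ev0_lt rho0) (quot_cvg pH bE z e2).
    by exists a => // r r0 ra; have [? ?] := aP r r0 ra; split.
  move=> [w r] /= [zw [r0 rrho qz]] w1.
  have Lzw : L * d z w <= e / 4.
    move: zw; rewrite ltr_pdivlMr ?ltr_wpDl// => /ltW; apply: le_trans.
    by rewrite mulrDr mulr1 mulrC lerDl (dist_ge0 d_hom).
  have q1 : `|quot G u x r z - quot G u x r w| <= L * d z w.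
    by apply: (quot_lip_at d_hom reg); rewrite ?z1 ?w1 ?mulr1.
  have := ell_lip z w; move: q1 qz; rewrite !ler_norml.
  by move=> /andP[? ?] /andP[? ?] /andP[? ?]; apply/andP; split; lra.
have ellE z : ip p z = ell z by exact: ip_proj1.
have lin : linear_for *%R (ip p : V -> R).
  by move=> a z w; rewrite linearDr/= linearZr_LR.
pose Lp : {scalar V} := HB.pack (ip p : V -> R)
  (GRing.isLinear.Build R V R *%R (ip p : V -> R) lin).
exists Lp => //; split.
  by move=> z; rewrite /= (pi1_proj1 ip_orth) ellE.
apply/eqoP => e e0 /=.
have [a a0 aP] := unif e e0.
apply: filterS (dball_nbhs d_hom 0 a0) => z za.
have [z0|z0] := eqVneq (nrm z) 0.
  by rewrite z0 (nrm0_eq0 d_hom z0) gmulg0 linear0r !subrr normr0 mulr0.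
have zp : 0 < nrm z by rewrite lt_neqAle eq_sym z0 (dist_ge0 d_hom).
pose w := dilation G (nrm z)^-1 z.
have w1 : nrm w = 1.
  by rewrite (nrm_dilation d_hom) ?invr_ge0 ?(ltW zp)// mulVf.
have wz : dilation G (nrm z) w = z by rewrite dilationVK.
have := aP (nrm z) zp za w w1; rewrite /quot wz ellE.
have -> : ell z = nrm z * ell w.
  by rewrite -{1}wz /ell proj1_dilation linearZr_LR.
move=> H; rewrite (gtr0_norm zp) -ler_pdivrMr//.
rewrite -{2}(gtr0_norm zp) -normfV -normrM mulrBl.
by rewrite [X in _ - X]mulrAC mulfV// mul1r.
Qed.

End Converse.

Theorem theorem1p3 (R : realType) (n : nat) (G : stratified_group R n)
    (ip : {dot 'rV[R]_n for idfun}) (ip_orth : layers_orthogonal G ip)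
    (d : 'rV[R]_n -> 'rV[R]_n -> R) (d_hom : homogeneous_distance G d)
    (Om : set 'rV[R]_n) (Om_open : open Om)
    (u : 'rV[R]_n -> R) (u_conv : hconvex G Om u)
    (u_meas : lebesgue_measurable_fun Om u)
    (x : 'rV[R]_n) (Om_x : Om x) :
  (hdifferentiable G ip d u x <->
     exists2 p, p \in layer G 1 & hsubdifferential G ip Om u x = [set p]) /\
  (forall p, hsubdifferential G ip Om u x = [set p] ->
     hgradient G ip d u x = p).
Proof.
split; first split.
- move=> [L dL].
  have linL : linear_for *%R L by move=> a z w; rewrite linearP.
  have [p pH pL] := riesz ip (layer G 1) linL.
  by exists p => //; exact: differential_subdifferential dL pH pL.
- move=> [p pH subE].
  have [L dL _] := unique_subgradient_differential ip_orth d_hom Om_open u_conv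
    u_meas Om_x subE.
  by exists L.
- move=> p subE.
  have [L dL LE] := unique_subgradient_differential ip_orth d_hom Om_open u_conv
    u_meas Om_x subE.
  have [pH _] : hsubdifferential G ip Om u x p by rewrite subE.
  apply: xget_unique; first by split=> //; exists L.
  move=> q [qH [M dM ME]].
  have := differential_subdifferential d_hom Om_open u_conv Om_x dM qH.
  by rewrite subE => /(_ (fun h _ => esym (ME h)))/seteqP[_ /(_ q erefl)].
Qed.
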